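(* Let $(X_t)_{t\in\mathbb{Z}}$ be a strictly stationary sequence of random variables with $\mathbb{E}X_0=0$, $\mathbb{E}X_0^2<\infty$, $\sigma_n\to\infty$ and $\rho(n)\to0$ as $n\to\infty$. Let $\alpha>0$ and $\beta\in(1/2,1)$. Assume that at least one of the following conditions (a), (b) holds: (a) $\mathbb{E}\big[X_0^2(\log^+|X_0|)^{2\alpha}\big]<\infty$ and $\rho(n)\le\alpha(\log n)^{-1}$ for every $n$ sufficiently large; (b) $\mathbb{E}\Big[X_0^2\exp\Big(\dfrac{2\alpha\,(2\log^+|X_0|)^{1-\beta}}{1-\beta}\Big)\Big]<\infty$ and $\rho(n)\le\alpha(\log n)^{-\beta}$ for every $n$ sufficiently large. Then $S_n/\sigma_n$ converges in distribution to the standard normal law $N(0,1)$ as $n\to\infty$.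
   Context: Notation: $\log$ is the logarithm to base $2$, $\log^+x=\log(x\vee1)$, and $\exp$ is the natural exponential. For a strictly stationary sequence $(X_t)_{t\in\mathbb{Z}}$ on a probability space, $S_n=\sum_{i=1}^n X_i$, $\sigma_n^2=\mathrm{var}(S_n)$ ($\sigma_n\ge 0$), $\mathcal{F}_m^n$ is the $\sigma$-field generated by $(X_t)_{m\le t\le n}$ for $-\infty\le m\le n\le\infty$, and the mixing coefficient is $$\rho(n)=\sup\{|\mathrm{corr}(f,g)|: f\in L_2(\mathcal{F}_{-\infty}^0),\ g\in L_2(\mathcal{F}_n^\infty)\}.$$ *)

(* Defs.v *)
From HB Require Import structures.
From mathcomp Require Import all_boot all_order all_algebra.
From mathcomp Require Import all_classical all_reals all_analysis measurable_realfun.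

Set Implicit Arguments.
Unset Strict Implicit.
Unset Printing Implicit Defensive.

Import Order.TTheory GRing.Theory Num.Theory.
Import numFieldNormedType.Exports.

Local Open Scope classical_set_scope.
Local Open Scope ring_scope.

Definition log2 (R : realType) (x : R) : R := ln x / ln 2.

(* log^+ x = log_2 (x \/ 1) *)
Definition logplus (R : realType) (x : R) : R := log2 (Num.max x 1).

Definition strictly_stationary (d : measure_display) (T : measurableType d)
    (R : realType) (P : probability T R) (X : int -> {RV P >-> R}) : Prop :=
  forall (k : nat) (t : k.-tuple int) (h : int) (B : set (k.-tuple R)),
    measurable B ->
    P ((fun w => [tuple X (tnth t i + h) w | i < k]) @^-1` B) =
    P ((fun w => [tuple X (tnth t i) w | i < k]) @^-1` B).
Arguments strictly_stationary {d T R} P X.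

(* F_m^n is the case where I is the interval of integers from m to n,
   m and n being possibly infinite. *)
Definition sigma_field (d : measure_display) (T : measurableType d)
    (R : realType) (P : probability T R) (X : int -> {RV P >-> R})
    (I : set int) : set (set T) :=
  <<s \bigcup_(t in I) preimage_set_system [set: T] (X t) measurable >>.
Arguments sigma_field {d T R} P X I.

(* Lfun gives square-integrability and measurability for the ambient
   sigma-field of T; the second condition is measurability for F. *)
Definition L2 (d : measure_display) (T : measurableType d)
    (R : realType) (P : probability T R) (F : set (set T)) : set (T -> R) :=
  [set f | f \in Lfun P 2%:E /\ preimage_set_system [set: T] f measurable `<=` F].

Definition stddev (d : measure_display) (T : measurableType d)
    (R : realType) (P : probability T R) (f : T -> R) : R :=
  Num.sqrt (fine 'V_P[f]).

(* Since 0^-1 = 0, the correlation is 0 when f or g has variance 0. *)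
Definition corr (d : measure_display) (T : measurableType d)
    (R : realType) (P : probability T R) (f g : T -> R) : R :=
  fine (covariance P f g) / (stddev P f * stddev P g).

(* The supremum is taken in \bar R, so that it needs no boundedness proof. *)
Definition rho (d : measure_display) (T : measurableType d)
    (R : realType) (P : probability T R) (X : int -> {RV P >-> R})
    (n : nat) : \bar R :=
  ereal_sup [set `|corr P fg.1 fg.2|%:E | fg in
    L2 P (sigma_field P X [set` `]-oo, 0%:Z]]) `*`
    L2 P (sigma_field P X [set` `[n%:Z, +oo[])].
Arguments rho {d T R} P X n.

Section partial_sums.
Context (d : measure_display) (T : measurableType d) (R : realType)
  (P : probability T R) (X : int -> {RV P >-> R}) (n : nat).

Definition partial_sum (w : T) : R := \sum_(1 <= i < n.+1) X i%:Z w.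

Definition sigma_n : R := stddev P partial_sum.

Definition normalized_sum (w : T) : R := partial_sum w / sigma_n.

Lemma measurable_partial_sum : measurable_fun [set: T] partial_sum.
Proof. exact: measurable_sum. Qed.

Lemma measurable_normalized_sum : measurable_fun [set: T] normalized_sum.
Proof. by apply: measurable_funM => //; exact: measurable_partial_sum. Qed.

HB.instance Definition _ :=
  isMeasurableFun.Build _ _ _ _ partial_sum measurable_partial_sum.

HB.instance Definition _ :=
  isMeasurableFun.Build _ _ _ _ normalized_sum measurable_normalized_sum.

End partial_sums.
Arguments partial_sum {d T R} P X n w.
Arguments sigma_n {d T R} P X n.
Arguments normalized_sum {d T R} P X n w.

(* mu is meant to be a probability measure on R: this is convergence of the
   distribution functions at every continuity point of that of mu. *)
Definition cvg_in_distribution (d : measure_display) (T : measurableType d)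
    (R : realType) (P : probability T R) (Y : nat -> {RV P >-> R})
    (mu : set R -> \bar R) : Prop :=
  forall x : R,
    {for x, continuous (fun y : R => mu `]-oo, y]%classic)} ->
    cdf (Y n) x @[n --> \oo] --> mu `]-oo, x]%classic.
Arguments cvg_in_distribution {d T R} P Y mu.

(* Main.v *)
(* Halving a sum of n variables, 2^j <= n < 2^(j+1), across a short gap doubles
   its variance up to a factor exp(O(rho(gap))). With Lam j the sum of the
   alpha i^(-beta), i <= j, iterating this gives c n exp(-Lam j) <= var S_n, and
   var (sum psi(X_t)) <= C n exp(Lam j) var psi(X_0) for centred psi(X_0).
   Truncate the variables at the level a = 2^(j/2) exp(-C1 D j), where D j is the
   sum of the i^(-theta beta), theta = 2/q. The moment condition is exactly what
   makes the contribution of the values above a negligible with respect to var S_n.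
   For the bounded part, a recursion over the scales n/2^i bounds the moment of
   order q in (2,3] by C sigma_n^q; there mixing costs rho^theta, and the
   exponent theta beta is summed by D. Hence S_n^2/sigma_n^2 is uniformly
   integrable. The theorem follows from Bernstein blocks, a fixed number of them
   separated by gaps of fixed length, and Lindeberg's replacement of one block at
   a time in P(x + sqrt s N <= a), whose heat equation turns a Gaussian block into an
   increment of s. *)

Require Import Defs.
From HB Require Import structures.
From mathcomp Require Import all_boot all_order all_algebra.
From mathcomp Require Import all_classical all_reals all_analysis measurable_realfun.
From mathcomp Require Import ring lra zify.
Set Implicit Arguments.
Unset Strict Implicit.
Unset Printing Implicit Defensive.
Import Order.TTheory GRing.Theory Num.Theory.
Import numFieldNormedType.Exports.
Local Open Scope classical_set_scope.
Local Open Scope ring_scope.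

(** * Real-valued expectation and the L2 seminorm *)

(** The two bounds on variances differ by the factor [expR (2 * Lam J)], so the tail of X_0^2 above
    a must be small against its inverse; since 2 log a is J up to a term of lower order, the weights
    in (a) and (b) are this factor written as a function of a. The obstacle is that lower order
    term, C1 D J. Moments of order q = 2 p are compared through their p-th roots, so a coefficient
    rho costs rho^(1/p), theta = 1/p < 1, and D J is of order J^u with u = 1 - theta beta, larger
    than Lam J. In (b), with s = 1 - beta, (J - c J^u)^s differs from J^s by at most c J^(u + s -
    1), which is bounded as soon as theta >= 1/beta - 1. Such a theta < 1, that is some q > 2,
    exists precisely because beta > 1/2. In (a), losing a constant factor in log a is harmless and q
    = 3 is enough. The inequality beta > 1/2 also makes the squares of the mixing rates summable
    over the scales, so that second order terms in a halving do not disturb Lam. *)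

Section expectation.
Context (d : measure_display) (T : measurableType d) (R : realType)
  (P : probability T R).
Implicit Types f g h : T -> R.

Definition Ex f : R := Rintegral P setT f.
Definition integr f : Prop := P.-integrable setT (EFin \o f).
Definition sqint f : Prop :=
  measurable_fun setT f /\ integr (fun w => f w ^+ 2).

Lemma integr_meas f : integr f -> measurable_fun setT f.
Proof. by move=> /integrableP[/measurable_EFinP]. Qed.

Lemma integr_le f g : measurable_fun setT f -> integr g ->
  (forall w, `|f w| <= g w) -> integr f.
Proof.
move=> mf ig fg; apply: le_integrable ig => //=; first exact/measurable_EFinP.
by move=> w _; rewrite lee_fin (le_trans (fg w))// ler_norm.
Qed.

Lemma integr_cst (c : R) : integr (fun=> c).
Proof. by apply: finite_measure_integrable_cst. Qed.

Lemma integr_bnd f (c : R) : measurable_fun setT f ->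
  (forall w, `|f w| <= c) -> integr f.
Proof. move=> mf; exact: (integr_le mf (integr_cst c)). Qed.

Lemma integrD f g : integr f -> integr g -> integr (fun w => f w + g w).
Proof. by move=> i1 i2; have := integrableD measurableT i1 i2. Qed.

Lemma integrZ f (c : R) : integr f -> integr (fun w => c * f w).
Proof. by move=> i1; have := integrableZl measurableT c i1. Qed.

Lemma integrN f : integr f -> integr (fun w => - f w).
Proof.
move=> /(integrZ (-1)); apply: eq_integrable => // w _ /=.
by rewrite mulN1r.
Qed.

Lemma integrB f g : integr f -> integr g -> integr (fun w => f w - g w).
Proof. by move=> i1 i2; apply: integrD => //; exact: integrN. Qed.

Lemma integr_abs f : integr f -> integr (fun w => `|f w|).
Proof. exact: integrable_norm. Qed.

Lemma ExD f g : integr f -> integr g ->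
  Ex (fun w => f w + g w) = Ex f + Ex g.
Proof. exact: RintegralD. Qed.

Lemma ExB f g : integr f -> integr g ->
  Ex (fun w => f w - g w) = Ex f - Ex g.
Proof. exact: RintegralB. Qed.

Lemma ExZ f (c : R) : integr f -> Ex (fun w => c * f w) = c * Ex f.
Proof. exact: RintegralZl. Qed.

Lemma Ex_cst (c : R) : Ex (fun=> c) = c.
Proof. by rewrite /Ex Rintegral_cst// [X in fine X](@probability_setT _ _ _ P) mulr1. Qed.

Lemma Ex_le f g : integr f -> integr g -> (forall w, f w <= g w) ->
  Ex f <= Ex g.
Proof. by move=> i1 i2 h; apply: le_Rintegral => // w _; exact: h. Qed.

Lemma Ex_ge0 f : (forall w, 0 <= f w) -> 0 <= Ex f.
Proof. by move=> h; apply: Rintegral_ge0. Qed.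

Lemma eq_Ex f g : f =1 g -> Ex f = Ex g.
Proof. by move=> fg; apply: eq_Rintegral => w _; exact: fg. Qed.

Lemma eq_integr f g : f =1 g -> integr f -> integr g.
Proof. by move=> /funext ->. Qed.

Lemma Ex_abs f : integr f -> `|Ex f| <= Ex (fun w => `|f w|).
Proof. exact: le_normr_Rintegral. Qed.

Lemma Ex_bnd f (c : R) : integr f -> (forall w, `|f w| <= c) -> `|Ex f| <= c.
Proof.
move=> i1 h; apply: (le_trans (Ex_abs i1)); rewrite -(Ex_cst c).
by apply: Ex_le => //; [exact: integr_abs|exact: integr_cst].
Qed.

Lemma Ex_EFin f : integr f -> ((Ex f)%:E = \int[P]_w (f w)%:E)%E.
Proof. by move=> i; rewrite /Ex /Rintegral fineK// integrable_fin_num. Qed.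

Lemma Ex_indic (A : set T) : measurable A -> Ex (\1_A) = fine (P A).
Proof. by move=> mA; rewrite /Ex /Rintegral integral_indic// setIT. Qed.

Lemma sqint_meas f : sqint f -> measurable_fun setT f. Proof. by case. Qed.

Lemma sqint_sq f : sqint f -> integr (fun w => f w ^+ 2). Proof. by case. Qed.

Lemma sqint_le f g : measurable_fun setT f -> sqint g ->
  (forall w, `|f w| <= `|g w|) -> sqint f.
Proof.
move=> mf [mg ig] fg; split => //; apply: integr_le ig _.
  exact: measurable_funX.
move=> w; rewrite ger0_norm ?sqr_ge0// -[f w ^+ 2]real_normK ?num_real//.
by rewrite -[leRHS]real_normK ?num_real// lerXn2r ?nnegrE.
Qed.

Lemma sqint_mul f g : sqint f -> sqint g -> integr (fun w => f w * g w).
Proof.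
move=> [mf i1] [mg i2]; apply: integr_le (integrD i1 i2) _.
  exact: measurable_funM.
move=> w; rewrite normrM; have := sqr_ge0 (`|f w| - `|g w|).
rewrite -[f w ^+ 2]real_normK ?num_real// -[g w ^+ 2]real_normK ?num_real//.
have := normr_ge0 (f w); have := normr_ge0 (g w); nra.
Qed.

Lemma sqint_cst (c : R) : sqint (fun=> c).
Proof. by split; [exact: measurable_cst|exact: integr_cst]. Qed.

Lemma sqint_integr f : sqint f -> integr f.
Proof.
move=> h; have := sqint_mul h (sqint_cst 1).
by apply: eq_integr => w; rewrite mulr1.
Qed.

Lemma sqint_bnd f (c : R) : measurable_fun setT f ->
  (forall w, `|f w| <= c) -> sqint f.
Proof.
move=> mf h; apply: (sqint_le mf (sqint_cst c)) => w.
by rewrite (le_trans (h w))// ler_norm.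
Qed.

Lemma sqintD f g : sqint f -> sqint g -> sqint (fun w => f w + g w).
Proof.
move=> h1 h2; split; first exact: measurable_funD (sqint_meas h1) (sqint_meas h2).
have := integrD (integrD (sqint_sq h1) (integrZ 2 (sqint_mul h1 h2))) (sqint_sq h2).
by apply: eq_integr => w; ring.
Qed.

Lemma sqintZ f (c : R) : sqint f -> sqint (fun w => c * f w).
Proof.
move=> [mf h]; split; first exact: measurable_funM.
by have := integrZ (c ^+ 2) h; apply: eq_integr => w; ring.
Qed.

Lemma eq_sqint f g : f =1 g -> sqint f -> sqint g.
Proof. by move=> /funext ->. Qed.

Lemma sqintN f : sqint f -> sqint (fun w => - f w).
Proof. by move=> /(sqintZ (-1)); apply: eq_sqint => w; rewrite mulN1r. Qed.

Lemma sqintB f g : sqint f -> sqint g -> sqint (fun w => f w - g w).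
Proof. by move=> h1 h2; apply: sqintD => //; exact: sqintN. Qed.

Lemma sqint_sum (I : Type) (s : seq I) (F : I -> T -> R) :
  (forall i, sqint (F i)) -> sqint (fun w => \sum_(i <- s) F i w).
Proof.
move=> h; elim: s => [|i s IH].
  by apply: eq_sqint (sqint_cst 0) => w; rewrite big_nil.
by apply: eq_sqint (sqintD (h i) IH) => w; rewrite big_cons.
Qed.

Lemma integr_sum (I : Type) (s : seq I) (F : I -> T -> R) :
  (forall i, integr (F i)) -> integr (fun w => \sum_(i <- s) F i w).
Proof.
move=> h; elim: s => [|i s IH].
  by apply: eq_integr (integr_cst 0) => w; rewrite big_nil.
by apply: eq_integr (integrD (h i) IH) => w; rewrite big_cons.
Qed.

Lemma Ex_sum (I : Type) (s : seq I) (F : I -> T -> R) :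
  (forall i, integr (F i)) ->
  Ex (fun w => \sum_(i <- s) F i w) = \sum_(i <- s) Ex (F i).
Proof.
move=> h; elim: s => [|i s IH].
  by rewrite big_nil -[RHS](Ex_cst 0); apply: eq_Ex => w; rewrite big_nil.
rewrite big_cons -IH -ExD//; last exact: integr_sum.
by apply: eq_Ex => w; rewrite big_cons.
Qed.

Definition norm2 f : R := Num.sqrt (Ex (fun w => f w ^+ 2)).

Lemma n2_ge0 f : 0 <= norm2 f. Proof. exact: sqrtr_ge0. Qed.

Lemma n2_sqr f : norm2 f ^+ 2 = Ex (fun w => f w ^+ 2).
Proof. by rewrite sqr_sqrtr// Ex_ge0// => w; exact: sqr_ge0. Qed.

(** Nonnegativity of the quadratic form E (x f + y g)^2 in (x, y), evaluated at (b, a) and (b, -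
    a). *)
Lemma Ex_CS f g : sqint f -> sqint g ->
  `|Ex (fun w => f w * g w)| <= norm2 f * norm2 g.
Proof.
move=> hf hg; set c := Ex _; set a := norm2 f; set b := norm2 g.
have a0 : 0 <= a by exact: n2_ge0.
have b0 : 0 <= b by exact: n2_ge0.
have key (x y : R) : 0 <= x ^+ 2 * a ^+ 2 + 2 * (x * y) * c + y ^+ 2 * b ^+ 2.
  rewrite /a /b !n2_sqr /c -!ExZ; [|exact: sqint_sq|exact: sqint_mul|exact: sqint_sq].
  have i1 := integrZ (x ^+ 2) (sqint_sq hf).
  have i2 := integrZ (y ^+ 2) (sqint_sq hg).
  have i3 := integrZ (2 * (x * y)) (sqint_mul hf hg).
  rewrite -ExD// -ExD//; last exact: integrD.
  apply: Ex_ge0 => w; rewrite [leRHS](_ : _ = (x * f w + y * g w) ^+ 2); last by ring.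
  exact: sqr_ge0.
have [ab0|ab0] := eqVneq (a * b) 0.
  suff -> : c = 0 by rewrite normr0 mulr_ge0.
  move/eqP : ab0; rewrite mulf_eq0 => /orP[]/eqP e0.
    (* With a = 0 these values turn the form into - (b^2 + 2) c^2, which forces c = 0. *)
    have := key (b ^+ 2 + 1) (- c); rewrite e0 => h; apply/eqP.
    rewrite -sqrf_eq0 eq_le sqr_ge0 andbT; have := sqr_ge0 b; have := sqr_ge0 c; nra.
  have := key (- c) (a ^+ 2 + 1); rewrite e0 => h; apply/eqP.
  rewrite -sqrf_eq0 eq_le sqr_ge0 andbT; have := sqr_ge0 a; have := sqr_ge0 c; nra.
have ab : 0 < a * b by rewrite lt_neqAle eq_sym ab0 mulr_ge0.
have h1 := key b a; have h2 := key b (- a).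
by rewrite ler_norml; apply/andP; split; nra.
Qed.

Lemma n2D f g : sqint f -> sqint g -> norm2 (fun w => f w + g w) <= norm2 f + norm2 g.
Proof.
move=> hf hg; have h := Ex_CS hf hg.
have a0 := n2_ge0 f; have b0 := n2_ge0 g.
rewrite -(@ler_pXn2r _ 2%N) ?nnegrE ?n2_ge0 ?addr_ge0// n2_sqr.
have -> : Ex (fun w => (f w + g w) ^+ 2) =
    norm2 f ^+ 2 + 2 * Ex (fun w => f w * g w) + norm2 g ^+ 2.
  rewrite !n2_sqr -ExZ; last exact: sqint_mul.
  rewrite -ExD; [|exact: sqint_sq|by apply: integrZ; exact: sqint_mul].
  rewrite -ExD; last 2 first.
  - by apply: integrD; [exact: sqint_sq|apply: integrZ; exact: sqint_mul].
  - exact: sqint_sq.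
  by apply: eq_Ex => w; ring.
have := ler_norm (Ex (fun w => f w * g w)).
nra.
Qed.

Lemma n2Z f (c : R) : sqint f -> norm2 (fun w => c * f w) = `|c| * norm2 f.
Proof.
move=> hf; rewrite /norm2 -sqrtr_sqr -sqrtrM ?sqr_ge0// -ExZ; last exact: sqint_sq.
by congr Num.sqrt; apply: eq_Ex => w; ring.
Qed.

Lemma eq_n2 f g : f =1 g -> norm2 f = norm2 g.
Proof. by move=> /funext ->. Qed.

Lemma n2N f : sqint f -> norm2 (fun w => - f w) = norm2 f.
Proof.
move=> hf; have := n2Z (-1) hf; rewrite normrN1 mul1r => <-.
by apply: eq_n2 => w; rewrite mulN1r.
Qed.

Lemma n2B f g : sqint f -> sqint g -> norm2 (fun w => f w - g w) <= norm2 f + norm2 g.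
Proof. by move=> hf hg; rewrite -(n2N hg); apply: n2D => //; exact: sqintN. Qed.

Lemma n2_le f g : sqint f -> sqint g -> (forall w, `|f w| <= `|g w|) ->
  norm2 f <= norm2 g.
Proof.
move=> hf hg h; rewrite ler_wsqrtr// Ex_le//; [exact: sqint_sq|exact: sqint_sq|].
move=> w; rewrite -[f w ^+ 2]real_normK ?num_real//.
by rewrite -[leRHS]real_normK ?num_real// lerXn2r ?nnegrE.
Qed.

Lemma n2_cst (c : R) : norm2 (fun=> c) = `|c|.
Proof. by rewrite /norm2 Ex_cst sqrtr_sqr. Qed.

Lemma Ex_n2 f : sqint f -> `|Ex f| <= norm2 f.
Proof.
move=> hf; have := Ex_CS hf (sqint_cst 1); rewrite n2_cst normr1 mulr1.
by congr (`|_| <= _); apply: eq_Ex => w; rewrite mulr1.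
Qed.

Definition same_law f g : Prop :=
  forall B : set R, measurable B -> P (f @^-1` B) = P (g @^-1` B).

(** Both sides are integrals of F against image measures on the line, which coincide. *)
Lemma same_law_integral f g (F : R -> \bar R) : measurable_fun setT f ->
  measurable_fun setT g -> same_law f g -> measurable_fun setT F ->
  (forall x, 0 <= F x)%E ->
  (\int[P]_w F (f w) = \int[P]_w F (g w))%E.
Proof.
move=> mf mg fg mF F0.
pose fm := [the {mfun T >-> R} of mfun_Sub (mem_set mf : f \in mfun)].
pose gm := [the {mfun T >-> R} of mfun_Sub (mem_set mg : g \in mfun)].
rewrite -(@ge0_integral_distribution _ _ T R R P fm F mF F0).
rewrite -(@ge0_integral_distribution _ _ T R R P gm F mF F0).
by apply: eq_measure_integral => B mB _; exact: fg.
Qed.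

Lemma same_law_integr f g (F : R -> R) : measurable_fun setT f ->
  measurable_fun setT g -> same_law f g -> measurable_fun setT F ->
  integr (fun w => F (f w)) -> integr (fun w => F (g w)).
Proof.
move=> mf mg fg mF /integrableP[_ h]; apply/integrableP; split.
  by apply/measurable_EFinP; exact: measurableT_comp.
rewrite (@same_law_integral _ _ (fun x => `|(F x)%:E|)%E mf mg fg) in h => //.
by apply: measurableT_comp => //; exact/measurable_EFinP.
Qed.

Lemma same_law_Ex f g (F : R -> R) : measurable_fun setT f ->
  measurable_fun setT g -> same_law f g -> measurable_fun setT F ->
  integr (fun w => F (f w)) -> Ex (fun w => F (f w)) = Ex (fun w => F (g w)).
Proof.
move=> mf mg fg mF h.
have h' := same_law_integr mf mg fg mF h.
(* The transfer is available for nonnegative functions, whence the positive and negative parts. *)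
have hp (k : T -> R) : measurable_fun setT k -> integr (fun w => F (k w)) ->
    Ex (fun w => F (k w)) = Ex (fun w => Num.max (F (k w)) 0)
      - Ex (fun w => Num.max (- F (k w)) 0).
  move=> mk ik; rewrite -ExB; last 2 first.
  - apply: integr_le (integr_abs ik) _.
      by apply: measurable_maxr => //; exact: measurableT_comp.
    by move=> w; rewrite ger0_norm ?le_max ?lexx ?orbT// ge_max ler_norm normr_ge0.
  - apply: integr_le (integr_abs ik) _.
      apply: measurable_maxr => //; apply: measurable_funN => //.
      exact: measurableT_comp.
    by move=> w; rewrite ger0_norm ?le_max ?lexx ?orbT// ge_max -normrN ler_norm normr_ge0.
  by apply: eq_Ex => w; have [?|?] := leP (F (k w)) 0; have [?|?] := leP (- F (k w)) 0; lra.
rewrite (hp _ mf h) (hp _ mg h'); congr (fine _ - fine _).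
  apply: (@same_law_integral _ _ (fun x => (Num.max (F x) 0)%:E)) => //.
    by apply/measurable_EFinP; exact: measurable_maxr.
  by move=> x; rewrite lee_fin le_max lexx orbT.
apply: (@same_law_integral _ _ (fun x => (Num.max (- F x) 0)%:E)) => //.
  apply/measurable_EFinP; apply: measurable_maxr => //.
  exact: measurable_funN.
by move=> x; rewrite lee_fin le_max lexx orbT.
Qed.

Lemma Lfun2_sqint f : f \in Lfun P 2%:E -> sqint f.
Proof.
move=> hf; split; first by move: (sub_Lfun_mfun hf); rewrite inE.
by have := Lfun2_integrable_sqr hf.
Qed.

End expectation.

Ltac integ := solve
  [ assumption | exact: integr_cst | exact: sqint_cst
  | apply: sqint_integr; assumption | apply: sqint_mul; assumption
  | apply: integrD; integ | apply: integrB; integ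
  | apply: integrN; integ | apply: integrZ; integ
  | apply: sqintD; integ | apply: sqintB; integ
  | apply: sqintN; integ | apply: sqintZ; integ
  | apply: sqint_sq; integ | apply: sqint_mul; integ
  | apply: sqint_integr; integ ].

(** * Mixing and stationarity for sums over finite sets of times *)

Section mixing.
Context (d : measure_display) (T : measurableType d) (R : realType)
  (P : probability T R) (X : int -> {RV P >-> R}).

Lemma sqint_Lfun2 (f : T -> R) : sqint P f -> f \in Lfun P 2%:E.
Proof.
move=> [mf /integrableP[_ i2]]; rewrite inE/=; apply/andP; split; rewrite inE//=.
rewrite /finite_norm unlock; apply: poweR_lty.
apply: le_lt_trans i2; apply: ge0_le_integral => //.
- by move=> t _; exact: poweR_ge0.
- apply/(@measurable_EFinP _ _ _ _ (fun x => `|f x| `^ 2)).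
  apply/(@measurableT_comp _ _ _ _ _ _ (fun x : R => x `^ 2)%R) => //.
  exact/measurableT_comp.
- apply: measurableT_comp => //; apply/measurable_EFinP; exact: measurable_funX.
- by move=> t _/=; rewrite lee_fin normrX powR_mulrn.
Qed.

Lemma cov_Ex (f g : T -> R) : sqint P f -> sqint P g ->
  fine (covariance P f g) = Ex P (fun w => f w * g w) - Ex P f * Ex P g.
Proof.
move=> hf hg; have hf2 := sqint_Lfun2 hf; have hg2 := sqint_Lfun2 hg.
have P1 : P [set: T] \is a fin_num by exact: fin_num_measure.
rewrite covarianceE ?Lfun2_mul_Lfun1// ?Lfun_subset12//.
have e (h : T -> R) : integr P h -> ('E_P[h] = (Ex P h)%:E)%E.
  by move=> ih; rewrite Ex_EFin// unlock.
rewrite (e (f * g)%R) ?(e f) ?(e g)//; try exact: sqint_integr.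
exact: sqint_mul.
Qed.

Lemma stddev_n2 (f : T -> R) : sqint P f -> Ex P f = 0 -> stddev P f = norm2 P f.
Proof.
move=> hf e0; rewrite /stddev /variance cov_Ex// e0 mulr0 subr0 /norm2.
by congr Num.sqrt; apply: eq_Ex => w; rewrite expr2.
Qed.

Lemma stddevE (f : T -> R) : sqint P f ->
  stddev P f = norm2 P (fun w => f w - Ex P f).
Proof.
move=> hf; rewrite /stddev /variance cov_Ex// /norm2; congr Num.sqrt.
rewrite [RHS](_ : _ = Ex P (fun w => (f w * f w - (2 * Ex P f) * f w) + Ex P f ^+ 2)).
  have i1 := sqint_mul hf hf; have i2 := integrZ (2 * Ex P f) (sqint_integr hf).
  rewrite ExD ?ExB ?ExZ ?Ex_cst; try integ.
  by ring.
by apply: eq_Ex => w; ring.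
Qed.

Lemma stddev_le (f : T -> R) : sqint P f -> stddev P f <= norm2 P f.
Proof.
move=> hf; rewrite /stddev /variance cov_Ex// /norm2 ler_wsqrtr//.
rewrite [X in X - _](@eq_Ex _ _ _ P _ (fun w => f w ^+ 2)); last first.
  by move=> w; rewrite expr2.
by rewrite -expr2 lerBlDr lerDl sqr_ge0.
Qed.

Lemma cov_le (f g : T -> R) : sqint P f -> sqint P g ->
  `|fine (covariance P f g)| <= stddev P f * stddev P g.
Proof.
move=> hf hg; rewrite cov_Ex// !stddevE//.
have cf := sqintB hf (sqint_cst P (Ex P f)).
have cg := sqintB hg (sqint_cst P (Ex P g)).
apply: le_trans (Ex_CS cf cg); rewrite le_eqVlt; apply/orP; left; apply/eqP.
congr (`|_|); symmetry; have iff := sqint_integr hf; have ig := sqint_integr hg.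
rewrite (@eq_Ex _ _ _ P _ (fun w => ((f w * g w - Ex P f * g w) - Ex P g * f w)
  + Ex P f * Ex P g)); last by move=> w; ring.
have i1 := sqint_mul hf hg; have i2 := integrZ (Ex P f) ig.
have i3 := integrZ (Ex P g) iff.
rewrite ExD ?ExB ?ExZ ?Ex_cst; try integ.
by ring.
Qed.

Definition past := [set` `]-oo, 0%:Z]] : set int.
Definition future (n : nat) := [set` `[n%:Z, +oo[] : set int.

(** The bound is stated with uncentred norms, weaker than standard deviations, because these are
    what the later estimates control. *)
Lemma cov_le_rho (n : nat) (r : R) (f g : T -> R) : (rho P X n <= r%:E)%E ->
  L2 P (sigma_field P X past) f -> L2 P (sigma_field P X (future n)) g ->
  `|Ex P (fun w => f w * g w) - Ex P f * Ex P g| <= r * (norm2 P f * norm2 P g).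
Proof.
move=> hr Lf Lg.
have hf : sqint P f by apply: Lfun2_sqint; case: Lf.
have hg : sqint P g by apply: Lfun2_sqint; case: Lg.
rewrite -cov_Ex//.
have hc : `|corr P f g| <= r.
  rewrite -lee_fin; apply: le_trans hr; apply: ereal_sup_ubound.
  by exists (f, g).
have r0 : 0 <= r by apply: le_trans hc.
have s0 (h : T -> R) : 0 <= stddev P h by exact: sqrtr_ge0.
apply: (@le_trans _ _ (r * (stddev P f * stddev P g))); last first.
  by apply: ler_wpM2l => //; apply: ler_pM => //; exact: stddev_le.
have hcov := cov_le hf hg.
(* In the degenerate case [corr] is 0 by convention and says nothing: the covariance vanishes by
   Cauchy-Schwarz. *)
have [e0|ne0] := eqVneq (stddev P f * stddev P g) 0.
  by rewrite e0 mulr0; rewrite e0 in hcov.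
have p0 : 0 < stddev P f * stddev P g by rewrite lt_neqAle eq_sym ne0 mulr_ge0.
rewrite -ler_pdivrMr//; apply: le_trans hc.
by rewrite /corr normrM normrV ?unitfE// (ger0_norm (ltW p0)).
Qed.

Definition Sx (psi : R -> R) (s : seq int) (w : T) : R :=
  \sum_(t <- s) psi (X t w).

Lemma Sx_cat psi s1 s2 w : Sx psi (s1 ++ s2) w = Sx psi s1 w + Sx psi s2 w.
Proof. by rewrite /Sx big_cat. Qed.

Lemma Sx_sigma_field (psi : R -> R) (I : set int) (s : seq int) : measurable_fun setT psi ->
  (forall t : int, t \in s -> I t) ->
  preimage_set_system [set: T] (Sx psi s) measurable `<=` sigma_field P X I.
Proof.
move=> mpsi; set G := \bigcup_(t in I) preimage_set_system [set: T] (X t) measurable.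
move=> hs.
(* Each [X t] is seen as a function on T carrying the sigma-field generated over I, where the usual
   closure properties of measurable functions apply. *)
have mX (t : int) : I t -> measurable_fun setT (X t : g_sigma_algebraType G -> R).
  move=> It _ B mB; apply: sub_sigma_algebra; exists t => //.
  by exists B.
have : measurable_fun setT (Sx psi s : g_sigma_algebraType G -> R).
  rewrite /Sx; elim: s hs => [|t s IH] hs.
    under eq_fun do rewrite big_nil; exact: measurable_cst.
  under eq_fun do rewrite big_cons.
  apply: measurable_funD.
    by apply: measurableT_comp => //; apply: mX; apply: hs; rewrite mem_head.
  by apply: IH => u us; apply: hs; rewrite inE us orbT.
by move=> h A [B mB <-]; exact: h.
Qed.

Lemma measurable_Sx (psi : R -> R) (s : seq int) : measurable_fun setT psi -> measurable_fun setT (Sx psi s).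
Proof.
move=> mpsi; rewrite /Sx; elim: s => [|t s IH].
  by under eq_fun do rewrite big_nil; exact: measurable_cst.
under eq_fun do rewrite big_cons.
by apply: measurable_funD => //; exact: measurableT_comp.
Qed.

Lemma Sx_L2 (psi : R -> R) (I : set int) (s : seq int) (F : R -> R) : measurable_fun setT psi ->
  measurable_fun setT F -> (forall t : int, t \in s -> I t) ->
  sqint P (fun w => F (Sx psi s w)) ->
  L2 P (sigma_field P X I) (fun w => F (Sx psi s w)).
Proof.
move=> mpsi mF hs h; split; first exact: sqint_Lfun2.
move=> A [B mB <-]; apply: (Sx_sigma_field mpsi hs).
exists (F @^-1` B); last by [].
by rewrite -[X in measurable X]setTI; exact: mF.
Qed.

(** The form in which mixing enters every later estimate: F and G are identities for variances,
    powers for moments, derivatives of the heat flow and truncated squares for the replacement of a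
    block. *)
Lemma Sx_mixing (psi1 psi2 : R -> R) (n : nat) (r : R) (s1 s2 : seq int)
    (F G : R -> R) :
  measurable_fun setT psi1 -> measurable_fun setT psi2 ->
  measurable_fun setT F -> measurable_fun setT G ->
  (rho P X n <= r%:E)%E ->
  (forall t : int, t \in s1 -> t <= 0) -> (forall t : int, t \in s2 -> n%:Z <= t) ->
  sqint P (fun w => F (Sx psi1 s1 w)) -> sqint P (fun w => G (Sx psi2 s2 w)) ->
  `|Ex P (fun w => F (Sx psi1 s1 w) * G (Sx psi2 s2 w))
    - Ex P (fun w => F (Sx psi1 s1 w)) * Ex P (fun w => G (Sx psi2 s2 w))|
  <= r * (norm2 P (fun w => F (Sx psi1 s1 w)) * norm2 P (fun w => G (Sx psi2 s2 w))).
Proof.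
move=> m1 m2 mF mG hr h1 h2 heatF hG.
have L1 : L2 P (sigma_field P X past) (fun w => F (Sx psi1 s1 w)).
  by apply: Sx_L2 => // t ts; rewrite /past /= in_itv /= h1.
have L3 : L2 P (sigma_field P X (future n)) (fun w => G (Sx psi2 s2 w)).
  by apply: Sx_L2 => // t ts; rewrite /future /= in_itv /= andbT h2.
exact: cov_le_rho hr L1 L3.
Qed.

Hypothesis stationaryX : strictly_stationary P X.

Lemma Sx_stationary (psi : R -> R) (s : seq int) (h : int) : measurable_fun setT psi ->
  same_law P (Sx psi [seq t + h | t <- s]) (Sx psi s).
Proof.
move=> mpsi B mB.
(* The sum is a measurable function of the vector of values, so its law inherits the invariance of
   the finite-dimensional laws. *)
pose H (v : (size s).-tuple R) : R := \sum_(i < size s) psi (tnth v i).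
have mH : measurable_fun setT H.
  rewrite /H; apply: measurable_sum => i; apply: measurableT_comp => //.
  exact: measurable_tnth.
have mHB : measurable (H @^-1` B).
  by rewrite -[X in measurable X]setTI; exact: mH.
have := stationaryX (in_tuple s) h mHB.
have e1 w : H [tuple X (tnth (in_tuple s) i) w | i < size s] = Sx psi s w.
  by rewrite /H /Sx [RHS]big_tnth; apply: eq_bigr => i _; rewrite tnth_mktuple.
have e2 w : H [tuple X (tnth (in_tuple s) i + h) w | i < size s] =
    Sx psi [seq t + h | t <- s] w.
  rewrite /H /Sx big_map [RHS]big_tnth.
  by apply: eq_bigr => i _; rewrite tnth_mktuple.
have e3 : Sx psi [seq t + h | t <- s] @^-1` B =
    (fun w => [tuple X (tnth (in_tuple s) i + h) w | i < size s]) @^-1` (H @^-1` B).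
  by apply/seteqP; split => w /=; rewrite e2.
have e4 : Sx psi s @^-1` B =
    (fun w => [tuple X (tnth (in_tuple s) i) w | i < size s]) @^-1` (H @^-1` B).
  by apply/seteqP; split => w /=; rewrite e1.
by rewrite e3 e4.
Qed.

End mixing.

(** * Sums over blocks of consecutive times *)

Definition blk (a : int) (n : nat) : seq int := [seq a + i%:Z | i <- iota 0 n].

Lemma blk_cat a m n : blk a (m + n) = blk a m ++ blk (a + m%:Z) n.
Proof.
rewrite /blk iotaD map_cat add0n; congr (_ ++ _).
rewrite -[m in iota m n]addn0 iotaDl -map_comp; apply: eq_map => i /=.
by rewrite PoszD addrA.
Qed.

Lemma blk_shift a b n : blk (a + b) n = [seq t + b | t <- blk a n].
Proof. by rewrite /blk -map_comp; apply: eq_map => i /=; rewrite addrAC. Qed.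

Lemma mem_blk a n t : t \in blk a n -> (a <= t) && (t < a + n%:Z).
Proof. by move=> /mapP[i]; rewrite mem_iota => /andP[_ h] ->; lia. Qed.

Section blocks.
Context (d : measure_display) (T : measurableType d) (R : realType)
  (P : probability T R) (X : int -> {RV P >-> R}).
Hypothesis stationaryX : strictly_stationary P X.

Definition Tn (psi : R -> R) (n : nat) : T -> R := Sx X psi (blk 1 n).
Definition tau (psi : R -> R) (n : nat) : R := norm2 P (Tn psi n).

Lemma partial_sumE n : partial_sum P X n = Tn id n.
Proof.
apply/funext => w; rewrite /partial_sum /Tn /Sx /blk big_map.
rewrite big_add1 /= /index_iota subn0; apply: eq_bigr => i _.
by congr (X _ w); lia.
Qed.

Lemma blk_eqd (psi : R -> R) a b n : measurable_fun setT psi ->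
  same_law P (Sx X psi (blk a n)) (Sx X psi (blk b n)).
Proof.
move=> mpsi B mB; rewrite -(subrK b a) addrC blk_shift; exact: Sx_stationary.
Qed.

Section fixed_function.
Variable psi : R -> R.
Hypothesis mpsi : measurable_fun setT psi.

Lemma blk_integr (F : R -> R) a b n : measurable_fun setT F ->
  integr P (fun w => F (Sx X psi (blk a n) w)) ->
  integr P (fun w => F (Sx X psi (blk b n) w)).
Proof.
by move=> mF; apply: same_law_integr => //; first exact: measurable_Sx;
  first exact: measurable_Sx; exact: blk_eqd.
Qed.

Lemma blk_Ex (F : R -> R) a b n : measurable_fun setT F ->
  integr P (fun w => F (Sx X psi (blk a n) w)) ->
  Ex P (fun w => F (Sx X psi (blk a n) w)) =
  Ex P (fun w => F (Sx X psi (blk b n) w)).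
Proof.
by move=> mF; apply: same_law_Ex => //; first exact: measurable_Sx;
  first exact: measurable_Sx; exact: blk_eqd.
Qed.

Lemma Sx1 (t : int) w : Sx X psi (blk t 1) w = psi (X t w).
Proof. by rewrite /Sx /blk /= big_seq1 addr0. Qed.

Hypothesis psi2 : sqint P (fun w => psi (X 0 w)).

Lemma psiX_sqint t : sqint P (fun w => psi (X t w)).
Proof.
split; first exact: measurableT_comp.
have mF : measurable_fun setT (fun x : R => x ^+ 2) by exact: measurable_funX.
have := @blk_integr (fun x => x ^+ 2) 0 t 1 mF.
have e u : (fun w => Sx X psi (blk u 1) w ^+ 2) = (fun w => psi (X u w) ^+ 2).
  by apply/funext => w; rewrite Sx1.
by rewrite !e; apply; exact: sqint_sq.
Qed.

Lemma Sx_sqint s : sqint P (Sx X psi s).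
Proof. by apply: sqint_sum => t; exact: psiX_sqint. Qed.

Lemma blk_n2 a n : norm2 P (Sx X psi (blk a n)) = tau psi n.
Proof.
rewrite /tau /norm2 /Tn; congr Num.sqrt.
apply: (@blk_Ex (fun x => x ^+ 2)); first exact: measurable_funX.
by apply: sqint_sq; exact: Sx_sqint.
Qed.

Lemma tau_ge0 n : 0 <= tau psi n. Proof. exact: n2_ge0. Qed.

Lemma tau0 : tau psi 0 = 0.
Proof.
rewrite -(normr0 R) -(n2_cst P 0); apply: eq_n2 => w.
by rewrite /Tn /Sx /blk big_nil.
Qed.

Lemma Sx_blkD a m n w : Sx X psi (blk a (m + n)) w =
  Sx X psi (blk a m) w + Sx X psi (blk (a + m%:Z) n) w.
Proof. by rewrite blk_cat Sx_cat. Qed.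

Lemma tauD m n : tau psi (m + n) <= tau psi m + tau psi n.
Proof.
rewrite -(blk_n2 (1 + m%:Z) n).
apply: le_trans (n2D (Sx_sqint (blk 1 m)) (Sx_sqint _)).
by rewrite /tau (eq_n2 _ (Sx_blkD 1 m n)).
Qed.

Lemma tauB m n : tau psi n <= tau psi (m + n) + tau psi m.
Proof.
rewrite -(blk_n2 (1 + m%:Z) n).
apply: le_trans (n2B (Sx_sqint (blk 1 (m + n))) (Sx_sqint (blk 1 m))).
by rewrite le_eqVlt; apply/orP; left; apply/eqP; apply: eq_n2 => w; rewrite Sx_blkD; ring.
Qed.

Lemma tau_mul n : tau psi n <= n%:R * tau psi 1.
Proof.
elim: n => [|n IH]; first by rewrite tau0 mul0r.
by rewrite -addn1 natrD mulrDl mul1r (le_trans (tauD _ _))// lerD.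
Qed.

Hypothesis psi0 : Ex P (fun w => psi (X 0 w)) = 0.

Lemma psiX_mean t : Ex P (fun w => psi (X t w)) = 0.
Proof.
have := @blk_Ex id 0 t 1 (@measurable_id _ _ _).
have e u : (fun w => id (Sx X psi (blk u 1) w)) = (fun w => psi (X u w)).
  by apply/funext => w; rewrite Sx1.
by rewrite !e psi0 => ->//; exact: sqint_integr.
Qed.

Lemma Sx_mean s : Ex P (Sx X psi s) = 0.
Proof.
rewrite (@Ex_sum _ _ _ P _ s (fun t w => psi (X t w))); last first.
  by move=> t; exact/sqint_integr/psiX_sqint.
by apply: big1 => t _; exact: psiX_mean.
Qed.

Variables (b : nat -> R) (N0 : nat).
Hypothesis hrho : forall n, (N0 <= n)%N -> (rho P X n <= (b n)%:E)%E.

(** The two blocks of length m are put on both sides of time 0, where [rho] is defined. The whole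
    discrepancy is twice the covariance of A and B = G + B': B' lies beyond a gap of length g and is
    handled by mixing, the part G inside the gap by Cauchy-Schwarz. *)
Lemma tau_double m g : (g <= m)%N -> (N0 <= g)%N ->
  `|tau psi (m + m) ^+ 2 - 2 * tau psi m ^+ 2| <=
  2 * (b g * (tau psi m * (tau psi m + tau psi g)) + tau psi m * tau psi g).
Proof.
move=> gm Ng.
pose A := Sx X psi (blk (1 - m%:Z) m); pose B := Sx X psi (blk 1 m).
pose G := Sx X psi (blk 1 g); pose B' := Sx X psi (blk (1 + g%:Z) (m - g)).
have hA : sqint P A by exact: Sx_sqint.
have hB : sqint P B by exact: Sx_sqint.
have hG : sqint P G by exact: Sx_sqint.
have hB' : sqint P B' by exact: Sx_sqint.
have eB w : B w = G w + B' w by rewrite -Sx_blkD subnKC.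
have nA : norm2 P A = tau psi m by exact: blk_n2.
have nB : norm2 P B = tau psi m by exact: blk_n2.
have nG : norm2 P G = tau psi g by exact: blk_n2.
have nB' : norm2 P B' <= tau psi m + tau psi g.
  by rewrite -nB -nG (@eq_n2 _ _ _ _ B' (fun w => B w - G w)) ?n2B// => w; rewrite eB; ring.
have -> : tau psi (m + m) ^+ 2 - 2 * tau psi m ^+ 2 = 2 * Ex P (fun w => A w * B w).
  rewrite -(blk_n2 (1 - m%:Z)) (@eq_n2 _ _ _ _ _ (fun w => A w + B w)); last first.
    by move=> w; rewrite Sx_blkD /A /B; congr (_ + Sx X psi (blk _ _) w); lia.
  rewrite mulr_natl mulr2n -{1}nA -{1}nB !n2_sqr.
  rewrite (@eq_Ex _ _ _ P _ (fun w => (A w ^+ 2 + 2 * (A w * B w)) + B w ^+ 2));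
    last by move=> w; ring.
  by rewrite !ExD ?ExZ; try integ; ring.
rewrite normrM ger0_norm// ler_wpM2l//.
rewrite (@eq_Ex _ _ _ P _ (fun w => A w * B' w + A w * G w)); last first.
  by move=> w; rewrite eB; ring.
rewrite ExD; try integ.
rewrite (le_trans (ler_normD _ _))// lerD//; last by rewrite -nA -nG; exact: Ex_CS.
have EA : Ex P A = 0 by exact: Sx_mean.
(* The mixing inequality for the constant function 1 has a nonnegative left side and the right side
   [b g]. *)
have b0 : 0 <= b g.
  have hbg := hrho Ng; have := @Sx_mixing _ _ _ P X psi psi g (b g) [::] [::] (fun=> 1) (fun=> 1)
   mpsi mpsi (measurable_cst _) (measurable_cst _) hbg.
  rewrite !n2_cst normr1 !mulr1 => h; apply: (le_trans (normr_ge0 _)); apply: h => //.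
  - exact: sqint_cst.
  - exact: sqint_cst.
apply: (@le_trans _ _ (b g * (norm2 P A * norm2 P B'))); last first.
  by rewrite nA; apply: ler_wpM2l => //; apply: ler_wpM2l => //; exact: tau_ge0.
have := @Sx_mixing _ _ _ P X psi psi g (b g) (blk (1 - m%:Z) m) (blk (1 + g%:Z) (m - g))
  id id mpsi mpsi (@measurable_id _ _ _) (@measurable_id _ _ _) (hrho Ng).
rewrite -[Ex P (fun w => id (Sx X psi (blk (1 - m%:Z) m) w))]/(Ex P A) EA mul0r subr0.
apply => //.
- by move=> t /mem_blk; lia.
- by move=> t /mem_blk; lia.
Qed.

End fixed_function.

End blocks.

(** * Growth of the variances *)

Section real.
Context {R : realType}.
Implicit Types x y s v : R.

Lemma ln_le_sub1 v : 0 < v -> ln v <= v - 1.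
Proof.
by move=> v0; have := @le_ln1Dx R (v - 1); rewrite [1 + _]addrC subrK; apply; lra.
Qed.

(** Young's inequality for the product of v^s and 1, with exponents 1/s and 1/(1 - s). *)
Lemma powR_le_lin v s : 0 <= v -> 0 < s -> s < 1 -> v `^ s <= 1 + s * (v - 1).
Proof.
move=> v0 s0 s1.
have q0 : 0 < 1 - s by lra.
have := @conjugate_powR R (v `^ s) 1 s^-1 (1 - s)^-1 (powR_ge0 _ _) ler01.
rewrite !invr_gt0 !invrK -powRrM mulfV ?gt_eqF// powRr1// powR1 mul1r mulr1 => h.
have := h s0 q0; lra.
Qed.

(** A discrete primitive of x^(s - 1): it makes multiples of x^s / s usable as [Lam] and [D], whose
    increments must dominate the rates. *)
Lemma powR_increment x s : 1 <= x -> 0 < s -> s < 1 ->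
  s * x `^ (s - 1) <= x `^ s - (x - 1) `^ s.
Proof.
move=> x1 s0 s1; have x0 : 0 < x by lra.
have h : ((x - 1) / x) `^ s <= 1 + s * ((x - 1) / x - 1).
  by apply: powR_le_lin => //; rewrite divr_ge0; lra.
rewrite powRB; last by rewrite (gt_eqF x0) implybT.
rewrite (powRr1 (ltW x0)).
have -> : (x - 1) `^ s = x `^ s * ((x - 1) / x) `^ s.
  rewrite -powRM; [|by lra|by rewrite divr_ge0; lra].
  by congr (_ `^ _); field; rewrite gt_eqF.
have := powR_gt0 s x0; set z := x `^ s => z0.
have e : (x - 1) / x - 1 = - x^-1 by field; rewrite gt_eqF.
rewrite e in h; have := ler_wpM2l (ltW z0) h. nra.
Qed.

(** The limiting case s = 0 of the previous bound, for [Lam j] = alpha ln j. *)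
Lemma ln_increment x : 1 < x -> x^-1 <= ln x - ln (x - 1).
Proof.
move=> x1; have x0 : 0 < x by lra.
have := @ln_le_sub1 ((x - 1) / x); rewrite ln_div ?posrE; [|lra|lra].
have -> : (x - 1) / x - 1 = - x^-1 by field; rewrite gt_eqF.
by rewrite divr_gt0; [move=> /(_ isT); lra|lra|lra].
Qed.

Lemma powRN_increment x s : 1 < x -> 0 < s ->
  s * x `^ (- s - 1) <= (x - 1) `^ (- s) - x `^ (- s).
Proof.
move=> x1 s0; have x0 : 0 < x by lra.
have h := ln_increment x1.
have -> : (x - 1) `^ (- s) = x `^ (- s) * expR (s * (ln x - ln (x - 1))).
  rewrite /powR !gt_eqF//; last by lra.
  by rewrite -expRD; congr expR; ring.
rewrite powRB; last by rewrite (gt_eqF x0) implybT.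
rewrite (powRr1 (ltW x0)).
have := powR_gt0 (- s) x0; set z := x `^ _ => z0.
have h2 : 1 + s * x^-1 <= expR (s * (ln x - ln (x - 1))).
  apply: le_trans (expR_ge1Dx _); rewrite lerD2l; nra.
nra.
Qed.

(** With L = - ln z, z^j is the inverse square of exp (L j / 2) >= 1 + L j / 2 >= c (j + 1). *)
Lemma geometric_le_invsqr (z : R) : 0 < z -> z < 1 ->
  exists2 C, 0 < C & forall j, z ^+ j <= C * (j.+1%:R ^+ 2)^-1.
Proof.
move=> z0 z1; pose L := - ln z.
have L0 : 0 < L by rewrite oppr_gt0 ln_lt0// z0 z1.
pose c := Num.min 1 (L / 2).
have c0 : 0 < c by rewrite lt_min ltr01 divr_gt0.
exists (c ^+ 2)^-1; first by rewrite invr_gt0 exprn_gt0.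
move=> j; have -> : z ^+ j = (expR (L * j%:R / 2) ^+ 2)^-1.
  rewrite -expRM_natl mulrC divfK// -expRN -[in LHS](@lnK _ z)//.
  by rewrite -expRM_natl /L; congr expR; ring.
rewrite -invfM -exprMn lef_pV2 ?posrE ?exprn_gt0 ?expR_gt0 ?mulr_gt0//.
rewrite lerXn2r ?nnegrE ?expR_ge0 ?mulr_ge0 ?(ltW c0)//.
apply: le_trans (expR_ge1Dx _).
have : c <= 1 by rewrite ge_min lexx.
have : c <= L / 2 by rewrite ge_min lexx orbT.
rewrite -natr1; have : 0 <= j%:R :> R by []; nra.
Qed.

(* A sum of n variables, 2^j <= n < 2^(j+1), is halved with a gap of length
   about n / 2^(gap_exp j); the gap then has standard deviation at most [gap_sd j] times
   that of the half, by [sigma_doubling_iter] with lam = 2^(1/4),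
   and [gap_mix j] bounds the mixing coefficient across it. *)
Definition ceil_log (j : nat) : nat := up_log 2 j.+1.
Definition gap_exp (j : nat) : nat := (8 * ceil_log j)%N.
Definition gap_mix (alpha beta : R) (j : nat) : R := alpha * (j - gap_exp j)%:R `^ (- beta).
Definition gap_sd (j : nat) : R := (2 ^+ (2 * ceil_log j))^-1.

Lemma ceil_log_sqr j : (ceil_log j ^ 2 <= 16 * j.+1)%N.
Proof.
have h l : (l.+1 ^ 2 <= 16 * 2 ^ l)%N.
  have [l3|l3] := leqP l 3; first by case: l l3 => [|[|[|[|]]]].
  elim: l l3 => // l IH; rewrite leq_eqVlt => /predU1P[<-//|/IH].
  rewrite !expnS !expn0 !muln1; nia.
case: j => [|j]; first by rewrite /ceil_log up_log1.
have : (0 < ceil_log j.+1)%N by rewrite up_log_gt0.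
have := @up_log_gtn 2 j.+2 isT isT; rewrite -/(ceil_log j.+1).
by case: (ceil_log j.+1) => //= l lt _; apply: (leq_trans (h l)); rewrite leq_mul2l ltnW.
Qed.

Lemma gap_sd_le j : gap_sd j <= (j.+1%:R ^+ 2)^-1.
Proof.
rewrite /gap_sd mulnC exprM lef_pV2 ?posrE ?exprn_gt0//.
rewrite lerXn2r ?nnegrE ?exprn_ge0// -natrX ler_nat.
exact: up_logP.
Qed.

(** The order sqrt j, far from optimal, is enough: shortening j by this amount changes j^(- beta) by
    O(j^(- beta - 1/2)), which is summable since beta > 1/2. The constant is 8 * 4 + 1. *)
Lemma gap_exp_le_sqrt j : (gap_exp j).+1%:R <= 33 * j.+1%:R `^ 2^-1 :> R.
Proof.
set x : R := j.+1%:R; have x1 : 1 <= x by rewrite ler1n.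
rewrite powR12_sqrt; last by lra.
have s0 := sqrtr_ge0 x; have s2 : Num.sqrt x ^+ 2 = x by rewrite sqr_sqrtr//; lra.
have h : (ceil_log j)%:R ^+ 2 <= 16 * x.
  by rewrite -natrX -natrM ler_nat; exact: ceil_log_sqr.
have l0 : 0 <= (ceil_log j)%:R :> R by [].
rewrite -natr1 /gap_exp natrM.
have : (ceil_log j)%:R <= 4 * Num.sqrt x by nra.
have : 1 <= Num.sqrt x by nra.
lra.
Qed.

(** For sqrt j >= 66 = 2 * 33 the gap exponent takes at most half of j + 1. With y = j - [gap_exp j]
    and x = j + 1, y^(- beta) is x^(- beta) (x / y)^beta <= x^(- beta) (x / y) as beta <= 1, and x /
    y is 1 + O(1 / sqrt x). *)
Lemma gap_mix_le (alpha beta : R) j : 0 < alpha -> 0 < beta -> beta <= 1 ->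
  (66 * 66 <= j)%N ->
  ((gap_exp j).+1 * 2 <= j.+1)%N /\
  gap_mix alpha beta j <= alpha * j.+1%:R `^ (- beta)
    + 66 * alpha * j.+1%:R `^ (- (beta - 2^-1) - 1).
Proof.
move=> a0 b0 b1 hj; set x : R := j.+1%:R.
have x5 : 66 * 66 <= x by rewrite -natrM ler_nat leqW.
have x0 : 0 < x by lra.
have := gap_exp_le_sqrt j; rewrite -/x; set s := x `^ 2^-1 => hs.
have s2 : s ^+ 2 = x.
  rewrite /s powR12_sqrt; last by lra.
  by rewrite sqr_sqrtr//; lra.
have s0 : 0 < s by apply: powR_gt0.
have s66 : 66 <= s by nra.
have hp : ((gap_exp j).+1 * 2 <= j.+1)%N.
  by rewrite -(ler_nat R) natrM -/x; nra.
split=> //; rewrite /gap_mix -mulrA mulrCA -mulrDr ler_pM2l//.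
set y : R := (j - gap_exp j)%:R.
have ey : y = x - (gap_exp j).+1%:R.
  by rewrite /y -subSS natrB//; apply: leq_trans hp; rewrite leq_pmulr.
have hy : x <= 2 * y.
  by rewrite ey; move: hp; rewrite -(ler_nat R) natrM -/x; lra.
have y0 : 0 < y by lra.
have yx : y <= x by rewrite ey; have : 0 <= (gap_exp j).+1%:R :> R by []; lra.
have h1 : y `^ (- beta) <= x `^ (- beta) * (x / y).
  have -> : y `^ (- beta) = x `^ (- beta) * (x / y) `^ beta.
    rewrite powRM; [|lra|by rewrite invr_ge0; lra].
    rewrite mulrA -powRD; last by rewrite (gt_eqF x0) implybT.
    by rewrite addNr powRr0 mul1r -[y^-1]powR_inv1 ?(ltW y0)// -powRrM mulN1r.
  rewrite ler_pM2l ?powR_gt0//; apply: ler1_powR => //.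
  by rewrite ler_pdivlMr// mul1r.
apply: (le_trans h1).
have -> : x `^ (- (beta - 2^-1) - 1) = x `^ (- beta) * (s / x).
  rewrite (_ : - (beta - 2^-1) - 1 = - beta + (2^-1 - 1)); last by ring.
  rewrite powRD; last by rewrite (gt_eqF x0) implybT.
  rewrite powRB; last by rewrite (gt_eqF x0) implybT.
  by rewrite (powRr1 (ltW x0)).
have := powR_gt0 (- beta) x0; set z := x `^ _ => z0.
rewrite [leRHS](_ : _ = z * (1 + 66 * (s / x))); last by ring.
rewrite ler_pM2l// ler_pdivrMr//.
have -> : (1 + 66 * (s / x)) * y = y + 66 * s * (y / x) by ring.
have yx2 : 2^-1 <= y / x by rewrite ler_pdivlMr//; lra.
have := ler_wpM2l (ltW s0) yx2; move: yx2; move: (y / x) => r _; rewrite mulrC -mulrA; nra.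
Qed.

Lemma powRN_small (a s e : R) : 0 < a -> 0 < s -> 0 < e ->
  exists j0 : nat, forall j, (j0 <= j)%N -> a * j.+1%:R `^ (- s) <= e.
Proof.
move=> a0 s0 e0; exists (Num.bound ((a / e) `^ s^-1)) => j hj.
have h : (a / e) `^ s^-1 <= j.+1%:R.
  apply: ltW; apply: lt_le_trans (archi_boundP _) _; first exact: powR_ge0.
  by rewrite ler_nat (leq_trans hj).
have h2 : a / e <= j.+1%:R `^ s.
  have -> : a / e = ((a / e) `^ s^-1) `^ s.
    by rewrite -powRrM mulVf ?gt_eqF// powRr1// divr_ge0 ?ltW.
  by apply: ge0_ler_powR => //; rewrite ?nnegrE ?powR_ge0 ?(ltW s0).
rewrite powRN ler_pdivrMr ?powR_gt0//.
by move: h2; rewrite ler_pdivrMr// mulrC.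
Qed.

(** Beyond the main term alpha j^(- beta), all losses of one halving are O(j^(- 1 - g)) with g =
    beta - 1/2 > 0: squares of the rate are O(j^(- 2 beta)), gaps and geometric terms O(j^(- 2)).
    Such terms are bounded by decrements of j^(- g), a bounded sequence, so that in total they cost
    a constant factor. *)
Lemma gap_error_le (alpha beta D z : R) : 0 < alpha -> 2^-1 < beta -> beta <= 1 ->
  0 <= D -> 0 < z -> z < 1 ->
  exists M (j0 : nat), [/\ 0 <= M, (66 * 66 <= j0)%N & forall j, (j0 <= j)%N ->
    gap_mix alpha beta j <= 8^-1 /\
    gap_mix alpha beta j + 4 * gap_mix alpha beta j ^+ 2 + D * (gap_sd j + z ^+ j) <=
      alpha * j.+1%:R `^ (- beta)
      + M * (j%:R `^ (- (beta - 2^-1)) - j.+1%:R `^ (- (beta - 2^-1)))].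
Proof.
move=> a0 b2 b1 D0 z0 z1; set g := beta - 2^-1.
have g0 : 0 < g by rewrite /g; lra.
have b0 : 0 < beta by lra.
have [C C0 hC] := geometric_le_invsqr z0 z1.
have [j1 hj1] : exists j1 : nat, forall j, (j1 <= j)%N ->
    67 * alpha * j.+1%:R `^ (- beta) <= 8^-1 by apply: powRN_small => //; lra.
set K := 66 * alpha + 4 * (67 * alpha) ^+ 2 + D * (1 + C).
have K0 : 0 <= K.
  rewrite /K addr_ge0 ?mulr_ge0 ?sqr_ge0 ?addr_ge0 ?mulr_ge0 ?sqr_ge0 ?(ltW a0) ?(ltW C0)//.
exists (K / g), (maxn (66 * 66) j1); split; [exact: divr_ge0 K0 (ltW g0)|exact: leq_maxl|].
move=> j; rewrite geq_max => /andP[h5 hj]; have := hj1 j hj.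
have [_ hb] := gap_mix_le a0 b0 b1 h5.
move: hb; rewrite -/g; set x : R := j.+1%:R; set B := gap_mix _ _ _ => hb.
have x1 : 1 < x by rewrite ltr1n ltnS (leq_trans _ h5).
have x0 : 0 < x by lra.
have hinc : x `^ (- g - 1) <= g^-1 * (j%:R `^ (- g) - x `^ (- g)).
  have h := powRN_increment x1 g0.
  rewrite (_ : x - 1 = j%:R) in h; last by rewrite /x -natr1 addrK.
  by rewrite mulrC ler_pdivlMr// mulrC.
have B0 : 0 <= B by rewrite /B /gap_mix mulr_ge0 ?powR_ge0 ?ltW.
set u := x `^ (- g - 1) in hb hinc *.
have u0 : 0 < u by apply: powR_gt0.
have hu : u <= x `^ (- beta).
  by apply: ler_powR; rewrite ?(ltW x1)// /g; lra.
have hu2 : (x ^+ 2)^-1 <= u.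
  rewrite -powR_invn ?(ltW x0)//; apply: ler_powR; rewrite ?(ltW x1)// /g.
  lra.
have hu3 : x `^ (- beta) ^+ 2 <= u.
  rewrite -powR_mulrn ?powR_ge0// -powRrM; apply: ler_powR; rewrite ?(ltW x1)// /g.
  lra.
set v := x `^ (- beta) in hb hu hu3 *.
have v0 : 0 < v by apply: powR_gt0.
move=> hv.
have hB : B <= 67 * alpha * v.
  apply: (le_trans hb); have := ler_wpM2l (ltW a0) hu; lra.
split; first by apply: le_trans hv.
have hB2 : B ^+ 2 <= (67 * alpha) ^+ 2 * u.
  apply: (@le_trans _ _ ((67 * alpha * v) ^+ 2)).
    by rewrite lerXn2r ?nnegrE// mulr_ge0// ?(ltW v0)//; lra.
  by rewrite exprMn ler_wpM2l// sqr_ge0.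
have hd : D * (gap_sd j + z ^+ j) <= D * (1 + C) * u.
  rewrite -mulrA ler_wpM2l// mulrDl mul1r lerD//.
    by apply: le_trans hu2; exact: gap_sd_le.
  by apply: (le_trans (hC j)); rewrite ler_wpM2l// ltW.
have hK : K * u <= K / g * (j%:R `^ (- g) - x `^ (- g)).
  by rewrite -mulrA ler_wpM2l.
apply: (@le_trans _ _ (alpha * v + K * u)); last by rewrite lerD2l.
have -> : K * u = 66 * alpha * u + 4 * ((67 * alpha) ^+ 2 * u) + D * (1 + C) * u.
  by rewrite /K; ring.
rewrite addrA addrA; apply: lerD hd; apply: lerD; first by [].
by rewrite ler_wpM2l.
Qed.

End real.

Section real_steps.
Context {R : realType}.

(** Follows from 1 / (1 - x) <= 1 + x + 2 x^2 on [0, 1/2]. *)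
Lemma expR_geB (x : R) : 0 <= x -> x <= 2^-1 -> expR (- (x + 2 * x ^+ 2)) <= 1 - x.
Proof.
move=> x0 x1.
rewrite expRN -[leRHS]invrK lef_pV2 ?posrE ?invr_gt0 ?expR_gt0//; last by lra.
apply: le_trans (expR_ge1Dx _).
rewrite -div1r ler_pdivrMr; last by lra.
have x2 : 0 <= x ^+ 2 by exact: sqr_ge0.
have : x ^+ 2 * x <= x ^+ 2 * 2^-1 by exact: ler_wpM2l.
lra.
Qed.

(** Here tm, tg, t1, t2 stand for the norms of half a block, of the gap, of one variable (left over
    when the length is odd) and of the doubled half. They are compared with an upper bound X of tm^2
    and not with tm itself, because for an arbitrary function psi nothing bounds tm from below. *)
Lemma doubling_upper (tm tg t1 t2 b dl et X : R) :
  0 <= tm -> 0 <= tg -> 0 <= t1 -> 0 <= t2 -> 0 <= b -> b <= 1 -> 0 <= dl ->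
  0 <= et -> et <= 1 -> 0 <= X ->
  tm ^+ 2 <= X -> tg ^+ 2 <= dl ^+ 2 * X -> t1 ^+ 2 <= et ^+ 2 * X ->
  `|t2 ^+ 2 - 2 * tm ^+ 2| <= 2 * (b * (tm * (tm + tg)) + tm * tg) ->
  (t2 + t1) ^+ 2 <= 2 * X * expR (b + 2 * dl + 2 * et).
Proof.
move=> tm0 tg0 t10 t20 b0 b1 dl0 et0 et1 X0 hm hg h1 hd.
set r := Num.sqrt X; have r0 : 0 <= r by exact: sqrtr_ge0.
have rX : r ^+ 2 = X by rewrite sqr_sqrtr.
have tmr : tm <= r by rewrite -(@ler_pXn2r _ 2%N) ?nnegrE// rX.
have tgr : tg <= dl * r.
  by rewrite -(@ler_pXn2r _ 2%N) ?nnegrE ?mulr_ge0// exprMn rX.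
have t1r : t1 <= et * r.
  by rewrite -(@ler_pXn2r _ 2%N) ?nnegrE ?mulr_ge0// exprMn rX.
have h2 : t2 ^+ 2 <= 2 * r ^+ 2 * (1 + b + 2 * dl).
  have e1 : tm * tg <= dl * r ^+ 2.
    by rewrite (_ : dl * r ^+ 2 = r * (dl * r)) ?ler_pM//; ring.
  have e2 : tm ^+ 2 <= r ^+ 2 by rewrite rX.
  have e3 : b * (tm ^+ 2) <= b * r ^+ 2 by rewrite ler_wpM2l.
  have e4 : b * (tm * tg) <= 1 * (tm * tg) by rewrite ler_wpM2r ?mulr_ge0.
  have := le_trans (ler_norm _) hd; lra.
set y := 1 + b + 2 * dl in h2 *; have y1 : 1 <= y by rewrite /y; lra.
have h3 : t2 <= 3 / 2 * r * y.
  rewrite -(@ler_pXn2r _ 2%N) ?nnegrE ?mulr_ge0//; last by lra.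
  apply: (le_trans h2); have : r ^+ 2 * y <= r ^+ 2 * y ^+ 2.
    by rewrite ler_wpM2l ?sqr_ge0// -[leLHS]mulr1 expr2 ler_wpM2l//; lra.
  have : 0 <= r ^+ 2 * y by rewrite mulr_ge0 ?sqr_ge0//; lra.
  rewrite !exprMn; lra.
have h4 : (t2 + t1) ^+ 2 <= 2 * X * (y * (1 + 2 * et)).
  have e1 : t2 * t1 <= (3 / 2 * r * y) * (et * r) by exact: ler_pM.
  have e2 : t1 ^+ 2 <= et * (r ^+ 2 * y).
    rewrite expr2 (le_trans (ler_pM _ _ t1r t1r))//.
    rewrite (_ : et * r * (et * r) = et * (r ^+ 2 * et)); last by ring.
    rewrite ler_wpM2l// ler_wpM2l ?sqr_ge0//; lra.
  rewrite -rX; have -> : (t2 + t1) ^+ 2 = t2 ^+ 2 + 2 * (t2 * t1) + t1 ^+ 2 by ring.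
  lra.
apply: (le_trans h4); rewrite ler_wpM2l//; first by lra.
rewrite expRD ler_pM//; [lra|lra| |exact: expR_ge1Dx].
by apply: le_trans (expR_ge1Dx _); rewrite /y addrA.
Qed.

(** The block of n <= 2 m + 1 variables has norm t3. The hypothesis 1 <= 2 m et lets a factor 1 - et
    absorb the ratio of n to 2 m. Turning the factor 1 - x into an exponential leaves a quadratic
    term, hence 4 b^2 in the exponent. *)
Lemma doubling_lower (tm tg t1 t2 t3 b dl et c e : R) (m n : nat) :
  0 < tm -> 0 <= tg -> 0 <= t1 -> 0 <= t2 -> 0 <= t3 ->
  0 <= b -> b <= 8^-1 -> 0 <= dl -> dl <= 8^-1 ->
  0 <= et -> et <= 2^-1 -> 0 <= c ->
  (n <= (m + m).+1)%N -> 1 <= 2 * m%:R * et ->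
  c * m%:R * e <= tm ^+ 2 -> 0 <= e -> tg <= dl * tm -> t1 <= et * tm ->
  t2 <= t3 + t1 ->
  `|t2 ^+ 2 - 2 * tm ^+ 2| <= 2 * (b * (tm * (tm + tg)) + tm * tg) ->
  c * n%:R * (e * expR (- (b + 4 * b ^+ 2 + 18 * dl + 6 * et))) <= t3 ^+ 2.
Proof.
move=> tm0 tg0 t10 t20 t30 b0 b1 dl0 dl1 et0 et1 c0 hn hme hc e0 hg h1 h3 hd.
have t_m2 : 0 < tm ^+ 2 by rewrite exprn_gt0.
set x := b + 2 * dl.
have x0 : 0 <= x by rewrite /x; lra.
have x1 : x <= 2^-1 by rewrite /x; lra.
have h2 : 2 * tm ^+ 2 * (1 - x) <= t2 ^+ 2.
  have e1 : tm * tg <= dl * tm ^+ 2.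
    by rewrite (_ : dl * tm ^+ 2 = tm * (dl * tm)) ?ler_wpM2l ?(ltW tm0)//; ring.
  have e4 : b * (tm * tg) <= 1 * (tm * tg).
    by rewrite ler_wpM2r ?mulr_ge0 ?(ltW tm0)//; lra.
  have : - (t2 ^+ 2 - 2 * tm ^+ 2) <= 2 * (b * (tm * (tm + tg)) + tm * tg).
    by apply: le_trans hd; rewrite -normrN ler_norm.
  have e5 : b * (tm * (tm + tg)) = b * tm ^+ 2 + b * (tm * tg) by ring.
  have e6 : 2 * tm ^+ 2 * (1 - x) = 2 * tm ^+ 2 - 2 * (b * tm ^+ 2) - 4 * (dl * tm ^+ 2).
    by rewrite /x; ring.
  rewrite e5 e6; lra.
have h4 : tm <= t2.
  rewrite -(@ler_pXn2r _ 2%N) ?nnegrE ?(ltW tm0)//; apply: le_trans h2.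
  have : tm ^+ 2 * 2^-1 <= tm ^+ 2 * (1 - x) by rewrite ler_wpM2l ?(ltW t_m2)//; lra.
  lra.
have h5 : t2 * (1 - et) <= t3.
  have : et * tm <= et * t2 by rewrite ler_wpM2l.
  lra.
have h6 : t2 ^+ 2 * (1 - et) ^+ 2 <= t3 ^+ 2.
  by rewrite -exprMn lerXn2r ?nnegrE ?mulr_ge0//; lra.
have h7 : c * n%:R * e * (1 - et) <= 2 * tm ^+ 2.
  have q : n%:R * (1 - et) <= 2 * m%:R.
    have : n%:R <= 2 * m%:R + 1 :> R.
      by move: hn; rewrite -(ler_nat R) -natr1 natrD; lra.
    have m0 : 0 <= m%:R :> R by [].
    have et1' : 0 <= 1 - et by lra.
    by move=> hn'; have := ler_wpM2r et1' hn'; lra.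
  have -> : c * n%:R * e * (1 - et) = c * e * (n%:R * (1 - et)) by ring.
  apply: (@le_trans _ _ (c * e * (2 * m%:R))).
    by rewrite ler_wpM2l ?mulr_ge0.
  have -> : c * e * (2 * m%:R) = 2 * (c * m%:R * e) by ring.
  by rewrite ler_pM2l.
have h8 : c * n%:R * e * ((1 - et) * (1 - x) * (1 - et) ^+ 2) <= t3 ^+ 2.
  apply: le_trans h6.
  have -> : c * n%:R * e * ((1 - et) * (1 - x) * (1 - et) ^+ 2) =
    (c * n%:R * e * (1 - et) * (1 - x)) * (1 - et) ^+ 2 by ring.
  apply: ler_wpM2r; first exact: sqr_ge0.
  apply: le_trans h2; apply: ler_wpM2r => //; lra.
apply: le_trans h8; rewrite mulrA; apply: ler_wpM2l; first by rewrite !mulr_ge0.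
have g1 : expR (- (2 * et)) <= 1 - et.
  apply: le_trans (expR_geB et0 et1); rewrite ler_expR.
  have : et * et <= et * 2^-1 by rewrite ler_wpM2l.
  rewrite expr2; lra.
have g2 := expR_geB x0 x1.
apply: (@le_trans _ _ (expR (- (2 * et)) * expR (- (x + 2 * x ^+ 2)) * expR (- (2 * et)) ^+ 2)).
  rewrite -expRM_natl -!expRD ler_expR.
  have k1 : dl * dl <= dl * 8^-1 by rewrite ler_wpM2l.
  have k2 : 0 <= (b - 2 * dl) ^+ 2 by exact: sqr_ge0.
  rewrite /x; nra.
rewrite ler_pM ?mulr_ge0 ?expR_ge0 ?exprn_ge0 ?expR_ge0//.
  by rewrite ler_pM ?expR_ge0.
by rewrite lerXn2r ?nnegrE ?expR_ge0//; lra.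
Qed.

End real_steps.

Lemma halfE (n : nat) : n = (n./2 + n./2 + odd n)%N.
Proof. by rewrite -[LHS]odd_double_half -addnn addnC. Qed.

Lemma half_level (j n : nat) : (2 ^ j.+1 <= n)%N -> (n < 2 ^ j.+2)%N ->
  (2 ^ j <= n./2)%N && (n./2 < 2 ^ j.+1)%N.
Proof.
have := halfE n; rewrite !expnS; case: (odd n) => /= h h1 h2; apply/andP; split; lia.
Qed.

(** * Two-sided variance bounds by induction on dyadic scales *)

Section variances.
Context (d : measure_display) (T : measurableType d) (R : realType)
  (P : probability T R) (X : int -> {RV P >-> R}).
Hypothesis stationaryX : strictly_stationary P X.

Local Notation tau := (tau X).
Local Notation sigma := (tau id).

Hypothesis X2 : sqint P (X 0).
Hypothesis X0 : Ex P (X 0) = 0.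
Hypothesis rho0 : forall e : R, 0 < e ->
  exists N : nat, (rho P X N <= e%:E)%E.
Hypothesis sigmay : forall A : R, exists N : nat,
  forall n, (N <= n)%N -> A <= sigma n.

Let mid : measurable_fun setT (@id R) := @measurable_id _ _ _.

Lemma sigma_ge0 n : 0 <= sigma n. Proof. exact: n2_ge0. Qed.

(** No rate is used: a gap g with [rho] at most e is fixed, and m is taken so large that [sigma g]
    and [sigma 1] are at most e [sigma m]. *)
Lemma sigma_doubling (lam : R) : 1 <= lam -> lam ^+ 2 < 2 ->
  exists N : nat, forall m, (N <= m)%N ->
    lam * sigma m <= sigma (m + m) /\ lam * sigma m <= sigma (m + m).+1.
Proof.
(* Doubling loses 6 e in the factor 2, and (lam + e)^2 <= lam^2 + 5 e = 2 - 6 e because lam <= 2 and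
   e <= 1; the extra e in lam + e pays for an odd variable. *)
move=> l1 l2; pose e := (2 - lam ^+ 2) / 11.
have e0 : 0 < e by rewrite /e; lra.
have e1 : e <= 1 by rewrite /e; nra.
have [g hg] := rho0 e0.
have [N hN] := sigmay ((sigma g + sigma 1) / e).
exists (maxn g N) => m; rewrite geq_max => /andP[gm Nm].
have s0 := sigma_ge0 g; have s10 := sigma_ge0 1.
have := hN m Nm; rewrite ler_pdivrMr// => hm.
have hgm : sigma g <= e * sigma m by lra.
have h1m : sigma 1 <= e * sigma m by lra.
have sm0 := sigma_ge0 m.
pose rr (n : nat) : R := if n == g then e else 1.
have dbl := @tau_double _ _ _ P X stationaryX id mid X2 X0.
have hd : `|sigma (m + m) ^+ 2 - 2 * sigma m ^+ 2| <=
    2 * (e * (sigma m * (sigma m + sigma g)) + sigma m * sigma g).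
  pose P' := fun n : nat => (rho P X n <= e%:E)%E.
  (* [rho] is nonincreasing, since the future sigma-fields shrink. *)
  have hr n : (g <= n)%N -> (rho P X n <= e%:E)%E.
    move=> gn; apply: le_trans hg; apply: le_ereal_sup => _ [[f1 f2] /= [L1 L3]] <-.
    exists (f1, f2) => //; split => //=; case: L3 => L3 L3'; split => //.
    apply: (subset_trans L3'); apply: sub_smallest2r => // A [t].
    rewrite /= in_itv /= andbT => ht hA; exists t => //.
    by rewrite /= in_itv /= andbT (le_trans _ ht)// lez_nat.
  exact: (dbl (fun=> e) g hr m g).
have lam2 : lam <= 2 by nra.
have h2 : (lam + e) * sigma m <= sigma (m + m).
  rewrite -(@ler_pXn2r _ 2%N) ?nnegrE ?sigma_ge0 ?mulr_ge0//; last by lra.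
  rewrite exprMn.
  have c1 : sigma m * sigma g <= e * sigma m ^+ 2.
    by rewrite (_ : e * _ = sigma m * (e * sigma m)) ?ler_wpM2l//; ring.
  have c2 : e * (sigma m * sigma g) <= 1 * (sigma m * sigma g).
    by rewrite ler_wpM2r ?mulr_ge0.
  have : - (sigma (m + m) ^+ 2 - 2 * sigma m ^+ 2) <=
     2 * (e * (sigma m * (sigma m + sigma g)) + sigma m * sigma g).
    by apply: le_trans hd; rewrite -normrN ler_norm.
  have -> : e * (sigma m * (sigma m + sigma g)) =
    e * sigma m ^+ 2 + e * (sigma m * sigma g) by ring.
  have : (lam + e) ^+ 2 * sigma m ^+ 2 <= (2 - 6 * e) * sigma m ^+ 2.
    by rewrite ler_wpM2r ?sqr_ge0// /e; rewrite /e in e0 e1; nra.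
  lra.
split.
  by apply: le_trans h2; rewrite ler_wpM2r//; lra.
have := @tauB _ _ _ P X stationaryX id mid X2 1 (m + m); rewrite add1n; lra.
Qed.

Lemma sigma_doubling_iter (lam : R) (N : nat) : 1 <= lam ->
  (forall m, (N <= m)%N ->
    lam * sigma m <= sigma (m + m) /\ lam * sigma m <= sigma (m + m).+1) ->
  forall k n, (N <= n %/ 2 ^ k)%N -> lam ^+ k * sigma (n %/ 2 ^ k) <= sigma n.
Proof.
move=> l1 h; elim=> [|k IH] n; first by rewrite expn0 divn1 expr0 mul1r.
rewrite expnSr divnMA divn2 => hN.
set q := (n %/ 2 ^ k)%N in hN *.
have [h1 h2] := h _ hN.
have hq : lam * sigma q./2 <= sigma q.
  by rewrite {2}[q]halfE; case: (odd q); rewrite ?addn0 ?addn1.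
have Nq : (N <= q)%N by apply: (leq_trans hN); rewrite -divn2 leq_div.
rewrite exprSr -mulrA; apply: le_trans (IH n Nq).
by rewrite ler_wpM2l// exprn_ge0//; lra.
Qed.

(** [sigma n] grows at least like any power of n of exponent below 1/2: a preliminary bound, against
    which single variables and short gaps are negligible. *)
Lemma sigma_lower_pow (lam : R) : 1 <= lam -> lam ^+ 2 < 2 ->
  exists2 c, 0 < c & exists j0, forall j n, (j0 <= j)%N -> (2 ^ j <= n)%N ->
    c * lam ^+ j <= sigma n.
Proof.
move=> l1 l2; have [N hN] := sigma_doubling l1 l2.
have [N1 hN1] := sigmay 1.
pose j0 := maxn N N1.
have l0 : 0 < lam by lra.
exists (lam ^+ j0)^-1; first by rewrite invr_gt0 exprn_gt0.
exists j0 => j n jj hn.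
have hq : (maxn N N1 <= n %/ 2 ^ (j - j0))%N.
  rewrite leq_divRL ?expn_gt0//; apply: leq_trans hn.
  rewrite -{2}(subnK jj) expnD mulnC leq_mul2l; apply/orP; right.
  exact/ltnW/ltn_expl.
have := sigma_doubling_iter l1 hN (leq_trans (leq_maxl _ _) hq).
apply: le_trans; have h := hN1 _ (leq_trans (leq_maxr _ _) hq).
have -> : lam ^+ j = lam ^+ (j - j0) * lam ^+ j0 by rewrite -exprD subnK.
rewrite mulrCA mulVf ?expf_neq0 ?gt_eqF// mulr1.
by rewrite -[leLHS]mulr1 ler_wpM2l// exprn_ge0// ltW.
Qed.

Section levels.
Variables (b bb LU : nat -> R) (N0 j0 : nat) (D z : R).
Hypothesis hrho : forall n, (N0 <= n)%N -> (rho P X n <= (b n)%:E)%E.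
Hypothesis b_ge0 : forall n, 0 <= b n.
Hypothesis hgap : forall j m, (j0 <= j)%N -> (2 ^ j <= m)%N ->
  (m < 2 ^ j.+1)%N ->
  (N0 <= m %/ 2 ^ gap_exp j)%N /\ b (m %/ 2 ^ gap_exp j) <= bb j.
Hypothesis hLU : forall j, (j0 <= j)%N ->
  bb j <= 8^-1 /\ bb j + 4 * bb j ^+ 2 + D * (gap_sd j + z ^+ j) <= LU j.+1 - LU j.
Hypothesis LU0 : forall j, (j0 <= j)%N -> 0 <= LU j.
Hypothesis j02 : (2 <= j0)%N.
Hypothesis z0 : 0 < z.
Hypothesis z1 : z < 1.
Hypothesis z2 : 2^-1 <= z ^+ 2.
Hypothesis D2 : 2 <= D.

Let dj0 j : 0 <= gap_sd j :> R. Proof. by rewrite invr_ge0 exprn_ge0. Qed.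

Let dj8 j : (j0 <= j)%N -> gap_sd j <= 8^-1 :> R.
Proof.
move=> hj; apply: (le_trans (gap_sd_le j)).
rewrite lef_pV2 ?posrE ?exprn_gt0// -natrX ler_nat.
have h3 : (3 <= j.+1)%N by rewrite ltnS (leq_trans j02).
by apply: (@leq_trans (3 ^ 2)) => //; rewrite leq_exp2r.
Qed.

Let bb0 j m : (j0 <= j)%N -> (2 ^ j <= m)%N -> (m < 2 ^ j.+1)%N -> 0 <= bb j.
Proof. by move=> h1 h2 h3; have [_] := hgap h1 h2 h3; apply: le_trans. Qed.

Let zj0 j : 0 <= z ^+ j. Proof. by rewrite exprn_ge0// ltW. Qed.

Let zj1 j : z ^+ j <= 1. Proof. by rewrite exprn_ile1// ltW. Qed.

Let LU_step j : (j0 <= j)%N ->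
  bb j + 2 * gap_sd j + 2 * z ^+ j <= LU j.+1 - LU j.
Proof.
move=> hj; have [_] := hLU hj; apply: le_trans.
have h : 2 * (gap_sd j + z ^+ j) <= D * (gap_sd j + z ^+ j).
  by rewrite ler_wpM2r ?addr_ge0.
have := sqr_ge0 (bb j); lra.
Qed.

(** The gap is estimated by the induction hypothesis itself, which is linear in the length: a
    fraction 2^(- [gap_exp j]) of the half gives at most [gap_sd j] ^ 2 times the bound. The
    increment of [LU] covers the total loss of one doubling. *)
Lemma tau_upper (psi : R -> R) : measurable_fun setT psi ->
  sqint P (fun w => psi (X 0 w)) -> Ex P (fun w => psi (X 0 w)) = 0 ->
  forall j n, (j0 <= j)%N -> (n < 2 ^ j.+1)%N ->
  tau psi n ^+ 2 <= 2 ^+ j0.+1 * n%:R * expR (LU j) * tau psi 1 ^+ 2.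
Proof.
move=> mpsi psi2 psi0 j n hj; rewrite -(subnK hj).
elim: (j - j0)%N n => [|k IH] n.
  rewrite add0n => hn.
  have h1 := tau_mul stationaryX mpsi psi2 n.
  have t0 k : 0 <= tau psi k by exact: n2_ge0.
  have h2 : tau psi n ^+ 2 <= (n%:R * tau psi 1) ^+ 2.
    by rewrite lerXn2r ?nnegrE ?mulr_ge0.
  apply: (le_trans h2); rewrite exprMn ler_wpM2r ?sqr_ge0//.
  have e1 : 1 <= expR (LU j0) by rewrite -expR0 ler_expR LU0.
  have n0 : 0 <= n%:R :> R by [].
  have hn2 : n%:R <= 2 ^+ j0.+1 :> R by rewrite -natrX ler_nat ltnW.
  rewrite -[leLHS]mulr1 ler_pM ?sqr_ge0// expr2 ler_wpM2r//.
rewrite addSn; set j' := (k + j0)%N; rewrite -/j' in IH * => hn.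
have hj' : (j0 <= j')%N by rewrite leq_addl.
have dj0' := dj0 j'; have zj0' := zj0 j'.
have hinc : expR (bb j' + 2 * gap_sd j' + 2 * z ^+ j') <= expR (LU j'.+1 - LU j').
  by rewrite ler_expR LU_step.
have t0 k' : 0 <= tau psi k' by exact: n2_ge0.
have [nl|nl] := ltnP n (2 ^ j'.+1).
  apply: (le_trans (IH n nl)); rewrite ler_wpM2r ?sqr_ge0//.
  rewrite ler_wpM2l ?mulr_ge0 ?exprn_ge0// ler_expR -subr_ge0.
  (* Any length at this scale will do: it serves to see that [bb j'] is nonnegative, so that [LU]
     increases. *)
  have [m [m1 m2]] : exists m, (2 ^ j' <= m)%N /\ (m < 2 ^ j'.+1)%N.
    by exists (2 ^ j')%N; rewrite leqnn ltn_exp2l.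
  have := LU_step hj'; have := bb0 hj' m1 m2; lra.
have /andP[m1 m2] := half_level nl hn; set m := n./2 in m1 m2.
have [Ng bg] := hgap hj' m1 m2.
set g := (m %/ 2 ^ gap_exp j')%N in Ng bg.
have gm : (g <= m)%N by exact: leq_div.
pose X' : R := 2 ^+ j0.+1 * m%:R * expR (LU j') * tau psi 1 ^+ 2.
have X'0 : 0 <= X' by rewrite /X' !mulr_ge0 ?exprn_ge0 ?expR_ge0.
have hm := IH m m2; rewrite -/X' in hm.
have hg : tau psi g ^+ 2 <= gap_sd j' ^+ 2 * X'.
  apply: (le_trans (IH g (leq_ltn_trans gm m2))).
  rewrite /X' (_ : gap_sd j' ^+ 2 * _ = 2 ^+ j0.+1 * (gap_sd j' ^+ 2 * m%:R) * expR (LU j') * tau psi 1 ^+ 2);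
    last by ring.
  rewrite !ler_wpM2r ?sqr_ge0 ?expR_ge0// ler_wpM2l ?exprn_ge0//.
  rewrite mulrC /gap_sd exprVn -exprM ler_pdivlMr ?exprn_gt0// -natrX -natrM ler_nat.
  apply: leq_trans (leq_trunc_div m (2 ^ gap_exp j')).
  by rewrite leq_mul2l leq_exp2l// /gap_exp mulnAC leq_mul2r !orbT.
have h1 : tau psi 1 ^+ 2 <= (z ^+ j') ^+ 2 * X'.
  rewrite /X' mulrA -[leLHS]mul1r ler_wpM2r ?sqr_ge0//.
  have e1 : 1 <= expR (LU j') by rewrite -expR0 ler_expR LU0.
  have m1R : 2 ^+ j' <= m%:R :> R by rewrite -natrX ler_nat.
  have e2 : 1 <= (z ^+ j') ^+ 2 * m%:R.
    apply: (@le_trans _ _ ((z ^+ 2 * 2) ^+ j')); first by apply: exprn_ege1; have := z2; lra.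
    by rewrite exprMn [(z ^+ 2) ^+ _]exprAC ler_wpM2l ?sqr_ge0.
  have e3 : 1 <= 2 ^+ j0.+1 :> R by rewrite exprn_ege1// ler1n.
  rewrite (_ : _ * _ = 2 ^+ j0.+1 * ((z ^+ j') ^+ 2 * m%:R) * expR (LU j')); last by ring.
  by apply: mulr_ege1 => //; exact: mulr_ege1.
have dbl := tau_double stationaryX mpsi psi2 psi0 hrho gm Ng.
have b18 : b g <= 8^-1 by have [+ _] := hLU hj'; apply: le_trans.
have b1 : b g <= 1 by lra.
have S := doubling_upper (t0 m) (t0 g) (t0 1) (t0 (m + m)%N) (b_ge0 g) b1 dj0' zj0' (zj1 j') X'0
  hm hg h1 dbl.
have hn2 : tau psi n <= tau psi (m + m) + tau psi 1.
  rewrite {1}[n]halfE -/m; case: (odd n) => /=; first exact: tauD.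
  by rewrite addn0 lerDl.
apply: (@le_trans _ _ ((tau psi (m + m) + tau psi 1) ^+ 2)).
  by rewrite lerXn2r ?nnegrE ?addr_ge0.
apply: (le_trans S).
apply: (@le_trans _ _ (2 * X' * expR (LU j'.+1 - LU j'))).
  rewrite ler_wpM2l ?mulr_ge0//; apply: le_trans hinc.
  by rewrite ler_expR !lerD2r.
have -> : 2 * X' * expR (LU j'.+1 - LU j') =
    2 ^+ j0.+1 * (m + m)%:R * expR (LU j'.+1) * tau psi 1 ^+ 2.
  have e : expR (LU j'.+1) = expR (LU j') * expR (LU j'.+1 - LU j').
    by rewrite -expRD; congr expR; ring.
  by rewrite e /X' natrD; ring.
rewrite !ler_wpM2r ?sqr_ge0 ?expR_ge0// ler_wpM2l ?exprn_ge0// ler_nat.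
by rewrite [leqRHS]halfE leq_addr.
Qed.

(** A lower bound cannot control the gap by induction; instead the iterated doubling inequality with
    ratio 1/z shows that the gap is small compared with the half itself. The induction starts from
    [sigma n] >= 1 at level j0. *)
Lemma sigma_lower_linear (c' : R) (N1 : nat) : 1 <= c' ->
  (forall k n, (N1 <= n %/ 2 ^ k)%N -> z^-1 ^+ k * sigma (n %/ 2 ^ k) <= sigma n) ->
  (N1 <= N0)%N -> z ^+ 4 = 2^-1 ->
  (forall j m, (j0 <= j)%N -> (2 ^ j <= m)%N -> sigma 1 <= c' * z ^+ j * sigma m) ->
  (forall n, (2 ^ j0 <= n)%N -> 1 <= sigma n) ->
  (forall j, (j0 <= j)%N -> c' * z ^+ j <= 2^-1) -> 18 <= D -> 6 * c' <= D ->
  forall j n, (j0 <= j)%N -> (2 ^ j <= n)%N -> (n < 2 ^ j.+1)%N ->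
  (2 ^+ j0.+1)^-1 * n%:R * expR (- LU j) <= sigma n ^+ 2.
Proof.
move=> c1 hit N10 z4 h1 hs hc D18 D6 j n hj; rewrite -(subnK hj).
have s0 := sigma_ge0.
elim: (j - j0)%N n => [|k IH] n.
  rewrite add0n => nl nu.
  have e1 : expR (- LU j0) <= 1 by rewrite -expR0 ler_expR oppr_le0 LU0.
  have s1 : 1 <= sigma n ^+ 2 by rewrite exprn_ege1// hs.
  apply: le_trans s1; rewrite -[leRHS]mulr1 ler_pM ?mulr_ge0 ?expR_ge0 ?invr_ge0 ?exprn_ge0//.
  by rewrite mulrC ler_pdivrMr ?exprn_gt0// mul1r -natrX ler_nat ltnW.
rewrite addSn; set j' := (k + j0)%N; rewrite -/j' in IH * => nl hn.
have hj' : (j0 <= j')%N by rewrite leq_addl.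
have dj0' := dj0 j'; have zj0' := zj0 j'.
have /andP[m1 m2] := half_level nl hn; set m := n./2 in m1 m2.
have [Ng bg] := hgap hj' m1 m2.
have hgz := hit (gap_exp j') m (leq_trans N10 Ng).
set g := (m %/ 2 ^ gap_exp j')%N in Ng bg hgz.
have gm : (g <= m)%N by exact: leq_div.
have hm := IH m m1 m2.
have sm1 : 1 <= sigma m by apply: hs; apply: leq_trans m1; rewrite leq_exp2l.
have sm0 : 0 < sigma m by lra.
(* z^8 = 1/4 is why the gap exponent is eight times a logarithm. *)
have zp : z ^+ gap_exp j' = gap_sd j'.
  have e : z ^+ 8 = 2 ^- 2 by rewrite (_ : 8 = 4 * 2)%N// exprM z4 exprVn.
  by rewrite /gap_exp exprM e /gap_sd exprVn -exprM.
have hg : sigma g <= gap_sd j' * sigma m.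
  by rewrite -zp mulrC -ler_pdivrMr ?exprn_gt0// mulrC -exprVn.
have h1' := h1 j' m hj' m1.
have et0 : 0 <= c' * z ^+ j' by rewrite mulr_ge0//; lra.
have hme : 1 <= 2 * m%:R * (c' * z ^+ j').
  have m1R : 2 ^+ j' <= m%:R :> R by rewrite -natrX ler_nat.
  have e2 : 1 <= m%:R * z ^+ j'.
    apply: (@le_trans _ _ ((2 * z) ^+ j')).
      apply: exprn_ege1; have : z ^+ 2 <= z * 1 by rewrite expr2 ler_wpM2l ?ltW.
      have := z2; lra.
    by rewrite exprMn ler_wpM2r.
  rewrite (_ : _ * _ = (2 * c') * (m%:R * z ^+ j')); last by ring.
  by apply: mulr_ege1 => //; lra.
have [b8 hb] := hLU hj'.
have dbl := tau_double stationaryX mid X2 X0 hrho gm Ng.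
have hn2 : sigma (m + m) <= sigma n + sigma 1.
  rewrite {1}[n]halfE -/m; case: (odd n) => /=; last by rewrite addn0 lerDl.
  have := @tauB _ _ _ P X stationaryX id mid X2 1 (m + m).
  by rewrite addnC.
have nm : (n <= (m + m).+1)%N.
  by rewrite [leqLHS]halfE -/m -addn1 leq_add2l; case: (odd n).
have c0 : 0 <= (2 ^+ j0.+1)^-1 :> R by rewrite invr_ge0 exprn_ge0.
have := doubling_lower sm0 (s0 g) (s0 1%N) (s0 (m + m)%N) (s0 n) (b_ge0 g)
  (le_trans bg b8) dj0' (dj8 hj') et0 (hc _ hj') c0 nm hme hm (expR_ge0 _) hg h1' hn2 dbl.
apply: le_trans; apply: ler_wpM2l; first by rewrite mulr_ge0.
rewrite -expRD ler_expR.
have k1 : b g ^+ 2 <= bb j' ^+ 2 by rewrite lerXn2r ?nnegrE// (le_trans (b_ge0 g)).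
have k2 : 18 * gap_sd j' <= D * gap_sd j' by rewrite ler_wpM2r.
have k3 : 6 * c' * z ^+ j' <= D * z ^+ j' by rewrite ler_wpM2r.
lra.
Qed.

End levels.

End variances.

Section logs.
Context {R : realType}.

Lemma ln2_gt0 : 0 < ln 2 :> R. Proof. by apply: ln_gt0; rewrite ltr1n. Qed.

Lemma log2_le (x y : R) : 0 < x -> x <= y -> log2 x <= log2 y.
Proof.
move=> x0 xy; rewrite /log2 ler_pM2r ?invr_gt0 ?ln2_gt0//.
by rewrite ler_ln ?posrE// (lt_le_trans x0).
Qed.

Lemma log2X (j : nat) : log2 (2 ^+ j) = j%:R :> R.
Proof. by rewrite /log2 lnXn// -[ln 2 *+ j]mulr_natl mulfK// gt_eqF// ln2_gt0. Qed.

Lemma log2_natX (j n : nat) : (2 ^ j <= n)%N -> j%:R <= log2 n%:R :> R.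
Proof.
by move=> h; rewrite -log2X; apply: log2_le; rewrite ?exprn_gt0// -natrX ler_nat.
Qed.

Lemma powRN_le (x y s : R) : 0 < x -> x <= y -> 0 <= s -> y `^ (- s) <= x `^ (- s).
Proof.
move=> x0 xy s0; rewrite !powRN lef_pV2 ?posrE ?powR_gt0//; last exact: lt_le_trans xy.
by apply: ge0_ler_powR; rewrite ?nnegrE//; [exact: ltW|exact: (le_trans (ltW x0))].
Qed.

Lemma expn2_le_ltn (j n : nat) : (2 ^ j <= n)%N -> (j < n)%N.
Proof. by apply: leq_trans; exact: ltn_expl. Qed.

End logs.

Section var_bounds.
Context (d : measure_display) (T : measurableType d) (R : realType)
  (P : probability T R) (X : int -> {RV P >-> R}).
Hypothesis stationaryX : strictly_stationary P X.

Local Notation tau := (tau X).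
Local Notation sigma := (tau id).

Hypothesis X2 : sqint P (X 0).
Hypothesis X0 : Ex P (X 0) = 0.
Hypothesis rho0 : forall e : R, 0 < e ->
  exists N : nat, (rho P X N <= e%:E)%E.
Hypothesis sigmay : forall A : R, exists N : nat,
  forall n, (N <= n)%N -> A <= sigma n.

Variables (alpha beta : R) (N0 : nat) (Lam : nat -> R).
Hypothesis a0 : 0 < alpha.
Hypothesis b2 : 2^-1 < beta.
Hypothesis b1 : beta <= 1.
Hypothesis hrho : forall n, (N0 <= n)%N ->
  (rho P X n <= (alpha * (log2 n%:R) `^ (- beta))%:E)%E.
Hypothesis Lam0 : forall j, (1 <= j)%N -> 0 <= Lam j.
Hypothesis LamS : forall j, (1 <= j)%N ->
  alpha * j.+1%:R `^ (- beta) <= Lam j.+1 - Lam j.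

Lemma var_bounds : exists C c (j0 : nat), [/\ 0 < C, 0 < c &
  (forall psi : R -> R, measurable_fun setT psi ->
    sqint P (fun w => psi (X 0 w)) -> Ex P (fun w => psi (X 0 w)) = 0 ->
    forall j n, (j0 <= j)%N -> (n < 2 ^ j.+1)%N ->
    tau psi n ^+ 2 <= C * n%:R * expR (Lam j) * tau psi 1 ^+ 2) /\
  (forall j n, (j0 <= j)%N -> (2 ^ j <= n)%N -> (n < 2 ^ j.+1)%N ->
    c * n%:R * expR (- Lam j) <= sigma n ^+ 2)].
Proof.
have b0 : 0 < beta by apply: lt_trans b2; rewrite invr_gt0.
have i2 : 0 < 2^-1 :> R by rewrite invr_gt0.
(* y = 2^(- 1/2) and z = 2^(- 1/4), obtained by repeated square roots. *)
have [y y0 y2] : exists2 y : R, 0 < y & y ^+ 2 = 2^-1.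
  by exists (Num.sqrt 2^-1); [rewrite sqrtr_gt0|rewrite sqr_sqrtr ?(ltW i2)].
have [z z0 z2] : exists2 z : R, 0 < z & z ^+ 2 = y.
  by exists (Num.sqrt y); [rewrite sqrtr_gt0|rewrite sqr_sqrtr ?(ltW y0)].
have z4 : z ^+ 4 = 2^-1 by rewrite (_ : 4 = 2 * 2)%N// exprM z2.
have y1 : y < 1 by rewrite -(@ltr_pXn2r _ 2%N) ?nnegrE ?(ltW y0)// y2 expr1n; lra.
have z1 : z < 1 by rewrite -(@ltr_pXn2r _ 2%N) ?nnegrE ?(ltW z0)// z2 expr1n.
have yl : 2^-1 < y.
  by rewrite -y2 -[ltRHS]mulr1 expr2 ltr_pM2l.
have l1 : 1 <= z^-1 by rewrite invf_ge1// ltW.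
have l2 : z^-1 ^+ 2 < 2.
  rewrite exprVn z2 -[ltRHS]invrK ltf_pV2 ?posrE ?invr_gt0//.
have [N1 hN1] := sigma_doubling stationaryX X2 X0 rho0 sigmay l1 l2.
have hit := sigma_doubling_iter l1 hN1.
have [c cp [j1 hlow]] := sigma_lower_pow stationaryX X2 X0 rho0 sigmay l1 l2.
have s0 := sigma_ge0 X.
pose c' := Num.max 1 (sigma 1 / c).
have c'1 : 1 <= c' by rewrite le_max lexx.
(* 18 and 6 are the coefficients of [dl] and [et] in [doubling_lower], where [et] will be
   [c' * z ^+ j]. *)
pose D := Num.max 18 (6 * c').
have D18 : 18 <= D by rewrite le_max lexx.
have D6 : 6 * c' <= D by rewrite le_max lexx orbT.
have D0 : 0 <= D by apply: le_trans D18.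
have [M [j2 [M0 j2big hM]]] := gap_error_le a0 b2 b1 D0 z0 z1.
have [C1 C10 hC1] := geometric_le_invsqr z0 z1.
have [N2 hN2] := sigmay 1.
set g := beta - 2^-1 in hM.
have g0 : 0 < g by rewrite /g subr_gt0.
(* N0 and N1 are doubled because the gap exponent takes at most half of j. *)
pose j0 := (j2 + j1 + N0 * 2 + N1 * 2 + N2 + Num.bound (2 * c' * C1))%N.
(* [Lam] plus a correction between 0 and M whose increments pay for the summable losses; at the end
   it becomes the constant factors exp M and exp (- M). *)
pose LU j := Lam j + M * (1 - j%:R `^ (- g)).
pose b n : R := alpha * (log2 n%:R) `^ (- beta).
pose N0' := maxn N0 N1.
have hrho' n : (N0' <= n)%N -> (rho P X n <= (b n)%:E)%E.
  by rewrite geq_max => /andP[h _]; exact: hrho.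
have bge n : 0 <= b n by rewrite /b mulr_ge0 ?powR_ge0// ltW.
have jj2 j : (j0 <= j)%N -> (j2 <= j)%N.
  by apply: leq_trans; rewrite /j0 -!addnA leq_addr.
have hgap j m : (j0 <= j)%N -> (2 ^ j <= m)%N -> (m < 2 ^ j.+1)%N ->
    (N0' <= m %/ 2 ^ gap_exp j)%N /\ b (m %/ 2 ^ gap_exp j)%N <= gap_mix alpha beta j.
  move=> hj m1 m2.
  have [hp _] := gap_mix_le a0 b0 b1 (leq_trans j2big (jj2 _ hj)).
  have pjj : (gap_exp j <= j)%N by move: hp; clear; lia.
  have hg : (2 ^ (j - gap_exp j) <= m %/ 2 ^ gap_exp j)%N.
    by rewrite leq_divRL ?expn_gt0// -expnD subnK.
  have jp : (0 < j - gap_exp j)%N.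
    have : (0 < j)%N by rewrite (leq_trans _ (jj2 _ hj))// (leq_trans _ j2big).
    by move: hp; clear; lia.
  split.
    have h1 : (N0 * 2 + N1 * 2 <= j)%N.
      apply: leq_trans hj; rewrite /j0; clear; lia.
    apply: (@leq_trans (j - gap_exp j)); last exact: ltnW (expn2_le_ltn hg).
    by rewrite geq_max; move: hp h1; clear; lia.
  rewrite /b /gap_mix ler_pM2l// powRN_le ?ltr0n// ?(ltW b0)//.
  exact: log2_natX.
have jge1 j : (j0 <= j)%N -> (1 <= j)%N.
  by move=> hj; rewrite (leq_trans _ (jj2 _ hj))// (leq_trans _ j2big).
have hLU j : (j0 <= j)%N -> gap_mix alpha beta j <= 8^-1 /\
    gap_mix alpha beta j + 4 * gap_mix alpha beta j ^+ 2 + D * (gap_sd j + z ^+ j) <= LU j.+1 - LU j.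
  move=> hj; have [h1 h2] := hM j (jj2 _ hj); split => //; apply: (le_trans h2).
  have := LamS (jge1 j hj); rewrite /LU; lra.
have LU0 j : (j0 <= j)%N -> 0 <= LU j.
  move=> hj; rewrite addr_ge0 ?Lam0 ?jge1// mulr_ge0// subr_ge0.
  rewrite powRN invf_le1 ?powR_gt0 ?ltr0n ?jge1//.
  by rewrite -[leLHS](powRr0 j%:R); apply: ler_powR; rewrite ?ler1n ?jge1// ltW.
have LUM j : LU j <= Lam j + M.
  rewrite lerD2l -[leRHS]mulr1 ler_wpM2l// gerBl; exact: powR_ge0.
have z2' : 2^-1 <= z ^+ 2 by rewrite z2 ltW.
have D2 : 2 <= D by lra.
have j02 : (2 <= j0)%N by apply: leq_trans (jj2 _ (leqnn _)); apply: leq_trans j2big.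
have N10 : (N1 <= N0')%N by exact: leq_maxr.
have h1 j m : (j0 <= j)%N -> (2 ^ j <= m)%N -> sigma 1 <= c' * z ^+ j * sigma m.
  move=> hj hm.
  have hjj : (j1 <= j)%N by apply: leq_trans hj; rewrite /j0; clear; lia.
  have h := hlow j m hjj hm.
  have zz : z ^+ j * z^-1 ^+ j = 1 by rewrite -exprMn mulfV ?gt_eqF// expr1n.
  have h3 : c <= z ^+ j * sigma m.
    apply: (@le_trans _ _ (z ^+ j * (c * z^-1 ^+ j))).
      by rewrite mulrCA zz mulr1.
    by rewrite ler_wpM2l// exprn_ge0// ltW.
  have h4 : sigma 1 <= c' * c by rewrite -ler_pdivrMr// le_max lexx orbT.
  apply: (le_trans h4); rewrite -mulrA ler_wpM2l//; lra.
have hs n : (2 ^ j0 <= n)%N -> 1 <= sigma n.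
  move=> hn; apply: hN2; apply: leq_trans (ltnW (expn2_le_ltn hn)).
  by rewrite /j0; clear; lia.
have hc j : (j0 <= j)%N -> c' * z ^+ j <= 2^-1.
  move=> hj.
  have hb : 2 * c' * C1 <= j.+1%:R.
    apply: (le_trans (ltW (archi_boundP _))); first by rewrite !mulr_ge0 ?(ltW C10)//; lra.
    by rewrite ler_nat leqW//; apply: leq_trans hj; rewrite /j0 leq_addl.
  have x1 : 1 <= j.+1%:R :> R by rewrite ler1n.
  have x0 : 0 < j.+1%:R :> R by [].
  apply: (@le_trans _ _ (c' * (C1 * (j.+1%:R ^+ 2)^-1))).
    by rewrite ler_wpM2l//; lra.
  rewrite mulrA ler_pdivrMr ?exprn_gt0//.
  have : j.+1%:R * 1 <= j.+1%:R ^+ 2 :> R by rewrite expr2 ler_wpM2l// ltW.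
  lra.
have Ce k : 0 < k -> 0 < k * expR M by move=> k0; rewrite mulr_gt0 ?expR_gt0.
exists (2 ^+ j0.+1 * expR M), ((2 ^+ j0.+1)^-1 * expR (- M)), j0; split.
- by rewrite mulr_gt0 ?expR_gt0 ?exprn_gt0.
- by rewrite mulr_gt0 ?expR_gt0 ?invr_gt0 ?exprn_gt0.
- split.
  + move=> psi mpsi psi2 psi0 j n hj hn.
    have := tau_upper stationaryX hrho' bge hgap hLU LU0 z0 z1 z2' D2 mpsi psi2 psi0 hj hn.
    move/le_trans; apply; rewrite ler_wpM2r ?sqr_ge0//.
    rewrite [2 ^+ _ * expR M * n%:R]mulrAC -[leRHS]mulrA.
    rewrite ler_wpM2l ?mulr_ge0 ?exprn_ge0// -expRD ler_expR addrC; exact: LUM.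
  + move=> j n hj n1 norm2.
    have := sigma_lower_linear stationaryX X2 X0 hrho' bge hgap hLU LU0 j02 z0 z1 z2' c'1 hit N10 z4 h1 hs hc D18 D6 hj n1 norm2.
    apply: le_trans.
    rewrite [_ * expR (- M) * n%:R]mulrAC -[leLHS]mulrA.
    rewrite ler_wpM2l ?mulr_ge0 ?invr_ge0 ?exprn_ge0// -expRD ler_expR -opprD lerN2.
    by rewrite addrC LUM.
Qed.

End var_bounds.

(** * Moments of order q *)

Section powers.
Context {R : realType}.
Implicit Types a b x y z t p q : R.

Lemma powR_mono x y p : 0 <= p -> 0 <= x -> x <= y -> x `^ p <= y `^ p.
Proof.
by move=> p0 x0 xy; apply: ge0_ler_powR; rewrite ?nnegrE// (le_trans x0).
Qed.

Lemma young_lin z t p : 0 <= z -> 0 < t -> 1 <= p -> z <= t + t `^ (1 - p) * z `^ p.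
Proof.
move=> z0 t0 p1; have [zt|tz] := leP z t.
  by rewrite (le_trans zt)// lerDl mulr_ge0// powR_ge0.
have zp : 0 < z by apply: lt_trans tz.
apply: (@le_trans _ _ (t `^ (1 - p) * z `^ p)); last by rewrite lerDr ltW.
have -> : t `^ (1 - p) = (t `^ (p - 1))^-1 by rewrite -powRN opprB.
rewrite mulrC ler_pdivlMr ?powR_gt0//.
rewrite -(@mulr_powRB1 _ z p)//; last by lra.
by rewrite ler_pM2l// powR_mono//; [lra|exact: ltW|exact: ltW].
Qed.

(** With z = |b| / |a| <= 1, (1 + z)^q <= (1 + z)^3 <= 1 + 7 z, and z is traded for t + t^(1 - q/2)
    z^(q/2) by [young_lin]. The cross product of powers of order q/2 is what mixing can decouple:
    these powers are square integrable when moments of order q are finite. *)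
Lemma pow_add_wlog a b t q : 2 <= q -> q <= 3 -> 0 < t -> `|b| <= `|a| ->
  `|a + b| `^ q <= (1 + 7 * t) * (`|a| `^ q + `|b| `^ q)
     + 7 * t `^ (1 - q / 2) * (`|a| `^ (q / 2) * `|b| `^ (q / 2)).
Proof.
move=> q2 q3 t0 ba; have q0 : 0 < q by lra.
have [a0|a0] := eqVneq a 0.
  have b0 : b = 0 by apply/eqP; rewrite -normr_le0 (le_trans ba)// a0 normr0.
  rewrite a0 b0 addr0 normr0 !powR0 ?gt_eqF//; last by lra.
  by rewrite mul0r !(mulr0, addr0).
have pa : 0 < `|a| by rewrite normr_gt0.
set z := `|b| / `|a|.
have z0 : 0 <= z by rewrite divr_ge0.
have z1 : z <= 1 by rewrite ler_pdivrMr// mul1r.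
have bz : `|b| = `|a| * z by rewrite mulrC divfK ?gt_eqF.
have h1 : `|a + b| `^ q <= `|a| `^ q * (1 + 7 * z).
  apply: (@le_trans _ _ ((`|a| * (1 + z)) `^ q)).
    rewrite powR_mono ?(ltW q0)// mulrDr mulr1 -bz; exact: ler_normD.
  rewrite powRM ?(ltW pa)//; last by lra.
  rewrite ler_wpM2l ?powR_ge0//.
  apply: (@le_trans _ _ ((1 + z) `^ 3)); first by apply: ler_powR => //; lra.
  rewrite powR_mulrn; last by lra.
  have zz : z * z <= z * 1 by rewrite ler_wpM2l.
  have zzz : z * (z * z) <= z * (z * 1) by rewrite ler_wpM2l.
  rewrite (_ : (1 + z) ^+ 3 = 1 + 3 * z + 3 * (z * z) + z * (z * z)); last by ring.
  lra.
have p1 : 1 <= q / 2 by lra.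
have yz := young_lin z0 t0 p1.
have e2 : `|a| `^ (q / 2) * `|b| `^ (q / 2) = `|a| `^ q * z `^ (q / 2).
  rewrite bz powRM ?(ltW pa)// mulrA -powRD; last by rewrite (gt_eqF pa) implybT.
  by rewrite -splitr.
apply: (le_trans h1); rewrite e2.
set u := `|a| `^ q; set v := z `^ _ in yz *; set s := t `^ _ in yz *.
have u0 : 0 <= u by apply: powR_ge0.
have bq0 : 0 <= (1 + 7 * t) * `|b| `^ q by rewrite mulr_ge0 ?powR_ge0//; lra.
have := ler_wpM2l u0 yz; lra.
Qed.

Lemma pow_add a b t q : 2 <= q -> q <= 3 -> 0 < t ->
  `|a + b| `^ q <= (1 + 7 * t) * (`|a| `^ q + `|b| `^ q)
     + 7 * t `^ (1 - q / 2) * (`|a| `^ (q / 2) * `|b| `^ (q / 2)).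
Proof.
move=> q2 q3 t0; have [h|h] := leP `|b| `|a|; first exact: pow_add_wlog.
by rewrite addrC [X in _ * X + _]addrC [_ `^ (q / 2) * _]mulrC;
  apply: pow_add_wlog => //; exact: ltW.
Qed.

Lemma powR_superadd x y p : 0 <= x -> 0 <= y -> 1 <= p ->
  x `^ p + y `^ p <= (x + y) `^ p.
Proof.
move=> x0 y0 p1; have p0 : 0 < p by lra.
rewrite -(mulr_powRB1 x0 p0) -(mulr_powRB1 y0 p0) -(mulr_powRB1 (addr_ge0 x0 y0) p0).
by rewrite mulrDl lerD// ler_wpM2l// powR_mono ?lerDl ?lerDr//; lra.
Qed.

(** Either |y| <= e |x| and |x + y| <= (1 + e) |x|, or |x| < |y| / e and the roles are exchanged. *)
Lemma pow_gap x y e q : 0 < q -> 0 < e ->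
  `|x + y| `^ q <= (1 + e) `^ q * `|x| `^ q + (1 + e^-1) `^ q * `|y| `^ q.
Proof.
move=> q0 e0; have ei : 0 < e^-1 by rewrite invr_gt0.
rewrite -!powRM//; try lra.
have [h|h] := leP `|y| (e * `|x|).
  apply: (@le_trans _ _ (((1 + e) * `|x|) `^ q)); last by rewrite lerDl powR_ge0.
  by rewrite powR_mono ?(ltW q0)// (le_trans (ler_normD _ _))// mulrDl mul1r lerD2l.
apply: (@le_trans _ _ (((1 + e^-1) * `|y|) `^ q)); last by rewrite lerDr powR_ge0.
rewrite powR_mono ?(ltW q0)// (le_trans (ler_normD _ _))// mulrDl mul1r addrC lerD2l.
by rewrite ler_pdivlMl// ltW.
Qed.

(** [pow_gap] with e the number of remaining terms. The power of the length is q and not the sharp q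
    - 1, which does not matter for the short sums to which it is applied. *)
Lemma pow_sum (I : Type) (s : seq I) (F : I -> R) q : 1 <= q ->
  `|\sum_(i <- s) F i| `^ q <= (size s)%:R `^ q * \sum_(i <- s) `|F i| `^ q.
Proof.
move=> q1; have q0 : 0 < q by lra.
elim: s => [|i s IH].
  by rewrite !big_nil normr0 powR0 ?gt_eqF// mulr0.
rewrite !big_cons /=; case: s IH => [|k s] IH.
  by rewrite !big_nil !addr0 powR1 mul1r.
have n0 : 0 < (size (k :: s))%:R :> R by rewrite ltr0n.
set n := (size (k :: s))%:R in IH n0 *; set S := \sum_(j <- k :: s) F j in IH *.
set V := \sum_(j <- k :: s) _ in IH *.
have V0 : 0 <= V by apply: sumr_ge0 => j _; exact: powR_ge0.
have := @pow_gap (F i) S n q q0 n0; move=> h; apply: (le_trans h).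
have -> : (size (k :: s)).+1%:R = 1 + n :> R by rewrite -natr1 addrC.
rewrite mulrDr lerD2l.
apply: (@le_trans _ _ ((1 + n^-1) `^ q * (n `^ q * V))).
  by rewrite ler_wpM2l ?powR_ge0.
rewrite mulrA -powRM ?(ltW n0)//; last by rewrite addr_ge0// invr_ge0 ltW.
by rewrite mulrDl mul1r mulVf ?gt_eqF// addrC.
Qed.

End powers.

Lemma moment_add_arith1 (R : realFieldType) (x y z : R) :
  x <= z -> y <= z -> 4 * x + y <= 5 * z.
Proof. lra. Qed.

Lemma moment_add_arith2 (R : realFieldType) (t y m e : R) : 0 <= t * y ->
  m <= (1 + 7 * t) * (y + y) -> e <= 35 * t * y -> m + e <= 2 * y * (1 + 25 * t).
Proof. lra. Qed.

Section moments.
Context (d : measure_display) (T : measurableType d) (R : realType)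
  (P : probability T R).
Variables (q p : R).
Hypothesis q2 : 2 <= q.
Hypothesis q3 : q <= 3.
Hypothesis qp : q = 2 * p.

Let q0 : 0 < q. Proof. exact: lt_le_trans q2. Qed.
Let p1 : 1 <= p. Proof. by move: q2 qp; lra. Qed.
Let p0 : 0 < p. Proof. by move: q2 qp; lra. Qed.
Let p2 : p <= 3 / 2. Proof. by move: q3 qp; lra. Qed.
Let qp2 : q / 2 = p. Proof. by move: qp; lra. Qed.

Definition bounded_meas (f : T -> R) := measurable_fun setT f /\ exists c, forall w, `|f w| <= c.

Lemma bdd_pow f s : 0 < s -> bounded_meas f -> bounded_meas (fun w => `|f w| `^ s).
Proof.
move=> s0 [mf [c hc]]; split.
  apply: (measurableT_comp (measurable_powR s)); exact: measurableT_comp.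
exists (c `^ s) => w; rewrite ger0_norm ?powR_ge0//; apply: powR_mono => //; exact: ltW.
Qed.

Lemma bdd_integr f : bounded_meas f -> integr P f.
Proof. by move=> [mf [c hc]]; exact: integr_bnd hc. Qed.

Lemma bdd_sqint f : bounded_meas f -> sqint P f.
Proof. by move=> [mf [c hc]]; exact: sqint_bnd hc. Qed.

Lemma bddD f g : bounded_meas f -> bounded_meas g -> bounded_meas (fun w => f w + g w).
Proof.
move=> [mf [a ha]] [mg [b hb]]; split; first exact: measurable_funD.
by exists (a + b) => w; rewrite (le_trans (ler_normD _ _))// lerD.
Qed.

Lemma bddM f g : bounded_meas f -> bounded_meas g -> bounded_meas (fun w => f w * g w).
Proof.
move=> [mf [a ha]] [mg [b hb]]; split; first exact: measurable_funM.
by exists (a * b) => w; rewrite normrM ler_pM.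
Qed.

Definition abs_moment (f : T -> R) : R := Ex P (fun w => `|f w| `^ q).

Lemma moment_integr f : bounded_meas f -> integr P (fun w => `|f w| `^ q).
Proof. by move=> h; apply: bdd_integr; exact: bdd_pow. Qed.

(** Jensen's inequality up to a factor 2, for p <= 2: pointwise, |f|^p is at most S^(p/2) + S^(p/2 -
    1) f^2. *)
Lemma Ex_powp f (S : R) : bounded_meas f -> 0 < S -> norm2 P f ^+ 2 <= S ->
  Ex P (fun w => `|f w| `^ p) <= 2 * S `^ (p / 2).
Proof.
move=> hf S0 hS.
have ip : integr P (fun w => `|f w| `^ p) by apply: bdd_integr; exact: bdd_pow.
have i2 := sqint_sq (bdd_sqint hf).
apply: (@le_trans _ _ (Ex P (fun w => S `^ (p / 2) + S `^ (p / 2) / S * f w ^+ 2))).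
  apply: Ex_le => //; first by integ.
  move=> w; have [h|h] := leP (f w ^+ 2) S.
    apply: (@le_trans _ _ (S `^ (p / 2))).
      have -> : `|f w| `^ p = (f w ^+ 2) `^ (p / 2).
        rewrite -[f w ^+ 2]real_normK ?num_real// -powR_mulrn// -powRrM.
        by congr (_ `^ _); field.
      by rewrite powR_mono ?sqr_ge0// divr_ge0// ltW.
    by rewrite lerDl; apply: mulr_ge0; [apply: divr_ge0; [exact: powR_ge0|exact: ltW]|exact: sqr_ge0].
  apply: (@le_trans _ _ (S `^ (p / 2) / S * f w ^+ 2)); last first.
    by rewrite lerDr powR_ge0.
  have f0 : 0 < `|f w|.
    by rewrite normr_gt0; apply: contraTneq h => ->; rewrite expr0n/= -leNgt ltW.
  have e1 : `|f w| `^ p = (f w ^+ 2) `^ (p / 2 - 1) * f w ^+ 2.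
    rewrite -[f w ^+ 2]real_normK ?num_real// mulrC mulr_powRB1 ?sqr_ge0//; last by move: p0; lra.
    by rewrite -powR_mulrn// -powRrM; congr (_ `^ _); field.
  have e2 : S `^ (p / 2) / S = S `^ (p / 2 - 1).
    by rewrite powRB ?(gt_eqF S0) ?implybT// powRr1// ltW.
  rewrite e1 e2 ler_wpM2r ?sqr_ge0//.
  have -> : p / 2 - 1 = - (1 - p / 2) by ring.
  rewrite !powRN lef_pV2 ?posrE ?powR_gt0//; last exact: lt_trans h.
  by apply: powR_mono; [move: p2; lra|exact: ltW|exact: ltW].
rewrite ExD ?ExZ ?Ex_cst; try integ.
rewrite -n2_sqr mulr_natl mulr2n lerD2l -mulrA mulrC.
apply: (@le_trans _ _ (1 * S `^ (p / 2))); last by rewrite mul1r.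
by rewrite ler_wpM2r ?powR_ge0// mulrC ler_pdivrMr// mul1r.
Qed.

Lemma moment_ge0 f : 0 <= abs_moment f. Proof. by apply: Ex_ge0 => w; exact: powR_ge0. Qed.

Lemma n2_powp f : bounded_meas f -> norm2 P (fun w => `|f w| `^ p) ^+ 2 = abs_moment f.
Proof.
move=> hf; rewrite n2_sqr; apply: eq_Ex => w.
by rewrite -powR_mulrn ?powR_ge0// -powRrM mulrC -qp.
Qed.

(** Y stands for p-th roots of moments of order q and S for variances, both quadratic in scale.
    [pow_add] is used with t = r^(1/p) + S / Y: mixing bounds the expectation of the cross product
    by 4 S^p + r Y^p <= 5 t^p Y^p. When p > 1, doubling thus multiplies Y by about 2^(1/p), less
    than the factor 2 of the variances; this is what keeps the moments of order q under control. *)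
Lemma moment_add_mixing (A B : T -> R) (r S Y : R) : bounded_meas A -> bounded_meas B -> 0 < S -> 0 < Y -> 0 <= r ->
  norm2 P A ^+ 2 <= S -> norm2 P B ^+ 2 <= S -> abs_moment A <= Y `^ p -> abs_moment B <= Y `^ p ->
  `|Ex P (fun w => `|A w| `^ p * `|B w| `^ p)
    - Ex P (fun w => `|A w| `^ p) * Ex P (fun w => `|B w| `^ p)|
  <= r * (norm2 P (fun w => `|A w| `^ p) * norm2 P (fun w => `|B w| `^ p)) ->
  abs_moment (fun w => A w + B w) <=
    (2 `^ p^-1 * (Y * (1 + 25 * r `^ p^-1) + 25 * S)) `^ p.
Proof.
move=> hA hB S0 Y0 r0 A2 B2 AY BY hr.
have [t et] : exists t, t = r `^ p^-1 + S / Y by exists (r `^ p^-1 + S / Y).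
have SY : 0 < S / Y by rewrite divr_gt0.
have t0 : 0 < t by rewrite et ltr_wpDl ?powR_ge0.
have Yp0 : 0 < Y `^ p by exact: powR_gt0.
have hAB : Ex P (fun w => `|A w| `^ p * `|B w| `^ p) <= 4 * S `^ p + r * Y `^ p.
  have e1 := Ex_powp hA S0 A2; have e2 := Ex_powp hB S0 B2.
  have nA : norm2 P (fun w => `|A w| `^ p) <= Num.sqrt (Y `^ p).
    have AY' := AY; rewrite -(n2_powp hA) in AY'.
    by rewrite -[leLHS]ger0_norm ?n2_ge0// -sqrtr_sqr ler_wsqrtr.
  have nB : norm2 P (fun w => `|B w| `^ p) <= Num.sqrt (Y `^ p).
    have BY' := BY; rewrite -(n2_powp hB) in BY'.
    by rewrite -[leLHS]ger0_norm ?n2_ge0// -sqrtr_sqr ler_wsqrtr.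
  have e3 : Ex P (fun w => `|A w| `^ p) * Ex P (fun w => `|B w| `^ p) <= 4 * S `^ p.
    apply: (le_trans (ler_pM _ _ e1 e2)); try by apply: Ex_ge0 => w; exact: powR_ge0.
    rewrite mulrACA -powRD; last by rewrite (gt_eqF S0) implybT.
    by rewrite -splitr -natrM.
  have e4 : norm2 P (fun w => `|A w| `^ p) * norm2 P (fun w => `|B w| `^ p) <= Y `^ p.
    apply: (le_trans (ler_pM _ _ nA nB)); rewrite ?n2_ge0//.
    by rewrite -expr2 sqr_sqrtr// ltW.
  have := le_trans (ler_norm _) hr; rewrite lerBlDr => /le_trans; apply.
  by rewrite addrC lerD//; exact: ler_wpM2l.
have tp : r <= t `^ p.
  rewrite -[leLHS](powRr1 r0) -(@mulVf _ p) ?gt_eqF// powRrM.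
  by apply: powR_mono; rewrite ?powR_ge0 ?(ltW p0)// et lerDl ltW.
have tp2 : S `^ p <= t `^ p * Y `^ p.
  rewrite -powRM ?(ltW t0) ?(ltW Y0)//; apply: powR_mono; rewrite ?(ltW p0) ?(ltW S0)//.
  by rewrite -ler_pdivrMr// et lerDr powR_ge0.
have key : abs_moment (fun w => A w + B w) <= 2 * Y `^ p * (1 + 25 * t).
  have iA := moment_integr hA; have iB := moment_integr hB.
  have iAB : integr P (fun w => `|A w| `^ p * `|B w| `^ p).
    by apply: bdd_integr; apply: bddM; exact: bdd_pow.
  apply: (@le_trans _ _ (Ex P (fun w => (1 + 7 * t) * (`|A w| `^ q + `|B w| `^ q)
    + 7 * t `^ (1 - p) * (`|A w| `^ p * `|B w| `^ p)))).
    apply: Ex_le; [by apply: moment_integr; exact: bddD|by integ|].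
    by move=> w; have := @pow_add _ (A w) (B w) t q q2 q3 t0; rewrite qp2.
  rewrite ExD ?ExZ ?ExD; try integ.
  rewrite -/(abs_moment A) -/(abs_moment B).
  have h1 : 7 * t `^ (1 - p) * Ex P (fun w => `|A w| `^ p * `|B w| `^ p) <=
     35 * t * Y `^ p.
    apply: (@le_trans _ _ (7 * t `^ (1 - p) * (5 * (t `^ p * Y `^ p)))).
      rewrite ler_wpM2l ?mulr_ge0 ?powR_ge0//; apply: (le_trans hAB).
      exact: moment_add_arith1 tp2 (ler_wpM2r (ltW Yp0) tp).
    rewrite powRB ?(gt_eqF t0) ?implybT// (powRr1 (ltW t0)).
    rewrite le_eqVlt; apply/orP; left; apply/eqP.
    by field; rewrite gt_eqF ?powR_gt0.
  have h2 : (1 + 7 * t) * (abs_moment A + abs_moment B) <= (1 + 7 * t) * (Y `^ p + Y `^ p).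
    apply: ler_wpM2l; last exact: (lerD AY BY).
    by apply: addr_ge0; [exact: ler01|apply: mulr_ge0; [exact: ler0n|exact: ltW]].
  exact: moment_add_arith2 (ltW (mulr_gt0 t0 Yp0)) h2 h1.
apply: (le_trans key).
have th0 : 0 < p^-1 by rewrite invr_gt0.
have -> : 2 `^ p^-1 * (Y * (1 + 25 * r `^ p^-1) + 25 * S) =
    2 `^ p^-1 * (Y * (1 + 25 * t)).
  by rewrite et; field; rewrite gt_eqF.
have w1 : 1 <= 1 + 25 * t by rewrite lerDl; apply: mulr_ge0; [exact: ler0n|exact: ltW].
have w0 : 0 <= 1 + 25 * t by exact: le_trans w1.
rewrite powRM; [|exact: powR_ge0|by apply: mulr_ge0 => //; exact: ltW].
rewrite powRM; [|exact: ltW|exact: w0].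
rewrite -powRrM mulVf ?gt_eqF// powRr1; last exact: ler0n.
rewrite mulrA; apply: ler_wpM2l; first by apply: mulr_ge0; [exact: ler0n|exact: ltW].
exact: le1r_powR.
Qed.

(** Since (1 + e)^q is the p-th power of (1 + e)^2, superadditivity of x^p puts both terms under one
    p-th power. *)
Lemma moment_add_gap (f g : T -> R) (Y W e : R) : bounded_meas f -> bounded_meas g -> 0 <= Y -> 0 <= W -> 0 < e ->
  abs_moment f <= Y `^ p -> abs_moment g <= W `^ p ->
  abs_moment (fun w => f w + g w) <= ((1 + e) ^+ 2 * Y + (1 + e^-1) ^+ 2 * W) `^ p.
Proof.
move=> hf hg Y0 W0 e0 hY hW; have ei : 0 < e^-1 by rewrite invr_gt0.
have iF := moment_integr hf; have iG := moment_integr hg.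
have Y1 : 0 <= (1 + e) ^+ 2 * Y by rewrite mulr_ge0// sqr_ge0.
have W1 : 0 <= (1 + e^-1) ^+ 2 * W by rewrite mulr_ge0// sqr_ge0.
apply: le_trans (powR_superadd Y1 W1 p1).
rewrite [((1 + e) ^+ 2 * Y) `^ p]powRM ?sqr_ge0//.
rewrite [((1 + e^-1) ^+ 2 * W) `^ p]powRM ?sqr_ge0//.
have g1 : 0 <= 1 + e := addr_ge0 ler01 (ltW e0).
have g2 : 0 <= 1 + e^-1 := addr_ge0 ler01 (ltW ei).
have e2 x : 0 <= x -> (x ^+ 2) `^ p = x `^ q.
  by move=> x0; rewrite -powR_mulrn// -powRrM -qp.
rewrite (e2 _ g1) (e2 _ g2).
apply: (@le_trans _ _ (Ex P (fun w => (1 + e) `^ q * `|f w| `^ q + (1 + e^-1) `^ q * `|g w| `^ q))).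
  apply: Ex_le; [by apply: moment_integr; exact: bddD|by integ|].
  by move=> w; exact: pow_gap.
rewrite ExD ?ExZ; try integ.
by apply: lerD; apply: ler_wpM2l => //; exact: powR_ge0.
Qed.

(** n^(q + 1) is at most n^(4 p) because 4 p = 2 q: a crude integer exponent, good enough for
    starting blocks and gaps. *)
Lemma moment_sum (I : Type) (s : seq I) (F : I -> T -> R) (Z : R) (n : nat) :
  (forall i, bounded_meas (F i)) -> 0 <= Z -> (forall i, abs_moment (F i) <= Z `^ p) ->
  (size s <= n)%N ->
  abs_moment (fun w => \sum_(i <- s) F i w) <= (n%:R ^+ 4 * Z) `^ p.
Proof.
move=> heatF Z0 hZ sn.
have bsum : bounded_meas (fun w => \sum_(i <- s) F i w).
  elim: s {sn} => [|i s IH].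
    split; first by under eq_fun do rewrite big_nil; exact: measurable_cst.
    by exists 0 => w; rewrite big_nil normr0.
  rewrite (_ : (fun w => _) = (fun w => F i w + \sum_(j <- s) F j w)).
    exact: bddD.
  by apply/funext => w; rewrite big_cons.
have iF i := moment_integr (heatF i).
apply: (@le_trans _ _ (Ex P (fun w => (size s)%:R `^ q * \sum_(i <- s) `|F i w| `^ q))).
  apply: Ex_le; first exact: moment_integr.
    by apply: integrZ; exact: integr_sum.
  by move=> w; apply: pow_sum; move: q2; lra.
rewrite ExZ; last exact: integr_sum.
rewrite (Ex_sum _ iF).
have h1 : \sum_(i <- s) Ex P (fun w => `|F i w| `^ q) <= (size s)%:R * Z `^ p.
  elim: s {sn bsum} => [|i s IH]; first by rewrite big_nil mul0r.
  by rewrite big_cons /= -natr1 mulrDl mul1r addrC lerD//; exact: hZ.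
apply: (@le_trans _ _ (n%:R `^ q * (n%:R * Z `^ p))).
  rewrite ler_pM ?powR_ge0//; first by apply: sumr_ge0 => i _; exact: moment_ge0.
    by apply: powR_mono; rewrite ?(ltW q0)// ler_nat.
  by apply: (le_trans h1); rewrite ler_wpM2r ?powR_ge0// ler_nat.
rewrite powRM ?exprn_ge0// mulrA ler_wpM2r ?powR_ge0//.
case: n {sn h1} => [|n].
  by rewrite mulr0 powR_ge0.
have n1 : 1 <= n.+1%:R :> R by rewrite ler1n.
rewrite -[X in _ * X]powRr1// -powRD; last by rewrite pnatr_eq0 implybT.
rewrite -powR_mulrn// -powRrM; apply: ler_powR => //; move: q2 qp; lra.
Qed.

End moments.

Section arith.
Context {R : realType}.

(** Separates, in one step of the recursion, the contributions of the block (Y), of the variables in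
    the gap (Z) and of the variance (S); r stands for the p-th root of the mixing coefficient. *)
Lemma step_coarse (e r t Y Z S g : R) : 0 < e -> e <= 1 -> 0 <= r -> r <= 1 ->
  0 <= t -> t <= 2 -> 0 <= Y -> 0 <= Z -> 0 <= S -> 0 <= g ->
  (1 + e) ^+ 2 * (t * (((1 + e) ^+ 2 * Y + (1 + e^-1) ^+ 2 * (g ^+ 4 * Z)) * (1 + 25 * r)
     + 25 * S)) + (1 + e^-1) ^+ 2 * ((2 * g) ^+ 4 * Z) <=
  t * expR (15 * e + 25 * r) * Y + 1000 * (g ^+ 4 * e^-1 ^+ 2) * Z + 200 * S.
Proof.
move=> e0 e1 r0 r1 t0 t2 Y0 Z0 S0 g0.
have i1 : 1 <= e^-1 by rewrite invf_ge1.
set u := e^-1 in i1 *.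
have hu : (1 + u) ^+ 2 <= 4 * u ^+ 2.
  have -> : 4 * u ^+ 2 = (2 * u) ^+ 2 by ring.
  by rewrite lerXn2r ?nnegrE//; lra.
have he : (1 + e) ^+ 2 <= 4 by rewrite (_ : 4 = 2 ^+ 2); [rewrite lerXn2r ?nnegrE//; lra|ring].
(* On [0, 1], the convex function (1 + e)^4 lies below its chord 1 + 15 e. *)
have he4 : (1 + e) ^+ 2 * (1 + e) ^+ 2 <= expR (15 * e).
  apply: le_trans (expR_ge1Dx _).
  have ee : e * e <= e * 1 by rewrite ler_wpM2l// ltW.
  have e3 : e * (e * e) <= e * (e * 1) by rewrite ler_wpM2l// ltW.
  have e4 : e * (e * (e * e)) <= e * (e * (e * 1)) by rewrite !ler_wpM2l// ltW.
  have -> : (1 + e) ^+ 2 * (1 + e) ^+ 2 =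
    1 + 4 * e + 6 * (e * e) + 4 * (e * (e * e)) + e * (e * (e * e)) by ring.
  lra.
have hr : 1 + 25 * r <= expR (25 * r) by exact: expR_ge1Dx.
have g4 : 0 <= g ^+ 4 by exact: exprn_ge0.
have hr26 : 1 + 25 * r <= 26 by lra.
have hr0 : 0 <= 1 + 25 * r by lra.
have a0 : 0 <= (1 + e) ^+ 2 by exact: sqr_ge0.
have b0 : 0 <= (1 + u) ^+ 2 by exact: sqr_ge0.
have u0 : 0 <= u ^+ 2 by exact: sqr_ge0.
have -> : (1 + e) ^+ 2 * (t * (((1 + e) ^+ 2 * Y + (1 + u) ^+ 2 * (g ^+ 4 * Z)) * (1 + 25 * r)
     + 25 * S)) + (1 + u) ^+ 2 * ((2 * g) ^+ 4 * Z) =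
  t * ((1 + e) ^+ 2 * (1 + e) ^+ 2 * (1 + 25 * r)) * Y
   + ((1 + e) ^+ 2 * (t * (1 + 25 * r)) * ((1 + u) ^+ 2) + 16 * (1 + u) ^+ 2) * (g ^+ 4 * Z)
   + (1 + e) ^+ 2 * t * 25 * S by ring.
apply: lerD; first apply: lerD.
- apply: ler_wpM2r => //; apply: ler_wpM2l => //.
  rewrite expRD; apply: ler_pM => //; exact: mulr_ge0.
- have -> : 1000 * (g ^+ 4 * u ^+ 2) * Z = 1000 * u ^+ 2 * (g ^+ 4 * Z) by ring.
  apply: ler_wpM2r; first exact: mulr_ge0.
  apply: (@le_trans _ _ (4 * (2 * 26) * (4 * u ^+ 2) + 16 * (4 * u ^+ 2))); last by lra.
  apply: lerD; last by apply: ler_wpM2l.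
  apply: ler_pM => //; first by apply: mulr_ge0 => //; exact: mulr_ge0.
  apply: ler_pM => //; first exact: mulr_ge0.
  exact: ler_pM.
- apply: ler_wpM2r => //.
  have : (1 + e) ^+ 2 * t <= 4 * 2 by exact: ler_pM.
  lra.
Qed.

(* [G] is the size of a gap to the fourth power *)
Lemma chain_step (t x x' Q Kd K1 K2 K3 Z V Ps tp Lm LJ L' G : R) :
  1 <= t -> 0 <= x -> 1 <= K1 -> 1 <= Ps -> 1 <= tp -> 0 <= Z -> 0 <= V ->
  0 <= LJ -> 0 <= K2 -> 1000 * G <= x' * tp -> x + x' <= Kd -> t * expR x <= L' ->
  0 <= x' ->
  200 * K3 <= K2 * (Lm - L') ->
  Q <= t * expR x * (K1 * Z * tp * Ps + K2 * V * LJ) + 1000 * G * Z + 200 * (K3 * V * LJ) ->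
  Q <= K1 * Z * (tp * t) * (Ps * expR Kd) + K2 * V * (LJ * Lm).
Proof.
move=> t1 x0 K11 P1 tp1 Z0 V0 LJ0 K20 hG hK hL x'0 hK2 /le_trans; apply.
rewrite [leLHS](_ : _ = (t * expR x * (K1 * Z * tp * Ps) + 1000 * G * Z)
  + V * LJ * (K2 * (t * expR x) + 200 * K3)); last by ring.
rewrite [K2 * V * _](_ : _ = V * LJ * (K2 * Lm)); last by ring.
apply: lerD; last first.
  apply: ler_wpM2l; first exact: mulr_ge0.
  have := ler_wpM2l K20 hL; lra.
have e1 : expR x + x' <= expR Kd.
  apply: (@le_trans _ _ (expR (x + x'))); last by rewrite ler_expR.
  rewrite expRD; have ex : 1 <= expR x by rewrite -expR0 ler_expR.
  apply: (@le_trans _ _ (expR x * (1 + x'))).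
    by rewrite mulrDr mulr1 lerD2l -[leLHS]mul1r ler_wpM2r.
  by rewrite ler_wpM2l ?expR_ge0// expR_ge1Dx.
apply: (@le_trans _ _ (K1 * Z * (tp * t) * (Ps * (expR x + x')))); last first.
  apply: ler_wpM2l; last by apply: ler_wpM2l => //; lra.
  by rewrite !mulr_ge0//; lra.
rewrite [leRHS](_ : _ = t * expR x * (K1 * Z * tp * Ps) + K1 * Ps * t * (x' * tp) * Z); last by ring.
rewrite lerD2l; apply: ler_wpM2r => //; apply: (le_trans hG).
rewrite -[leLHS]mul1r; apply: ler_wpM2r; first by rewrite mulr_ge0//; lra.
by rewrite !mulr_ege1.
Qed.

End arith.

Lemma gap_with_parity_le (g : nat) (o : bool) : (0 < g)%N -> (g + o <= 2 * g)%N.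
Proof. case: o => /=; lia. Qed.

Lemma blk_before_gap (m : nat) (t : int) :
  (1 - m%:Z <= t) && (t < 1 - m%:Z + m%:Z) -> t <= 0.
Proof. lia. Qed.

Lemma blk_after_gap (g k : nat) (t : int) :
  (1 + g%:Z <= t) && (t < 1 + g%:Z + k%:Z) -> g%:Z <= t.
Proof. lia. Qed.

(** * The recursion for moments of order q over dyadic scales *)

Section chain.
Context (d : measure_display) (T : measurableType d) (R : realType)
  (P : probability T R) (X : int -> {RV P >-> R}).
Hypothesis stationaryX : strictly_stationary P X.
Local Notation tau := (tau X).

Variables (q p : R).
Hypothesis q2 : 2 <= q.
Hypothesis q3 : q <= 3.
Hypothesis qp : q = 2 * p.

Definition block_moment (psi : R -> R) (n : nat) : R := abs_moment P q (Tn X psi n).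

Section one_function.
Variable psi : R -> R.
Hypothesis mpsi : measurable_fun setT psi.
Hypothesis bpsi : exists A, forall x, `|psi x| <= A.

Lemma bdd_psi t : bounded_meas (fun w => psi (X t w)).
Proof.
split; first exact: measurableT_comp.
by case: bpsi => A hA; exists A.
Qed.

Lemma bdd_Sx s : bounded_meas (Sx X psi s).
Proof.
split; first exact: measurable_Sx.
case: bpsi => A hA; exists ((size s)%:R * A) => w; rewrite /Sx.
elim: s => [|t s IH]; first by rewrite big_nil normr0 mul0r.
by rewrite big_cons /= -natr1 mulrDl mul1r addrC (le_trans (ler_normD _ _))// lerD.
Qed.

Let q0 : 0 < q. Proof. exact: lt_le_trans q2. Qed.

Let mF (s : R) : measurable_fun setT (fun x : R => `|x| `^ s).
Proof. by apply: (measurableT_comp (measurable_powR s)). Qed.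

Lemma moment_blk a n : abs_moment P q (Sx X psi (blk a n)) = block_moment psi n.
Proof.
apply: (@blk_Ex _ _ _ P X stationaryX psi mpsi (fun x => `|x| `^ q)) => //.
exact: (moment_integr P q2 (bdd_Sx _)).
Qed.

Lemma moment_stationary t : abs_moment P q (fun w => psi (X t w)) = abs_moment P q (fun w => psi (X 0 w)).
Proof.
have e u : abs_moment P q (fun w => psi (X u w)) = block_moment psi 1.
  rewrite -(moment_blk u 1); congr abs_moment; apply/funext => w; by rewrite Sx1.
by rewrite !e.
Qed.

Let psi2 : sqint P (fun w => psi (X 0 w)).
Proof. exact: (bdd_sqint P (bdd_psi 0)). Qed.

Lemma moment_Sx_le s (n : nat) (Z : R) : 0 <= Z ->
  abs_moment P q (fun w => psi (X 0 w)) <= Z `^ p -> (size s <= n)%N ->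
  abs_moment P q (Sx X psi s) <= (n%:R ^+ 4 * Z) `^ p.
Proof.
move=> Z0 hZ hs.
have hZ' t : abs_moment P q (fun w => psi (X t w)) <= Z `^ p by rewrite moment_stationary.
exact: (@moment_sum _ _ _ P q p q2 qp _ s (fun t w => psi (X t w)) Z n bdd_psi Z0 hZ' hs).
Qed.

(** A ends at time 0 and B' starts beyond the gap G. Passing from B to B' = B - G and restoring G at
    the end each cost a factor (1 + e)^2, plus (1 + 1/e)^2 times the root of the moment of the gap.
    A possible odd variable is put in H together with the gap, whence the length 2 g. *)
Lemma block_moment_doubling (m g : nat) (o : bool) (r Y Z S e : R) :
  (0 < g)%N -> (g <= m)%N -> (rho P X g <= r%:E)%E -> 0 <= r ->
  0 < Y -> 0 <= Z -> 0 < S -> 0 < e ->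
  block_moment psi m <= Y `^ p -> abs_moment P q (fun w => psi (X 0 w)) <= Z `^ p ->
  (tau psi m + tau psi g) ^+ 2 <= S ->
  block_moment psi (m + m + o) <=
   ((1 + e) ^+ 2 * (2 `^ p^-1 * (((1 + e) ^+ 2 * Y + (1 + e^-1) ^+ 2 * (g%:R ^+ 4 * Z))
      * (1 + 25 * r `^ p^-1) + 25 * S))
      + (1 + e^-1) ^+ 2 * ((2 * g%:R) ^+ 4 * Z)) `^ p.
Proof.
move=> g0 gm hr r0 Y0 Z0 S0 e0 hY hZ hS.
have p0 : 0 < p by move: q2 qp; lra.
pose A := Sx X psi (blk (1 - m%:Z) m); pose B := Sx X psi (blk 1 m).
pose G := Sx X psi (blk 1 g); pose B' := Sx X psi (blk (1 + g%:Z) (m - g)).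
pose H := Sx X psi (blk 1 g ++ blk (1 + m%:Z) o).
have hA : bounded_meas A := bdd_Sx _.
have hB : bounded_meas B := bdd_Sx _.
have hG : bounded_meas G := bdd_Sx _.
have hB' : bounded_meas B' := bdd_Sx _.
have hH : bounded_meas H := bdd_Sx _.
have eB w : B w = G w + B' w by rewrite -Sx_blkD subnKC.
have nA : norm2 P A = tau psi m by exact: blk_n2.
have nG : norm2 P G = tau psi g by exact: blk_n2.
have t0 k : 0 <= tau psi k by exact: n2_ge0.
have nB' : norm2 P B' <= tau psi m + tau psi g.
  have nB : norm2 P B = tau psi m by exact: blk_n2.
  rewrite -nB -nG (@eq_n2 _ _ _ _ B' (fun w => B w - G w)); last by move=> w; rewrite eB; ring.
  by apply: n2B; exact: bdd_sqint.
have MG : abs_moment P q (fun w => - G w) <= (g%:R ^+ 4 * Z) `^ p.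
  rewrite (_ : abs_moment P q _ = abs_moment P q G); last by apply: eq_Ex => w; rewrite normrN.
  by apply: moment_Sx_le => //; rewrite size_map size_iota.
have MH : abs_moment P q H <= ((2 * g%:R) ^+ 4 * Z) `^ p.
  rewrite -natrM; apply: moment_Sx_le => //.
  by rewrite size_cat !size_map !size_iota; exact: gap_with_parity_le.
have W0 : 0 <= g%:R ^+ 4 * Z by rewrite mulr_ge0// exprn_ge0.
have hGN : bounded_meas (fun w => - G w).
  by case: hG => mG [c hc]; split; [exact: measurable_funN|exists c => w; rewrite normrN].
have MB' : abs_moment P q B' <= ((1 + e) ^+ 2 * Y + (1 + e^-1) ^+ 2 * (g%:R ^+ 4 * Z)) `^ p.
  rewrite (_ : B' = (fun w => B w + (- G w))); last by apply/funext => w; rewrite eB; ring.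
  apply: (moment_add_gap q2 qp hB hGN (ltW Y0) W0 e0 _ MG).
  by rewrite /B moment_blk.
have Y1 : Y <= (1 + e) ^+ 2 * Y + (1 + e^-1) ^+ 2 * (g%:R ^+ 4 * Z).
  apply: ler_wpDr; first by rewrite mulr_ge0// sqr_ge0.
  rewrite -[leLHS]mul1r ler_wpM2r ?(ltW Y0)//.
  by rewrite exprn_ege1// lerDl ltW.
set Yt := _ + _ in MB' Y1 *.
have Yt0 : 0 < Yt by apply: lt_le_trans Y1.
have MA : abs_moment P q A <= Yt `^ p.
  rewrite /A moment_blk; apply: (le_trans hY); apply: powR_mono; [exact: ltW|exact: ltW|exact: Y1].
have tge : 0 <= tau psi m + tau psi g by rewrite addr_ge0.
have A2 : norm2 P A ^+ 2 <= S.
  apply: le_trans hS; rewrite nA lerXn2r ?nnegrE//; by rewrite lerDl.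
have B2 : norm2 P B' ^+ 2 <= S.
  by apply: le_trans hS; rewrite lerXn2r ?nnegrE// n2_ge0.
have mix : `|Ex P (fun w => `|A w| `^ p * `|B' w| `^ p)
    - Ex P (fun w => `|A w| `^ p) * Ex P (fun w => `|B' w| `^ p)|
  <= r * (norm2 P (fun w => `|A w| `^ p) * norm2 P (fun w => `|B' w| `^ p)).
  apply: (@Sx_mixing _ _ _ P X psi psi g r (blk (1 - m%:Z) m) (blk (1 + g%:Z) (m - g))
    (fun x => `|x| `^ p) (fun x => `|x| `^ p)) => //.
  - by move=> t /mem_blk/blk_before_gap.
  - by move=> t /mem_blk/blk_after_gap.
  - by apply: bdd_sqint; exact: bdd_pow.
  - by apply: bdd_sqint; exact: bdd_pow.
have MAB := moment_add_mixing q2 q3 qp hA hB' S0 Yt0 r0 A2 B2 MA MB' mix.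
have eT : abs_moment P q (fun w => (A w + B' w) + H w) = block_moment psi (m + m + o).
  rewrite -(moment_blk (1 - m%:Z)); congr abs_moment; apply/funext => w.
  rewrite Sx_blkD Sx_blkD.
  rewrite (_ : 1 - m%:Z + m%:Z = 1); last by ring.
  rewrite (_ : 1 - m%:Z + (m + m)%N%:Z = 1 + m%:Z); last by rewrite PoszD; ring.
  rewrite -/(A w) -/(B w) eB /H Sx_cat -/(G w); ring.
rewrite -eT; apply: (moment_add_gap q2 qp (bddD hA hB') hH _ _ e0 MAB MH).
  apply: mulr_ge0; first exact: powR_ge0.
  apply: addr_ge0; last exact: mulr_ge0 (ler0n _ _) (ltW S0).
  apply: mulr_ge0; first exact: ltW.
  exact: addr_ge0 ler01 (mulr_ge0 (ler0n _ _) (powR_ge0 _ _)).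
by rewrite mulr_ge0// exprn_ge0// mulr_ge0.
Qed.

End one_function.

End chain.

Section rates.
Context {R : realType}.

(** At scale i the gap has length 2^(i/16). Its logarithm is only a fixed fraction of i, which costs
    a constant factor in the rate: harmless here, since the coefficient of [D] in the exponent is
    free, unlike that of [Lam]. *)
Lemma rate_le (alpha beta theta : R) i : 0 < alpha -> 0 < beta -> beta <= 1 ->
  0 < theta -> theta <= 1 -> (32 <= i)%N ->
  (alpha * (i %/ 16)%N%:R `^ (- beta)) `^ theta <=
  32 * alpha `^ theta * i.+1%:R `^ (- (theta * beta)).
Proof.
move=> a0 b0 b1 t0 t1 hi.
rewrite powRM ?(ltW a0) ?powR_ge0// -powRrM (_ : - beta * theta = - (theta * beta)); last by ring.
set s := theta * beta.
have s0 : 0 < s by rewrite mulr_gt0.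
have s1 : s <= 1 by rewrite mulr_ile1// ltW.
rewrite [leRHS]mulrAC mulrC ler_pM2r ?powR_gt0//.
have h : (i.+1 <= i %/ 16 * 32)%N by lia.
have h2 : i.+1%:R / 32 <= (i %/ 16)%N%:R :> R.
  by rewrite ler_pdivrMr// -natrM ler_nat.
have x0 : 0 < i.+1%:R :> R by [].
apply: (le_trans (powRN_le _ h2 (ltW s0))); first by rewrite divr_gt0.
rewrite powRM ?invr_ge0//; rewrite mulrC ler_wpM2r ?powR_ge0//.
rewrite -powR_inv1// -powRrM mulN1r opprK; apply: ler1_powR => //.
by rewrite ler1n.
Qed.

(** The fourth power of the gap is at most 2^(i/4), and 1/4 < 2/3 leaves a geometric factor that
    beats all powers of i. *)
Lemma gap_rate (t : R) : 2 `^ (2 / 3) <= t -> exists2 C, 0 < C &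
  forall i, (2 ^ (i %/ 16))%N%:R ^+ 4 * i.+1%:R ^+ 2 <= C * i.+1%:R^-1 * t ^+ i.
Proof.
move=> ht.
have t23 : 0 < 2 `^ (2 / 3) :> R by exact: powR_gt0.
have t0 : 0 < t by apply: lt_le_trans ht.
pose s4 : R := 2 `^ 4^-1.
have s40 : 0 < s4 by apply: powR_gt0.
have s44 : s4 ^+ 4 = 2 by rewrite -powR_mulrn ?powR_ge0// -powRrM mulVf ?powRr1.
have s41 : 1 <= s4.
  by rewrite -[leLHS](powRr0 2); apply: ler_powR; rewrite ?ler1n ?invr_ge0.
have st : s4 < t.
  apply: lt_le_trans ht; rewrite /s4 /powR !gt_eqF// ltr_expR.
  by rewrite ltr_pM2r ?ln2_gt0//; lra.
have w0 : 0 < s4 / t by rewrite divr_gt0.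
pose z := Num.sqrt (s4 / t).
have z0 : 0 < z by rewrite sqrtr_gt0.
have z2 : z ^+ 2 = s4 / t by rewrite sqr_sqrtr// ltW.
have z1 : z < 1.
  rewrite -(@ltr_pXn2r _ 2%N) ?nnegrE ?(ltW z0)// z2 expr1n ltr_pdivrMr// mul1r.
  exact: st.
have [C C0 hC] := geometric_le_invsqr z0 z1.
exists (C ^+ 2); first by rewrite exprn_gt0.
move=> i; have x0 : 0 < i.+1%:R :> R by [].
have x1 : 1 <= i.+1%:R :> R by rewrite ler1n.
have g4 : (2 ^ (i %/ 16))%N%:R ^+ 4 <= s4 ^+ i :> R.
  rewrite natrX -exprM -s44 -exprM ler_weXn2l//.
  by have := leq_trunc_div i 16; move: (i %/ 16)%N => k; clear; lia.
have e : s4 ^+ i = (z ^+ i) ^+ 2 * t ^+ i.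
  by rewrite exprAC z2 -exprMn divfK ?gt_eqF.
have hz : (z ^+ i) ^+ 2 <= (C * (i.+1%:R ^+ 2)^-1) ^+ 2.
  by rewrite lerXn2r ?nnegrE ?exprn_ge0 ?(ltW z0) ?mulr_ge0 ?invr_ge0 ?exprn_ge0 ?(ltW C0).
have ti : 0 <= t ^+ i by rewrite exprn_ge0// ltW.
apply: (@le_trans _ _ ((C * (i.+1%:R ^+ 2)^-1) ^+ 2 * t ^+ i * i.+1%:R ^+ 2)).
  rewrite ler_wpM2r ?sqr_ge0//; apply: (le_trans g4); rewrite e.
  by rewrite ler_wpM2r.
have -> : (C * (i.+1%:R ^+ 2)^-1) ^+ 2 * t ^+ i * i.+1%:R ^+ 2 =
    C ^+ 2 * (i.+1%:R ^+ 2)^-1 * t ^+ i.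
  by field; rewrite gt_eqF.
rewrite ler_wpM2r// ler_wpM2l ?sqr_ge0// lef_pV2 ?posrE ?exprn_gt0//.
by rewrite expr2 ler_peMl// ltW.
Qed.

Lemma chain_arith1 (e u C5 r : R) : e <= u -> r <= C5 * u ->
  15 * e + 25 * r <= (15 + 25 * C5) * u.
Proof. lra. Qed.

Lemma step_coarse_ge0 (e r t Y Z S g : R) : 0 <= e -> 0 <= r ->
  0 <= t -> 0 <= Y -> 0 <= Z -> 0 <= S -> 0 <= g ->
  0 <= (1 + e) ^+ 2 * (t * (((1 + e) ^+ 2 * Y + (1 + e^-1) ^+ 2 * (g ^+ 4 * Z)) * (1 + 25 * r)
     + 25 * S)) + (1 + e^-1) ^+ 2 * ((2 * g) ^+ 4 * Z).
Proof.
move=> e0 r0 t0 Y0 Z0 S0 g0.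
have g4 : 0 <= g ^+ 4 * Z by apply: mulr_ge0 => //; exact: exprn_ge0.
have h4 : 0 <= (2 * g) ^+ 4 * Z by apply: mulr_ge0 => //; apply: exprn_ge0; exact: mulr_ge0.
have h1 : 0 <= (1 + e) ^+ 2 * Y + (1 + e^-1) ^+ 2 * (g ^+ 4 * Z).
  by apply: addr_ge0; apply: mulr_ge0 => //; exact: sqr_ge0.
have h2 : 0 <= 1 + 25 * r by apply: addr_ge0 => //; exact: mulr_ge0.
apply: addr_ge0; apply: mulr_ge0; rewrite ?sqr_ge0//.
by apply: mulr_ge0 => //; apply: addr_ge0; exact: mulr_ge0.
Qed.

End rates.

Section chain.
Context (d : measure_display) (T : measurableType d) (R : realType)
  (P : probability T R) (X : int -> {RV P >-> R}).
Hypothesis stationaryX : strictly_stationary P X.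
Local Notation tau := (tau X).

Variables (q p : R).
Hypothesis q2 : 2 < q.
Hypothesis q3 : q <= 3.
Hypothesis qp : q = 2 * p.

Variables (alpha beta K3 Lm : R) (N0 : nat) (D : nat -> R).
Hypothesis a0 : 0 < alpha.
Hypothesis b0 : 0 < beta.
Hypothesis b1 : beta <= 1.
Hypothesis K30 : 0 < K3.
Hypothesis hLm : 2 `^ p^-1 < Lm.
Hypothesis hrho : forall n, (N0 <= n)%N ->
  (rho P X n <= (alpha * (log2 n%:R) `^ (- beta))%:E)%E.
Hypothesis D0 : forall j, (1 <= j)%N -> 0 <= D j.
Hypothesis DS : forall j, (1 <= j)%N ->
  j.+1%:R `^ (- (p^-1 * beta)) <= D j.+1 - D j.

(** Z bounds the p-th root of the moment of one variable and V is the variance scale at length n.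
    The recursion follows the lengths n / 2^(J - i). Down the scales the variances decay by the
    factor Lm, faster than the factor 2^(1/p) by which moments are multiplied at each doubling, so
    that their contributions form a geometric sum bounded by a multiple of V. K1, K2, K and i0
    depend neither on psi nor on n, which allows a truncation varying with n. *)
Lemma block_moment_le : exists (K1 K2 K : R) (i0 : nat), [/\ 1 <= K1, 0 <= K2, 0 <= K, (N0 <= i0)%N &
  forall psi : R -> R, measurable_fun setT psi -> (exists A, forall x, `|psi x| <= A) ->
  forall (Z V : R) (J n : nat), 0 <= Z -> 0 < V -> (i0 <= J)%N ->
  (2 ^ J <= n)%N -> (n < 2 ^ J.+1)%N ->
  abs_moment P q (fun w => psi (X 0 w)) <= Z `^ p ->
  (forall i, (i0 <= i)%N -> (i <= J)%N ->
    (tau psi (n %/ 2 ^ (J - i)) + tau psi (2 ^ (i %/ 16))) ^+ 2 <=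
    K3 * V * Lm ^- (J - i)) ->
  block_moment X q psi n <= (K1 * Z * (2 `^ p^-1) ^+ J * expR (K * D J) + K2 * V) `^ p].
Proof.
have p1 : 1 < p by move: q2 qp; lra.
have p32 : p <= 3 / 2 by move: q3 qp; lra.
have p0 : 0 < p by lra.
pose th := p^-1.
have th0 : 0 < th by rewrite invr_gt0.
have th1 : th < 1 by rewrite invf_lt1.
have th23 : 2 / 3 <= th by rewrite -[leLHS]invrK lef_pV2 ?posrE ?invr_gt0//; lra.
rewrite -/th.
have [t te] : exists t, t = 2 `^ th by exists (2 `^ th).
rewrite -te.
have t1 : 1 <= t by rewrite te -[leLHS](powRr0 2); apply: ler_powR; rewrite ?ler1n// ltW.
have t2 : t <= 2 by rewrite te; apply: ler1_powR; rewrite ?ler1n// ltW.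
have t23 : 2 `^ (2 / 3) <= t by rewrite te; apply: ler_powR => //; rewrite ler1n.
have tL : t < Lm by rewrite te.
have [C4 C40 hC4] := gap_rate t23.
pose C5 := 32 * alpha `^ th; pose C6 := 15 + 25 * C5; pose C7 := 1000 * C4.
have C50 : 0 < C5 by rewrite mulr_gt0// powR_gt0.
have C60 : 0 < C6 by rewrite /C6; lra.
have C70 : 0 < C7 by apply: mulr_gt0; [rewrite ltr0n|exact: C40].
pose s := th * beta.
have s0 : 0 < s by rewrite mulr_gt0.
have s1 : s <= 1 by rewrite mulr_ile1// ltW.
(* Room between t and Lm: from i0 on, one step multiplies by at most L', and K2 solves K2 L' + 200
   K3 = K2 Lm, so that the new variance term fits. *)
pose L' := (t + Lm) / 2.
have tL' : t < L' by rewrite /L'; lra.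
have L'L : L' < Lm by rewrite /L'; lra.
have t0 : 0 < t by lra.
have e0 : 0 < ln (L' / t) by rewrite ln_gt0// ltr_pdivlMr// mul1r.
have L'0 : 0 < L' by lra.
have Lm0 : 0 < Lm by lra.
have [i1 hi1] := powRN_small C60 s0 e0.
have [i2 hi2] := powRN_small C50 s0 (@ltr01 R).
pose i0 := (i1 + i2 + 16 * N0 + 32)%N.
have K200 : 0 <= 200 * K3 / (Lm - L').
  apply: divr_ge0; last by rewrite subr_ge0 ltW.
  by apply: mulr_ge0; [exact: ler0n|exact: ltW].
exists ((2 ^ i0.+1)%N%:R ^+ 4), (200 * K3 / (Lm - L')), (C6 + C7), i0.
split.
- by rewrite exprn_ege1// ler1n expn_gt0.
- by [].
- by rewrite addr_ge0// ltW.
- by rewrite /i0; clear; lia.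
move=> psi mpsi bpsi Z V J n Z0 V0 iJ n1 norm2 hZ hS.
move eK1 : ((2 ^ i0.+1)%N%:R ^+ 4) => K1; move eK2 : (200 * K3 / (Lm - L')) => K2.
move eK : (C6 + C7) => K.
have K20 : 0 < K2.
  rewrite -eK2; apply: divr_gt0; last by rewrite subr_gt0.
  by apply: mulr_gt0; [rewrite ltr0n|exact: K30].
have K11 : 1 <= K1 by rewrite -eK1 exprn_ege1// ler1n expn_gt0.
have K10 : 0 <= K1 := le_trans ler01 K11.
pose U i := K1 * Z * t ^+ i * expR (K * D i) + K2 * V * Lm ^- (J - i).
suff main : forall k, (i0 + k <= J)%N ->
    block_moment X q psi (n %/ 2 ^ (J - (i0 + k))) <= (U (i0 + k)%N) `^ p.
  have := main (J - i0)%N; rewrite subnKC// leqnn subnn expn0 divn1 => /(_ isT).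
  by rewrite /U subnn expr0 invr1 mulr1.
have Kp : 0 <= K by rewrite -eK addr_ge0// ltW.
have Ps1 i : (i0 <= i)%N -> 1 <= expR (K * D i).
  move=> hi; rewrite -expR0 ler_expR mulr_ge0// D0//.
  by apply: leq_trans hi; rewrite /i0 addnS.
have ti1 i : 1 <= t ^+ i by rewrite exprn_ege1.
have LJ0 k : 0 < Lm ^- k by rewrite invr_gt0 exprn_gt0.
have KZ i : (i0 <= i)%N -> K1 * Z <= K1 * Z * t ^+ i * expR (K * D i).
  move=> hi; rewrite -mulrA ler_peMr//; first exact: mulr_ge0.
  by apply: mulr_ege1 => //; exact: Ps1.
have level k : (i0 + k <= J)%N -> (2 ^ (i0 + k) <= n %/ 2 ^ (J - (i0 + k)))%N /\
    (n %/ 2 ^ (J - (i0 + k)) < 2 ^ (i0 + k).+1)%N.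
  move=> hk; rewrite leq_divRL ?expn_gt0// ltn_divLR ?expn_gt0// -!expnD.
  by rewrite addSn subnKC.
elim=> [|k IH] hk.
  have [_ ml] := level 0 hk.
  rewrite addn0 in hk ml *.
  have hs : (size (blk 1 (n %/ 2 ^ (J - i0))) <= 2 ^ i0.+1)%N.
    by rewrite size_map size_iota ltnW.
  apply: (le_trans (moment_Sx_le stationaryX (ltW q2) qp mpsi bpsi Z0 hZ hs)).
  apply: powR_mono; [exact: ltW|by rewrite mulr_ge0// exprn_ge0|].
  rewrite eK1; apply: (le_trans (KZ i0 (leqnn _))).
  rewrite lerDl; apply: mulr_ge0; last exact/ltW/LJ0.
  by apply: mulr_ge0; exact: ltW.
rewrite addnS in hk *.
have hk' : (i0 + k <= J)%N := ltnW hk.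
have {IH} := IH hk'; have [m1 m2] := level k hk'.
have ihi : (i0 <= i0 + k)%N by exact: leq_addr.
set i := (i0 + k)%N in hk hk' m1 m2 ihi *.
set m := (n %/ 2 ^ (J - i))%N in m1 m2 *.
have eJ : (J - i = (J - i.+1).+1)%N by rewrite subnSK.
have em : m = (n %/ 2 ^ (J - i.+1))./2 by rewrite /m eJ expnSr divnMA divn2.
have en : (n %/ 2 ^ (J - i.+1))%N = (m + m + odd (n %/ 2 ^ (J - i.+1)))%N.
  by rewrite em -halfE.
move=> IH; rewrite en.
set o := odd _.
have hSi := hS i ihi hk'; rewrite -/m in hSi.
pose g := (2 ^ (i %/ 16))%N.
have i32 : (32 <= i)%N by apply: leq_trans ihi; rewrite /i0 leq_addl.
have g0 : (0 < g)%N by rewrite expn_gt0.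
have gm : (g <= m)%N.
  by apply: leq_trans m1; rewrite leq_exp2l// leq_div.
have Ng : (N0 <= g)%N.
  have hN : (N0 <= i %/ 16)%N.
    rewrite leq_divRL// mulnC; apply: leq_trans ihi; rewrite /i0.
    by rewrite -addnA addnCA leq_addr.
  by apply: (leq_trans hN); rewrite ltnW// ltn_expl.
pose r := alpha * (i %/ 16)%N%:R `^ (- beta).
have i16 : (0 < i %/ 16)%N by rewrite divn_gt0// (leq_trans _ i32).
have hr : (rho P X g <= r%:E)%E.
  apply: (le_trans (hrho Ng)); rewrite lee_fin ler_pM2l//.
  by apply: powRN_le; [rewrite ltr0n|exact: log2_natX|exact: ltW].
have r0 : 0 <= r by rewrite mulr_ge0 ?powR_ge0// ltW.
have Ui0 : 0 < U i.
  rewrite ltr_wpDl//; first by apply: le_trans (KZ i ihi); exact: mulr_ge0.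
  by apply: mulr_gt0 => //; exact: mulr_gt0.
have S0 : 0 < K3 * V * Lm ^- (J - i) by rewrite !mulr_gt0.
(* Small enough to be absorbed by the rate i^(- theta beta), as theta beta <= 1, while e^(- 2) stays
   polynomial and is absorbed by [gap_rate]. *)
pose e : R := i.+1%:R^-1.
have e0' : 0 < e by rewrite invr_gt0.
have e1' : e <= 1 by rewrite invf_le1// ler1n.
have stp := block_moment_doubling stationaryX (ltW q2) q3 qp mpsi bpsi o g0 gm hr r0 Ui0 Z0 S0 e0' IH hZ hSi.
apply: (le_trans stp); clear stp.
have x0 : 0 < i.+1%:R :> R by [].
have x1 : 1 <= i.+1%:R :> R by rewrite ler1n.
set u : R := i.+1%:R `^ (- s).
have hru : r `^ th <= C5 * u by exact: rate_le (ltW th1) i32.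
have eu : e <= u.
  by rewrite /e -powR_inv1 ?(ltW x0)//; apply: ler_powR => //; rewrite lerN2.
have u0 : 0 <= u by exact: powR_ge0.
have ii1 : (i1 <= i)%N by apply: leq_trans ihi; rewrite /i0 -!addnA leq_addr.
have ii2 : (i2 <= i)%N by apply: leq_trans ihi; rewrite /i0 -!addnA addnCA leq_addr.
have hu1 := hi1 i ii1; have hu2 := hi2 i ii2; rewrite -/u in hu1 hu2.
have rt0 : 0 <= r `^ th by exact: powR_ge0.
have r1 : r `^ th <= 1 by apply: (le_trans hru).
have gR0 : 0 <= g%:R :> R by [].
have co := step_coarse e0' e1' rt0 r1 (ltW t0) t2 (ltW Ui0) Z0 (ltW S0) gR0.
rewrite -/th -te.
apply: powR_mono; first exact: ltW.
  exact: step_coarse_ge0 (ltW e0') rt0 (ltW t0) (ltW Ui0) Z0 (ltW S0) gR0.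
have hx0 : 0 <= 15 * e + 25 * r `^ th.
  by apply: addr_ge0; apply: mulr_ge0 => //; rewrite ?ler0n ?(ltW e0').
have hxC : 15 * e + 25 * r `^ th <= C6 * u by exact: chain_arith1.
have hG : 1000 * (g%:R ^+ 4 * e^-1 ^+ 2) <= C7 * e * t ^+ i.
  rewrite /C7 -!mulrA; apply: ler_wpM2l; first exact: ler0n.
  by have := hC4 i; rewrite -!mulrA /e invrK.
have hKd : 15 * e + 25 * r `^ th + C7 * e <= K * (D i.+1 - D i).
  apply: (@le_trans _ _ (K * u)); last first.
    apply: ler_wpM2l => //; apply: DS; exact: leq_trans i32.
  have -> : K * u = C6 * u + C7 * u by rewrite -eK [LHS]mulrDl.
  by apply: lerD => //; apply: ler_wpM2l => //; exact: ltW.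
have hL : t * expR (15 * e + 25 * r `^ th) <= L'.
  rewrite mulrC -ler_pdivlMr// -[leRHS](@lnK _ (L' / t)); last by rewrite posrE divr_gt0.
  by rewrite ler_expR (le_trans hxC).
have hK2 : 200 * K3 <= K2 * (Lm - L').
  by rewrite -eK2 divfK// gt_eqF// subr_gt0.
have Ce0 : 0 <= C7 * e by apply: mulr_ge0; exact: ltW.
have := chain_step t1 hx0 K11 (Ps1 i ihi) (ti1 i) Z0 (ltW V0) (ltW (LJ0 (J - i)%N))
  (ltW K20) hG hKd hL Ce0 hK2 co.
have eD : K * D i + K * (D i.+1 - D i) = K * D i.+1 by rewrite -mulrDr addrC subrK.
rewrite -exprSr -expRD eD.
have -> : Lm ^- (J - i) * Lm = Lm ^- (J - i.+1).
  by rewrite eJ exprS invfM mulrAC mulVf ?mul1r// gt_eqF.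
by [].
Qed.

End chain.

(** * Truncation and uniform integrability *)

Section truncation.
Context {R : realType}.
Implicit Types k x a b : R.

Definition tl k x : R := if k < `|x| then x ^+ 2 else 0.
Definition trunc a x : R := if `|x| <= a then x else 0.

Lemma measurable_tl k : measurable_fun setT (tl k).
Proof.
by apply: measurable_fun_ifT => //; exact: measurable_fun_ltr.
Qed.

Lemma measurable_trunc a : measurable_fun setT (trunc a).
Proof. by apply: measurable_fun_ifT => //; exact: measurable_fun_ler. Qed.

Lemma tl_ge0 k x : 0 <= tl k x.
Proof. by rewrite /tl; case: ifP => // _; exact: sqr_ge0. Qed.

Lemma tl_le k x : tl k x <= x ^+ 2.
Proof. by rewrite /tl; case: ifP => // _; exact: sqr_ge0. Qed.

Lemma trunc_tl a x : 0 <= a -> (x - trunc a x) ^+ 2 = tl a x.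
Proof.
move=> a0; rewrite /trunc /tl; case: leP => h; last by rewrite subr0.
by rewrite subrr expr0n.
Qed.

Lemma trunc_bnd a x : 0 <= a -> `|trunc a x| <= a.
Proof. by move=> a0; rewrite /trunc; case: ifP => //; rewrite normr0. Qed.

Lemma trunc_sq a x : trunc a x ^+ 2 <= x ^+ 2.
Proof. by rewrite /trunc; case: ifP => // _; rewrite expr0n sqr_ge0. Qed.

(** If |a| <= |b| then (a + b)^2 <= 4 b^2; otherwise |a| > k and a^2 <= k^(2 - q) |a|^q. Later a is
    the sum of truncated variables and b that of the remainders. *)
Lemma tl_split (k q a b : R) : 0 < k -> 2 <= q ->
  tl (2 * k) (a + b) <= 4 * b ^+ 2 + 4 * (k `^ (2 - q) * `|a| `^ q).
Proof.
move=> k0 q2.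
have B0 : 0 <= 4 * b ^+ 2 by rewrite mulr_ge0// sqr_ge0.
have A0 : 0 <= 4 * (k `^ (2 - q) * `|a| `^ q) by rewrite !mulr_ge0// powR_ge0.
rewrite /tl; case: ifP => h; last exact: addr_ge0.
have sq (u v : R) : `|u| <= 2 * `|v| -> u ^+ 2 <= 4 * v ^+ 2.
  move=> uv; rewrite -[u ^+ 2]real_normK ?num_real// -[v ^+ 2]real_normK ?num_real//.
  rewrite [leRHS](_ : _ = (2 * `|v|) ^+ 2); last by ring.
  by rewrite lerXn2r ?nnegrE// mulr_ge0.
have [ab|ba] := leP `|a| `|b|.
  apply: (@le_trans _ _ (4 * b ^+ 2)); last by rewrite lerDl.
  by apply: sq; rewrite (le_trans (ler_normD _ _))//; lra.
apply: (@le_trans _ _ (4 * a ^+ 2)).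
  by apply: sq; rewrite (le_trans (ler_normD _ _))//; lra.
apply: (@le_trans _ _ (4 * (k `^ (2 - q) * `|a| `^ q))); last by rewrite lerDr.
rewrite ler_pM2l//.
have ka : k < `|a|.
  by have := lt_le_trans h (ler_normD _ _); lra.
have pa : 0 < `|a| by lra.
rewrite -[a ^+ 2]real_normK ?num_real// -powR_mulrn//.
rewrite [in leLHS](_ : 2%:R = q - (q - 2)); last by ring.
rewrite powRB; last by rewrite (gt_eqF pa) implybT.
rewrite mulrC ler_wpM2r ?powR_ge0//.
rewrite (_ : 2 - q = - (q - 2)); last by ring.
by rewrite -powRN; apply: powRN_le => //; [exact: ltW|lra].
Qed.

End truncation.

Section UI.
Context (d : measure_display) (T : measurableType d) (R : realType)
  (P : probability T R) (X : int -> {RV P >-> R}).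
Hypothesis stationaryX : strictly_stationary P X.

Local Notation tau := (tau X).
Local Notation sigma := (tau id).

Hypothesis X2 : sqint P (X 0).
Hypothesis X0 : Ex P (X 0) = 0.

Definition tail (a : R) : R := Ex P (fun w => tl a (X 0 w)).

Section centred_truncation.
Variable a : R.
Hypothesis a0 : 0 <= a.

Definition mua : R := Ex P (fun w => trunc a (X 0 w)).
Definition psiL (x : R) : R := trunc a x - mua.
Definition psiH (x : R) : R := x - psiL x.

Lemma mpsiL : measurable_fun setT psiL.
Proof. by apply: measurable_funB => //; exact: measurable_trunc. Qed.

Lemma mpsiH : measurable_fun setT psiH.
Proof. by apply: measurable_funB => //; exact: mpsiL. Qed.

Let mtr : measurable_fun setT (fun w => trunc a (X 0 w)).
Proof. by apply: measurableT_comp => //; exact: measurable_trunc. Qed.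

Let str : sqint P (fun w => trunc a (X 0 w)).
Proof. by apply: (@sqint_bnd _ _ _ P _ a mtr) => w; exact: trunc_bnd. Qed.

Lemma psiL_sqint : sqint P (fun w => psiL (X 0 w)).
Proof. by apply: sqintB => //; exact: sqint_cst. Qed.

Lemma psiH_sqint : sqint P (fun w => psiH (X 0 w)).
Proof. by apply: sqintB => //; exact: psiL_sqint. Qed.

Lemma psiL_mean : Ex P (fun w => psiL (X 0 w)) = 0.
Proof.
rewrite /psiL ExB ?Ex_cst ?subrr//; [exact: sqint_integr|exact: integr_cst].
Qed.

Lemma psiH_mean : Ex P (fun w => psiH (X 0 w)) = 0.
Proof.
rewrite /psiH ExB; [|exact: sqint_integr|exact/sqint_integr/psiL_sqint].
by rewrite psiL_mean X0 subr0.
Qed.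

Lemma Ex_centre_sq (f : T -> R) : sqint P f ->
  Ex P (fun w => (f w - Ex P f) ^+ 2) <= Ex P (fun w => f w ^+ 2).
Proof.
move=> hf; rewrite -!n2_sqr -(stddevE hf) lerXn2r ?nnegrE ?n2_ge0 ?sqrtr_ge0//.
exact: stddev_le.
Qed.

Lemma psiL_var : Ex P (fun w => psiL (X 0 w) ^+ 2) <= Ex P (fun w => X 0 w ^+ 2).
Proof.
apply: (le_trans (Ex_centre_sq str)); apply: Ex_le; try exact: sqint_sq.
by move=> w; exact: trunc_sq.
Qed.

(** As [X 0] is centred, [psiH] is the part above the level minus its own mean. *)
Lemma psiH_var : Ex P (fun w => psiH (X 0 w) ^+ 2) <= tail a.
Proof.
have hf : sqint P (fun w => X 0 w - trunc a (X 0 w)) by exact: sqintB.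
rewrite [leLHS](_ : _ = Ex P (fun w => (X 0 w - trunc a (X 0 w) -
    Ex P (fun w => X 0 w - trunc a (X 0 w))) ^+ 2)).
  apply: (le_trans (Ex_centre_sq hf)); rewrite le_eqVlt; apply/orP; left; apply/eqP.
  by apply: eq_Ex => w; rewrite trunc_tl.
rewrite ExB; [|exact: sqint_integr|exact: sqint_integr].
by apply: eq_Ex => w; rewrite X0 sub0r /psiH /psiL /mua; congr (_ ^+ 2); ring.
Qed.

Lemma psiL_bnd x : `|psiL x| <= 2 * a.
Proof.
have h : `|mua| <= a.
  by apply: Ex_bnd; [exact: sqint_integr|move=> w; exact: trunc_bnd].
have := trunc_bnd x a0; have := ler_normB (trunc a x) mua; rewrite -/(psiL x); lra.
Qed.

Lemma psiL_mom q : 2 <= q -> 0 < a ->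
  abs_moment P q (fun w => psiL (X 0 w)) <= (2 * a) `^ (q - 2) * Ex P (fun w => X 0 w ^+ 2).
Proof.
move=> q2 a1.
apply: (@le_trans _ _ ((2 * a) `^ (q - 2) * Ex P (fun w => psiL (X 0 w) ^+ 2))); last first.
  by rewrite ler_wpM2l ?powR_ge0// psiL_var.
have bL : bounded_meas (fun w => psiL (X 0 w)).
  split; first by apply: measurableT_comp => //; exact: mpsiL.
  by exists (2 * a) => w; exact: psiL_bnd.
rewrite -ExZ; last exact/sqint_sq/psiL_sqint.
apply: Ex_le; first exact: (moment_integr P q2 bL).
  by apply: integrZ; exact/sqint_sq/psiL_sqint.
move=> w; have [->|n0] := eqVneq (psiL (X 0 w)) 0.
  by rewrite normr0 powR0 ?expr0n ?mulr0//; lra.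
have y0 : 0 < `|psiL (X 0 w)| by rewrite normr_gt0.
rewrite -[psiL (X 0 w) ^+ 2]real_normK ?num_real// -powR_mulrn//.
rewrite [in leLHS](_ : q = (q - 2) + 2%:R); last by ring.
rewrite powRD; last by rewrite (gt_eqF y0) implybT.
rewrite ler_wpM2r ?powR_ge0//; apply: powR_mono => //; [lra|exact: psiL_bnd].
Qed.

Lemma Tn_split n w : Tn X id n w = Tn X psiL n w + Tn X psiH n w.
Proof.
rewrite /Tn /Sx -big_split /=; apply: eq_bigr => t _.
by rewrite /psiH addrC subrK.
Qed.

Lemma tauL_le n : tau psiL n <= sigma n + tau psiH n.
Proof.
rewrite /tau (@eq_n2 _ _ _ _ (Tn X psiL n) (fun w => Tn X id n w - Tn X psiH n w)).
  apply: n2B; first exact: (Sx_sqint stationaryX (@measurable_id _ _ _) X2).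
  exact: (Sx_sqint stationaryX mpsiH psiH_sqint).
by move=> w; rewrite Tn_split addrK.
Qed.

Lemma tauL1 : tau psiL 1 <= norm2 P (X 0).
Proof.
rewrite -(blk_n2 stationaryX mpsiL psiL_sqint 0 1) /norm2 ler_wsqrtr//.
apply: le_trans psiL_var; rewrite le_eqVlt; apply/orP; left; apply/eqP.
by apply: eq_Ex => w; rewrite Sx1.
Qed.

Lemma tauH1 : tau psiH 1 ^+ 2 <= tail a.
Proof.
rewrite -(blk_n2 stationaryX mpsiH psiH_sqint 0 1) n2_sqr.
apply: le_trans psiH_var; rewrite le_eqVlt; apply/orP; left; apply/eqP.
by apply: eq_Ex => w; rewrite Sx1.
Qed.

End centred_truncation.

End UI.

Section arith.
Context {R : realType}.

(* the truncation level is calibrated so that its moment of order q loses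
   exactly what the recursion gains *)
Lemma truncation_calibration (q p k K KL KL0 C1 V Lam D c s K1 n : R) (J : nat) :
  2 < q -> q = 2 * p -> k = 1 - p^-1 -> 0 <= V -> 0 <= K1 -> 0 < c ->
  2 * k * C1 = K + KL -> Lam <= KL * D + KL0 ->
  c * n * expR (- Lam) <= s -> 2 ^+ J <= n ->
  K1 * ((2 * (2 `^ (J%:R / 2) * expR (- (C1 * D)))) `^ (q - 2) * V) `^ p^-1
     * (2 `^ p^-1) ^+ J * expR (K * D) <=
  K1 * (2 `^ (2 * k) * V `^ p^-1 * expR KL0 / c) * s.
Proof.
move=> q2 qp kp V0 K10 c0 hC hLam hs hn.
have p1 : 1 < p by lra.
have pn : p != 0 by rewrite gt_eqF//; lra.
have e2 (x : R) : 0 < x -> (x `^ (q - 2)) `^ p^-1 = x `^ (2 * k).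
  by move=> x0; rewrite -powRrM qp kp; congr (_ `^ _); field.
rewrite powRM ?powR_ge0//.
set a := 2 * (_ * expR _); have a0 : 0 < a by rewrite !mulr_gt0 ?powR_gt0 ?expR_gt0//.
rewrite e2// /a powRM ?mulr_ge0 ?powR_ge0 ?expR_ge0// powRM ?powR_ge0 ?expR_ge0//.
rewrite -expRM -powRrM.
have e3 : 2 `^ (J%:R / 2 * (2 * k)) * (2 `^ p^-1) ^+ J = 2 ^+ J :> R.
  rewrite -powR_mulrn ?powR_ge0// -powRrM -powRD ?pnatr_eq0 ?implybT//.
  rewrite -powR_mulrn//; congr (_ `^ _); rewrite kp; field; exact: pn.
have e4 : expR (- (C1 * D) * (2 * k)) * expR (K * D) = expR (- (KL * D)).
  rewrite -expRD; congr expR.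
  have -> : - (C1 * D) * (2 * k) = - (2 * k * C1) * D by ring.
  by rewrite hC; ring.
have -> : K1 * (2 `^ (2 * k) * (2 `^ (J%:R / 2 * (2 * k)) * expR (- (C1 * D) * (2 * k))) * V `^ p^-1)
  * (2 `^ p^-1) ^+ J * expR (K * D) =
  K1 * (2 `^ (2 * k) * V `^ p^-1) *
  ((2 `^ (J%:R / 2 * (2 * k)) * (2 `^ p^-1) ^+ J) * (expR (- (C1 * D) * (2 * k)) * expR (K * D))) by ring.
rewrite e3 e4.
have -> : K1 * (2 `^ (2 * k) * V `^ p^-1 * expR KL0 / c) * s =
  K1 * (2 `^ (2 * k) * V `^ p^-1) * (expR KL0 / c * s) by ring.
apply: ler_wpM2l; first by rewrite !mulr_ge0 ?powR_ge0.
apply: (@le_trans _ _ (expR KL0 / c * (c * n * expR (- Lam)))); last first.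
  by rewrite ler_wpM2l// divr_ge0 ?expR_ge0// ltW.
have -> : expR KL0 / c * (c * n * expR (- Lam)) = n * (expR KL0 * expR (- Lam)).
  by field; rewrite gt_eqF.
apply: ler_pM => //; rewrite ?expR_ge0 ?exprn_ge0//.
by rewrite -expRD ler_expR; lra.
Qed.

(** Even the trivial bound for the norm of a gap, its length times the norm of one variable, is then
    of order lam^i, where lam will be a growth ratio of [sigma]. *)
Lemma gap_lam (lam : R) i : 1 <= lam -> 2 <= lam ^+ 4 ->
  (2 ^ (i %/ 16))%N%:R <= lam ^+ i.
Proof.
move=> l1 l4; apply: (@le_trans _ _ ((lam ^+ 4) ^+ (i %/ 16))).
  by rewrite natrX lerXn2r ?nnegrE// exprn_ge0//; lra.
rewrite -exprM ler_weXn2l//.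
by have := leq_trunc_div i 16; move: (i %/ 16)%N => k; clear; lia.
Qed.

End arith.

Section UI.
Context (d : measure_display) (T : measurableType d) (R : realType)
  (P : probability T R) (X : int -> {RV P >-> R}).
Hypothesis stationaryX : strictly_stationary P X.

Local Notation tau := (tau X).
Local Notation sigma := (tau id).

Hypothesis X2 : sqint P (X 0).
Hypothesis X0 : Ex P (X 0) = 0.
Hypothesis rho0 : forall e : R, 0 < e ->
  exists N : nat, (rho P X N <= e%:E)%E.
Hypothesis sigmay : forall A : R, exists N : nat,
  forall n, (N <= n)%N -> A <= sigma n.
Variables (alpha beta q p KL KL0 : R) (N0 : nat) (Lam D : nat -> R).
Hypothesis q2 : 2 < q.
Hypothesis q3 : q <= 3.
Hypothesis qp : q = 2 * p.
Hypothesis a0 : 0 < alpha.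
Hypothesis b2 : 2^-1 < beta.
Hypothesis b1 : beta <= 1.
Hypothesis hrho : forall n, (N0 <= n)%N ->
  (rho P X n <= (alpha * (log2 n%:R) `^ (- beta))%:E)%E.
Hypothesis Lam0 : forall j, (1 <= j)%N -> 0 <= Lam j.
Hypothesis LamS : forall j, (1 <= j)%N ->
  alpha * j.+1%:R `^ (- beta) <= Lam j.+1 - Lam j.
Hypothesis D0 : forall j, (1 <= j)%N -> 0 <= D j.
Hypothesis DS : forall j, (1 <= j)%N ->
  j.+1%:R `^ (- (p^-1 * beta)) <= D j.+1 - D j.
Hypothesis LamD : forall j, (1 <= j)%N -> Lam j <= KL * D j + KL0.
Hypothesis tail_cvg : forall C1 e : R, 0 < e -> exists J1 : nat,
  forall J, (J1 <= J)%N ->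
  expR (2 * Lam J) * tail X (2 `^ (J%:R / 2) * expR (- (C1 * D J))) <= e.

(** The truncation level varies with n through J. The remainders contribute eta / 2 through their
    variance, the truncated part eta / 2 through its moment of order q and a Markov inequality at
    level k [sigma n]. *)
Lemma unif_integrable (eta : R) : 0 < eta -> exists (K : R) (N : nat), 0 < K /\
  forall n, (N <= n)%N ->
    Ex P (fun w => tl (K * sigma n) (Tn X id n w)) <= eta * sigma n ^+ 2.
Proof.
move=> eta0.
have b0 : 0 < beta by apply: lt_trans b2; rewrite invr_gt0.
have p1 : 1 < p by move: q2 qp; lra.
have p0 : 0 < p by lra.
have [th the] : exists th, th = p^-1 by exists p^-1.
have th0 : 0 < th by rewrite the invr_gt0.
have th1 : th < 1 by rewrite the invf_lt1.
have th23 : 2 / 3 <= th.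
  by rewrite the -[leLHS]invrK lef_pV2 ?posrE ?invr_gt0//; move: q3 qp; lra.
have [t te] : exists t : R, t = 2 `^ th by exists (2 `^ th).
have t1 : 1 <= t by rewrite te -[leLHS](powRr0 2); apply: ler_powR; rewrite ?ler1n// ltW.
have t2 : t < 2.
  by rewrite te -[ltRHS](@powRr1 _ 2)// /powR !gt_eqF// ltr_expR ltr_pM2r ?ln2_gt0.
have tsq : 2 <= t ^+ 2.
  rewrite te -powR_mulrn ?powR_ge0// -powRrM -[leLHS](@powRr1 _ 2)//.
  by apply: ler_powR; [rewrite ler1n|lra].
have [C [c [j0 [C0 c0 [hU hL]]]]] :=
  var_bounds stationaryX X2 X0 rho0 sigmay a0 b2 b1 hrho Lam0 LamS.
(* Above 2^(1/p), as the recursion on moments requires, and below 2, so that the variances do grow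
   by Lm per scale. *)
have [Lm Lme] : exists Lm, Lm = (t + 2) / 2 by exists ((t + 2) / 2).
have tLm : t < Lm by lra.
have Lm2 : Lm < 2 by lra.
have Lm0 : 0 < Lm by lra.
have [lam lame] : exists lam, lam = Num.sqrt Lm by exists (Num.sqrt Lm).
have lamsq : lam ^+ 2 = Lm by rewrite lame sqr_sqrtr// ltW.
have lam0 : 0 <= lam by rewrite lame sqrtr_ge0.
have lam1 : 1 <= lam.
  by rewrite -(@ler_pXn2r _ 2%N) ?nnegrE// lamsq expr1n; lra.
have lamp : 0 < lam by lra.
have lamlt : lam ^+ 2 < 2 by rewrite lamsq.
have lam4 : 2 <= lam ^+ 4.
  rewrite (_ : 4 = 2 * 2)%N// exprM lamsq (le_trans tsq)//.
  by rewrite lerXn2r ?nnegrE//; lra.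
have [N1 hN1] := sigma_doubling stationaryX X2 X0 rho0 sigmay lam1 lamlt.
have hit := sigma_doubling_iter lam1 hN1.
have [c1 c10 [j1 hlow]] := sigma_lower_pow stationaryX X2 X0 rho0 sigmay lam1 lamlt.
have s_ge0 := sigma_ge0 X.
pose V2 := norm2 P (X 0); have V20 : 0 <= V2 by exact: n2_ge0.
(* The summand 2 comes from the truncated sum at scale i, at most [sigma] plus the norm of the
   remainders, and V2 / c1 from the gap. *)
pose W := 2 + V2 / c1; have W0 : 0 < W by rewrite ltr_wpDr ?divr_ge0 ?(ltW c10).
have K30 : 0 < W ^+ 2 by rewrite exprn_gt0.
have hLm : 2 `^ p^-1 < Lm by rewrite -the -te.
have hrho' n : (N0 + N1 + j1 <= n)%N ->
    (rho P X n <= (alpha * (log2 n%:R) `^ (- beta))%:E)%E.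
  by move=> h; apply: hrho; apply: leq_trans h; rewrite -addnA leq_addr.
have [K1 [K2 [K [i0 [K11 K20 K00 Ni0 hmom]]]]] :=
  block_moment_le stationaryX q2 q3 qp a0 b0 b1 K30 hLm hrho' D0 DS.
have kap0 : 0 < 1 - th by lra.
(* K D is the growth in the recursion and KL D bounds Lam in the lower bound of the variance;
   lowering the level by exp (- C1 D) gains 2 (1 - theta) C1 D in the exponent of the p-th root of
   the moment. *)
pose C1 := (K + KL) / (2 * (1 - th)).
have hC1 : 2 * (1 - th) * C1 = K + KL.
  by rewrite /C1 mulrC divfK// mulf_neq0 ?gt_eqF.
have cC : 0 < c / C by rewrite divr_gt0.
(* The tail hypothesis serves twice: with c / C to compare the remainders with [sigma n] at every
   scale of the recursion, then with a multiple of eta at the full length. *)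
have [J1 hJ1] := tail_cvg C1 cC.
have e80 : 0 < eta * (c / C) / 8 by rewrite divr_gt0// mulr_gt0.
have [J2 hJ2] := tail_cvg C1 e80.
pose E2 := Ex P (fun w => X 0 w ^+ 2).
have E20 : 0 <= E2 by apply: Ex_ge0 => w; exact: sqr_ge0.
pose K6 := K1 * (2 `^ (2 * (1 - th)) * E2 `^ p^-1 * expR KL0 / c) + K2.
have K10 : 0 <= K1 by apply: le_trans K11.
have K60 : 0 <= K6.
  apply: addr_ge0 => //; apply: mulr_ge0 => //.
  apply: divr_ge0; last exact: ltW.
  by rewrite !mulr_ge0 ?powR_ge0 ?expR_ge0.
pose K5 := K6 `^ p; have K50 : 0 <= K5 by exact: powR_ge0.
have K5p : 0 < 4 * (K5 + 1) by rewrite mulr_gt0// ltr_wpDl.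
have q20 : 0 < q - 2 by rewrite subr_gt0.
have eta2 : 0 < eta / 2 by rewrite divr_gt0.
have [k0 hk0] := powRN_small K5p q20 eta2.
pose k : R := k0.+1%:R; have k_gt0 : 0 < k by rewrite ltr0n.
have hk : 4 * K5 * k `^ (2 - q) <= eta / 2.
  have := hk0 k0 (leqnn _); rewrite -/k opprB; apply: le_trans.
  by rewrite ler_wpM2r ?powR_ge0// ler_wpM2l// lerDl.
have [N2 hN2] := sigmay 1.
pose Jm := (j0 + j1 + i0 + J1 + J2 + 1)%N.
exists (2 * k), (maxn (2 ^ Jm) N2); split; first by rewrite mulr_gt0.
move=> n; rewrite geq_max => /andP[nJ nN2].
have s1 := hN2 n nN2; have sp : 0 < sigma n := lt_le_trans ltr01 s1.
have n0 : (0 < n)%N by apply: leq_trans nJ; rewrite expn_gt0.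
pose J := trunc_log 2 n.
have /andP[n1 norm2] := @trunc_log_bounds 2 n isT n0; rewrite -/J in n1 norm2.
have JJ : (Jm <= J)%N.
  by rewrite -ltnS -(ltn_exp2l _ _ (isT : (1 < 2)%N)); exact: leq_ltn_trans norm2.
have Jj0 : (j0 <= J)%N by apply: leq_trans JJ; rewrite /Jm; clear; lia.
have Jj1 : (j1 <= J)%N by apply: leq_trans JJ; rewrite /Jm; clear; lia.
have Ji0 : (i0 <= J)%N by apply: leq_trans JJ; rewrite /Jm; clear; lia.
have JJ1 : (J1 <= J)%N by apply: leq_trans JJ; rewrite /Jm; clear; lia.
have JJ2 : (J2 <= J)%N by apply: leq_trans JJ; rewrite /Jm; clear; lia.
have J_1 : (1 <= J)%N by apply: leq_trans JJ; rewrite /Jm; clear; lia.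
have {}hL := hL J n Jj0 n1 norm2.
have {}hJ1 := hJ1 J JJ1; have {}hJ2 := hJ2 J JJ2.
pose a := 2 `^ (J%:R / 2) * expR (- (C1 * D J)).
rewrite -/a in hJ1 hJ2.
have ap : 0 < a by rewrite mulr_gt0 ?powR_gt0 ?expR_gt0.
have age : 0 <= a by exact: ltW.
have ta0 : 0 <= tail X a by apply: Ex_ge0 => w; exact: tl_ge0.
(* The upper bound at length m against the lower bound at length n: each brings a factor exp (Lam
   J), hence the 2 in the weight. *)
have hH m : (m <= n)%N ->
    tau (psiH X a) m ^+ 2 <= C / c * (expR (2 * Lam J) * tail X a) * (m%:R / n%:R * sigma n ^+ 2).
  move=> mn.
  have h1 := hU (psiH X a) (mpsiH X a) (psiH_sqint X2 age) (psiH_mean X2 X0 age) J m Jj0 (leq_ltn_trans mn norm2).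
  apply: (le_trans h1).
  apply: (@le_trans _ _ (C * m%:R * expR (Lam J) * tail X a)).
    by rewrite ler_wpM2l ?tauH1// !mulr_ge0 ?expR_ge0 ?(ltW C0).
  have nn0 : 0 < n%:R :> R by rewrite ltr0n.
  have -> : C / c * (expR (2 * Lam J) * tail X a) * (m%:R / n%:R * sigma n ^+ 2) =
    C * m%:R * tail X a * (expR (2 * Lam J) * (sigma n ^+ 2 / (c * n%:R))).
    by field; rewrite !gt_eqF.
  rewrite mulrAC ler_wpM2l ?mulr_ge0 ?(ltW C0)//.
  have e2L : expR (2 * Lam J) = expR (Lam J) * expR (Lam J).
    by rewrite -expRD; congr expR; ring.
  have -> : expR (2 * Lam J) * (sigma n ^+ 2 / (c * n%:R)) =
      expR (Lam J) * (expR (Lam J) * sigma n ^+ 2 / (c * n%:R)).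
    by rewrite e2L; field; rewrite !gt_eqF.
  rewrite ler_peMr ?expR_ge0// ler_pdivlMr ?mulr_gt0// mul1r.
  by rewrite -ler_pdivrMl ?expR_gt0// -expRN mulrC.
have hHn : tau (psiH X a) n ^+ 2 <= eta / 8 * sigma n ^+ 2.
  apply: (le_trans (hH n (leqnn _))); rewrite divff ?pnatr_eq0 -?lt0n// mul1r.
  rewrite ler_wpM2r ?sqr_ge0//.
  apply: (@le_trans _ _ (C / c * (eta * (c / C) / 8))).
    by rewrite ler_wpM2l// divr_ge0 ?ltW.
  by rewrite le_eqVlt; apply/orP; left; apply/eqP; field; rewrite !gt_eqF.
have hbL : exists A, forall x, `|psiL X a x| <= A.
  by exists (2 * a) => x; exact: psiL_bnd.
pose Z := ((2 * a) `^ (q - 2) * E2) `^ p^-1.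
have Z0 : 0 <= Z by exact: powR_ge0.
have hZ : abs_moment P q (fun w => psiL X a (X 0 w)) <= Z `^ p.
  rewrite -powRrM mulVf ?gt_eqF// powRr1 ?mulr_ge0 ?powR_ge0//.
  by apply: psiL_mom => //; exact: ltW.
have V0 : 0 < sigma n ^+ 2 by rewrite exprn_gt0.
have hS i : (i0 <= i)%N -> (i <= J)%N ->
    (tau (psiL X a) (n %/ 2 ^ (J - i)) + tau (psiL X a) (2 ^ (i %/ 16))) ^+ 2 <=
    W ^+ 2 * sigma n ^+ 2 * Lm ^- (J - i).
  move=> ii iJ.
  have mi : (2 ^ i <= n %/ 2 ^ (J - i))%N.
    by rewrite leq_divRL ?expn_gt0// -expnD subnKC.
  have mN : (N1 <= n %/ 2 ^ (J - i))%N.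
    apply: leq_trans mi; apply: (leq_trans _ (ltnW (ltn_expl i (isT : (1 < 2)%N)))).
    by apply: leq_trans ii; apply: leq_trans Ni0; rewrite addnAC leq_addl.
  have h1 := hit (J - i)%N n mN.
  set m := (n %/ 2 ^ (J - i))%N in h1 mi *.
  have mn : (m <= n)%N by exact: leq_div.
  pose l := lam ^- (J - i).
  have l0 : 0 <= l by rewrite invr_ge0 exprn_ge0.
  have lk : 0 < lam ^+ (J - i) by rewrite exprn_gt0.
  have k1 : sigma m <= l * sigma n by rewrite ler_pdivlMl.
  have l2 : l ^+ 2 = Lm ^- (J - i) by rewrite /l exprVn -exprM mulnC exprM lamsq.
  have k2 : tau (psiH X a) m <= l * sigma n.
    rewrite -(@ler_pXn2r _ 2%N) ?nnegrE ?n2_ge0 ?mulr_ge0//.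
    apply: (le_trans (hH m mn)).
    apply: (@le_trans _ _ (m%:R / n%:R * sigma n ^+ 2)).
      rewrite -[leRHS]mul1r ler_wpM2r ?mulr_ge0 ?divr_ge0 ?sqr_ge0//.
      apply: (@le_trans _ _ (C / c * (c / C))); first by rewrite ler_wpM2l// divr_ge0 ?ltW.
      by rewrite le_eqVlt; apply/orP; left; apply/eqP; field; rewrite !gt_eqF.
    (* As m / n <= 2^(- (J - i)) and Lm < 2, the remainders decay at least as fast as required. *)
    rewrite exprMn ler_wpM2r ?sqr_ge0// l2 ler_pdivrMr ?ltr0n//.
    rewrite ler_pdivlMl ?exprn_gt0//.
    apply: (@le_trans _ _ (2 ^+ (J - i) * m%:R)).
      by rewrite ler_wpM2r// lerXn2r ?nnegrE// ?(ltW Lm0)// ltW.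
    by rewrite -natrX -natrM ler_nat mulnC; exact: leq_trunc_div.
  have k3 : tau (psiL X a) (2 ^ (i %/ 16)) <= V2 / c1 * (l * sigma n).
    have h2 := tau_mul stationaryX (mpsiL X a) (psiL_sqint X age) (2 ^ (i %/ 16)).
    apply: (le_trans h2).
    apply: (@le_trans _ _ (lam ^+ i * V2)).
      apply: ler_pM; rewrite ?n2_ge0//; first exact: gap_lam.
      exact: tauL1.
    have h3 := hlow J n Jj1 n1.
    have eJ : lam ^+ J = lam ^+ i * lam ^+ (J - i) by rewrite -exprD subnKC.
    have -> : lam ^+ i = lam ^+ J * l by rewrite eJ /l mulfK// gt_eqF.
    have -> : V2 / c1 * (l * sigma n) = sigma n / c1 * l * V2 by ring.
    rewrite ler_wpM2r// ler_wpM2r// ler_pdivlMr// mulrC; exact: h3.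
  have k4 : tau (psiL X a) m <= 2 * (l * sigma n).
    by apply: (le_trans (tauL_le stationaryX X2 age m)); rewrite mulr_natl mulr2n lerD.
  rewrite -l2 -!exprMn lerXn2r ?nnegrE ?addr_ge0 ?n2_ge0 ?mulr_ge0 ?(ltW W0)//.
  rewrite -mulrA [_ * l]mulrC /W mulrDl; exact: lerD.
have hM := hmom (psiL X a) (mpsiL X a) hbL Z (sigma n ^+ 2) J n Z0 V0 Ji0 n1 norm2 hZ hS.
have nR : 2 ^+ J <= n%:R :> R by rewrite -natrX ler_nat.
have kth : 1 - th = 1 - p^-1 by rewrite the.
have cal := truncation_calibration q2 qp kth E20 K10 c0 hC1 (LamD J_1) hL nR.
have hM2 : block_moment X q (psiL X a) n <= K5 * sigma n `^ q.
  apply: (le_trans hM).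
  have -> : K5 * sigma n `^ q = (K6 * sigma n ^+ 2) `^ p.
    rewrite powRM ?sqr_ge0//; congr (_ * _).
    by rewrite -powR_mulrn ?(ltW sp)// -powRrM -qp.
  apply: powR_mono; first exact: ltW.
    by rewrite addr_ge0 ?mulr_ge0 ?expR_ge0 ?exprn_ge0 ?powR_ge0 ?(ltW V0).
  by rewrite /K6 mulrDl; apply: lerD.
have bL : bounded_meas (Tn X (psiL X a) n) by exact: bdd_Sx (mpsiL X a) hbL _.
have sH : sqint P (Tn X (psiH X a) n).
  exact: (Sx_sqint stationaryX (mpsiH X a) (psiH_sqint X2 age)).
have ks : 0 < k * sigma n by rewrite mulr_gt0.
have sT : sqint P (Tn X id n).
  exact: (Sx_sqint stationaryX (@measurable_id _ _ _) X2).
have iq := moment_integr P (ltW q2) bL.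
have iH := sqint_sq sH.
apply: (@le_trans _ _ (Ex P (fun w => 4 * Tn X (psiH X a) n w ^+ 2 +
    4 * ((k * sigma n) `^ (2 - q) * `|Tn X (psiL X a) n w| `^ q)))).
  apply: Ex_le.
  - apply: integr_le (sqint_sq sT) _.
      by apply: measurableT_comp; [exact: measurable_tl|exact: sqint_meas sT].
    by move=> w; rewrite ger0_norm ?tl_ge0 ?tl_le.
  - by integ.
  - move=> w; rewrite (Tn_split X a) -mulrA; apply: tl_split => //; exact: ltW.
rewrite ExD ?ExZ; try integ.
rewrite -n2_sqr -/(tau (psiH X a) n) -/(block_moment X q (psiL X a) n).
have -> : eta * sigma n ^+ 2 = 4 * (eta / 8 * sigma n ^+ 2) + eta / 2 * sigma n ^+ 2 by field.
apply: lerD; first by rewrite ler_wpM2l.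
apply: (@le_trans _ _ (4 * ((k * sigma n) `^ (2 - q) * (K5 * sigma n `^ q)))).
  by rewrite ler_wpM2l// ler_wpM2l ?powR_ge0.
rewrite powRM ?(ltW sp) ?(ltW k_gt0)//.
have -> : 4 * (k `^ (2 - q) * sigma n `^ (2 - q) * (K5 * sigma n `^ q)) =
   4 * K5 * k `^ (2 - q) * (sigma n `^ (2 - q) * sigma n `^ q) by ring.
rewrite -powRD; last by rewrite (gt_eqF sp) implybT.
rewrite subrK powR_mulrn ?(ltW sp)//.
by rewrite ler_wpM2r ?sqr_ge0.
Qed.

End UI.

(** * The Gaussian heat flow *)

Section taylor.
Context {R : realType}.
Implicit Types f : R -> R.

Lemma is_derive_continuous f df : (forall x : R, is_derive x 1 f (df x)) -> continuous f.
Proof. by move=> h x; apply/differentiable_continuous/derivable1_diffP; case: (h x). Qed.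

Lemma mvt_segment f df : (forall x : R, is_derive x 1 f (df x)) ->
  forall x h, exists2 t, 0 <= t <= 1 & f (x + h) - f x = df (x + t * h) * h.
Proof.
move=> hf x h.
have cf := is_derive_continuous hf.
have [h0|h0|->] := ltgtP h 0; last first.
- by exists 0; rewrite ?lexx ?ler01// addr0 subrr mulr0.
- have xh : x < x + h by rewrite ltrDl.
  have [c] := MVT xh (fun y _ => hf y) (continuous_subspaceT cf).
  rewrite in_itv /= => /andP[c1 c2] ->.
  exists ((c - x) / h).
    apply/andP; split; first by apply: divr_ge0; lra.
    by rewrite ler_pdivrMr//; lra.
  by rewrite divfK ?gt_eqF// (addrC x (c - x)) subrK (addrC x h) addrK.
- have xh : x + h < x by rewrite gtrDl.
  have [c] := MVT xh (fun y _ => hf y) (continuous_subspaceT cf).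
  rewrite in_itv /= => /andP[c1 c2] e.
  exists ((c - x) / h).
    rewrite ler_ndivlMr// mul0r ler_ndivrMr//; apply/andP; split; lra.
  rewrite divfK ?lt_eqF// (addrC x (c - x)) subrK.
  by rewrite -[LHS]opprB e; ring.
Qed.

(** The mean value theorem twice; the constant is twice that of Taylor's formula. *)
Lemma taylor1 f f1 f2 M : (forall x : R, is_derive x 1 f (f1 x)) ->
  (forall x : R, is_derive x 1 f1 (f2 x)) -> (forall x, `|f2 x| <= M) ->
  forall x h, `|f (x + h) - f x - f1 x * h| <= M * h ^+ 2.
Proof.
move=> h1 h2 hM x h; have [t /andP[t0 t1] ->] := mvt_segment h1 x h.
rewrite -mulrBl normrM; have [t' _ ->] := mvt_segment h2 x (t * h).
rewrite 2!normrM -[h ^+ 2]real_normK ?num_real// expr2 -!mulrA.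
apply: ler_pM => //.
by rewrite ger0_norm// ler_piMl// mulr_ge0.
Qed.

Lemma taylor2 f f1 f2 f3 M : (forall x : R, is_derive x 1 f (f1 x)) ->
  (forall x : R, is_derive x 1 f1 (f2 x)) -> (forall x : R, is_derive x 1 f2 (f3 x)) ->
  (forall x, `|f3 x| <= M) ->
  forall x h, `|f (x + h) - f x - f1 x * h - f2 x / 2 * h ^+ 2| <= M * `|h| ^+ 3.
Proof.
move=> h1 h2 h3 hM x h.
have M0 : 0 <= M by apply: le_trans (hM 0).
pose g k := f (x + k) - f x - f1 x * k - f2 x / 2 * k ^+ 2.
pose g1 k := f1 (x + k) - f1 x - f2 x * k.
have hg (k : R) : is_derive k 1 g (g1 k).
  have hs : is_derive k 1 (fun k : R => x + k) 1.
    by apply: is_derive_eq; rewrite add0r mulr1.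
  have hc : is_derive k 1 (fun k : R => f (x + k)) (f1 (x + k)).
    exact: is_derive_eq (is_derive1_comp (h1 (x + k)) hs) (mulr1 _).
  rewrite /g /g1; apply: is_derive_eq.
  by rewrite /GRing.scale /=; field.
have [t /andP[t0 t1]] := mvt_segment hg 0 h.
rewrite add0r [g 0](_ : _ = 0); last by rewrite /g addr0; ring.
rewrite add0r subr0 -/(g h) => ->; rewrite normrM exprSr.
rewrite mulrA ler_pM//; apply: (le_trans (taylor1 h2 h3 hM _ _)).
rewrite ler_wpM2l// -[(t * h) ^+ 2]real_normK ?num_real// lerXn2r ?nnegrE//.
by rewrite normrM ger0_norm// ler_piMl.
Qed.

End taylor.

Section gauss.
Context {R : realType}.
Implicit Types x z a b s v e : R.

Definition Phi x : R := fine (normal_prob 0 1 `]-oo, x]).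
Definition phi x : R := normal_pdf 0 1 x.

Lemma phiE : phi = fun x => normal_peak 1 * expR (- (x ^+ 2) / 2).
Proof.
apply/funext => x; rewrite /phi normal_pdfE ?oner_neq0//.
by rewrite /normal_fun subr0 expr1n.
Qed.

Lemma phi_ge0 x : 0 <= phi x. Proof. exact: normal_pdf_ge0. Qed.

(** The exponential series gives exp (x^2 / 2) >= x^4 / 8, and |x|^k <= x^4 unless |x| <= 1. *)
Lemma phi_poly_decay k x : (k <= 4)%N -> `|x| ^+ k * phi x <= 8.
Proof.
move=> k4; have pk1 : normal_peak 1 <= 1 :> R.
  rewrite /normal_peak invf_le1 ?sqrtr_gt0; last first.
    by rewrite expr1n mul1r mulrn_wgt0// pi_gt0.
  rewrite expr1n mul1r -[leLHS]sqrtr1 ler_wsqrtr// mulr2n.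
  by have := pi_ge2 R; lra.
have pk0 : 0 <= normal_peak 1 :> R by exact: normal_peak_ge0.
have x20 : 0 <= x ^+ 2 by exact: sqr_ge0.
have y0 : 0 <= x ^+ 2 / 2 by rewrite divr_ge0.
have E : 0 < expR (x ^+ 2 / 2) by exact: expR_gt0.
have e4 : x ^+ 4 <= 8 * expR (x ^+ 2 / 2).
  have h := expR_ge1Dxn 1 y0; rewrite (_ : 2`! = 2)%N// in h.
  have -> : x ^+ 4 = 8 * ((x ^+ 2 / 2) ^+ 2 / 2) by field.
  by rewrite ler_pM2l//; apply: le_trans h; rewrite lerDr.
have e1 : 1 <= expR (x ^+ 2 / 2) by rewrite -[leLHS]expR0 ler_expR.
have ek : `|x| ^+ k <= 8 * expR (x ^+ 2 / 2).
  have [x1|x1] := leP `|x| 1.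
    apply: (@le_trans _ _ 1); first exact: exprn_ile1.
    lra.
  apply: le_trans e4; rewrite -[x ^+ 4]ger0_norm ?exprn_even_ge0// normrX.
  by rewrite ler_weXn2l// ltW.
rewrite phiE mulrCA mulNr expRN.
apply: (@le_trans _ _ (1 * 8)); last by rewrite mul1r.
apply: ler_pM => //; last by rewrite ler_pdivrMr.
Qed.

Lemma phi_le8 x : phi x <= 8.
Proof. by have := @phi_poly_decay 0 x isT; rewrite expr0 mul1r. Qed.

Lemma phi_derive x : is_derive x 1 phi (- (x * phi x)).
Proof.
have hs : is_derive x 1 (fun x : R => - (x ^+ 2) / 2) (- x).
  apply: is_derive_eq; rewrite /GRing.scale /=; by field.
have hc : is_derive x 1 (fun x : R => expR (- (x ^+ 2) / 2)) (expR (- (x ^+ 2) / 2) * - x).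
  exact: (is_derive1_comp (is_derive_expR _) hs).
rewrite phiE; apply: is_derive_eq; rewrite /GRing.scale /=; ring.
Qed.

Lemma phi1_derive x : is_derive x 1 (fun x => - (x * phi x)) ((x ^+ 2 - 1) * phi x).
Proof.
have h := phi_derive x.
apply: is_derive_eq; rewrite /GRing.scale /=; ring.
Qed.

Lemma phi1_bnd x : `|- (x * phi x)| <= 8.
Proof. by rewrite normrN normrM (ger0_norm (phi_ge0 x)) -[`|x|]expr1 phi_poly_decay. Qed.

Lemma phi2_bnd x : `|(x ^+ 2 - 1) * phi x| <= 16.
Proof.
rewrite normrM (ger0_norm (phi_ge0 x)).
apply: (@le_trans _ _ ((`|x| ^+ 2 + 1) * phi x)).
  rewrite ler_wpM2r ?phi_ge0// (le_trans (ler_normB _ _))// normrX normr1//.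
rewrite mulrDl mul1r; have := @phi_poly_decay 2 x isT; have := phi_le8 x; lra.
Qed.

Lemma Phi_derive x : is_derive x 1 Phi (phi x).
Proof.
have o0 : (1 : R) != 0 by exact: oner_neq0.
have hi : (lebesgue_measure).-integrable `]-oo, (x + 1)] (EFin \o (normal_pdf 0 1 : R -> R)).
  by apply: integrableS (integrable_normal_pdf 0 1) => //; exact: subsetT.
have x1 : x < x + 1 by rewrite ltrDl.
have [d1 d2] := @continuous_FTC1 R (normal_pdf 0 1) -oo%O x (x + 1) x1 hi (ltNyr _)
  (@continuous_normal_pdf R 0 1 o0 x).
by split; [exact: d1|rewrite -derive1E d2].
Qed.

Lemma Phi_ge0 x : 0 <= Phi x.
Proof. by rewrite fine_ge0// measure_ge0. Qed.

Lemma PhiE x : (Phi x)%:E = normal_prob 0 1 `]-oo, x]%classic.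
Proof. by rewrite fineK// fin_num_measure. Qed.

Lemma Phi_le1 x : Phi x <= 1.
Proof. by rewrite -lee_fin PhiE probability_le1. Qed.

Lemma Phi_mono x y : x <= y -> Phi x <= Phi y.
Proof.
move=> xy; rewrite -lee_fin !PhiE le_measure ?inE//.
by move=> t /=; rewrite !in_itv /= => /le_trans; apply.
Qed.

End gauss.

Section heat.
Context {R : realType}.
Implicit Types x z a s v e : R.

(* [heatF s a x] is P(x + sqrt s N <= a) for N standard normal: as a function of
   (s, x) it solves the heat equation d/ds = (1/2) d^2/dx^2. *)
Definition heatF s a x : R := Phi ((a - x) / Num.sqrt s).
Definition heat_dx s a x : R := - ((Num.sqrt s)^-1 * phi ((a - x) / Num.sqrt s)).
Definition heat_dxx s a x : R :=
  s^-1 * - ((a - x) / Num.sqrt s * phi ((a - x) / Num.sqrt s)).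

(** The heat equation in rescaled form: for z = (a - x) / sqrt s and d^2 = 1 + v / s,
    [heatF (s + v) a x] is Phi (z / d), and v / 2 times the second derivative in x is the last term
    subtracted. No derivative in s is taken. *)
Lemma Phi_scale z (d : R) : 1 <= d ->
  `|Phi (z / d) - Phi z - (d ^+ 2 - 1) / 2 * - (z * phi z)| <= 5 * (d ^+ 2 - 1) ^+ 2.
Proof.
move=> d1; have d0 : 0 < d by lra.
pose y := d ^+ 2 - 1.
have di1 : d^-1 <= 1 by rewrite invf_le1.
have di0 : 0 < d^-1 by rewrite invr_gt0.
have dd : d * d^-1 = 1 by rewrite divff// gt_eqF.
have yd : d - 1 <= y / 2 by rewrite /y; nra.
have [h he] : exists h, h = z * (d^-1 - 1) by exists (z * (d^-1 - 1)).
have zh : z / d = z + h by rewrite he; ring.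
have [t /andP[t0 t1] e1] := mvt_segment (@Phi_derive R) z h.
have [t' /andP[t'0 t'1] e2] := mvt_segment (@phi_derive R) z (t * h).
pose f := 1 - t' * t * (1 - d^-1).
have xi : z + t' * (t * h) = z * f by rewrite /f he; ring.
rewrite xi in e2.
have tt : 0 <= t' * t <= 1 by rewrite mulr_ge0//= mulr_ile1.
have f1 : d^-1 <= f.
  rewrite /f; have /andP[a b] := tt.
  have : t' * t * (1 - d^-1) <= 1 * (1 - d^-1) by rewrite ler_wpM2r//; lra.
  lra.
have df : 1 <= d * f by rewrite -dd ler_pM2l.
have part1 : `|Phi (z / d) - Phi z - phi z * h| <= 8 * (y / 2) ^+ 2.
  rewrite zh e1 -mulrBl e2 -[_ * (t * h) * h]mulrA normrM.
  apply: (@le_trans _ _ (`|z * f * phi (z * f)| * h ^+ 2)).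
    rewrite normrN ler_wpM2l// !normrM (ger0_norm t0).
    rewrite -[h ^+ 2]real_normK ?num_real// expr2 -mulrA; apply: ler_piMl => //; exact: mulr_ge0.
  rewrite normrM (ger0_norm (phi_ge0 _)).
  apply: (@le_trans _ _ ((`|z * f| ^+ 3 * phi (z * f)) * (d - 1) ^+ 2)); last first.
    apply: ler_pM; rewrite ?sqr_ge0 ?mulr_ge0 ?exprn_ge0 ?phi_ge0//; first exact: phi_poly_decay.
    by rewrite lerXn2r ?nnegrE//; lra.
  have -> : `|z * f| ^+ 3 * phi (z * f) * (d - 1) ^+ 2 =
     `|z * f| * phi (z * f) * (`|z * f| ^+ 2 * (d - 1) ^+ 2) by ring.
  apply: ler_wpM2l; first by rewrite mulr_ge0// phi_ge0.
  rewrite real_normK ?num_real//.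
  have -> : h ^+ 2 = (z * (d - 1)) ^+ 2 * d^-1 ^+ 2.
    by rewrite he; field; rewrite gt_eqF.
  have -> : (z * f) ^+ 2 * (d - 1) ^+ 2 = (z * (d - 1)) ^+ 2 * f ^+ 2 by ring.
  apply: ler_wpM2l; first exact: sqr_ge0.
  by rewrite lerXn2r ?nnegrE//; lra.
have part2 : `|phi z * h - y / 2 * - (z * phi z)| <= 8 * (3 / 8 * y ^+ 2).
  have -> : phi z * h - y / 2 * - (z * phi z) = z * phi z * (d^-1 - 1 + y / 2).
    by rewrite he; field; rewrite gt_eqF.
  rewrite normrM; apply: ler_pM => //.
    by have := phi1_bnd z; rewrite normrN.
  have -> : d^-1 - 1 + y / 2 = (d - 1) ^+ 2 * ((1 + 2 * d^-1) / 2).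
    by rewrite /y; field; rewrite gt_eqF.
  rewrite ger0_norm; last by rewrite mulr_ge0 ?sqr_ge0//; lra.
  apply: (@le_trans _ _ ((y / 2) ^+ 2 * (3 / 2))); last first.
    by rewrite le_eqVlt; apply/orP; left; apply/eqP; field.
  apply: ler_pM; rewrite ?sqr_ge0//; [lra| |lra].
  by rewrite lerXn2r ?nnegrE//; lra.
rewrite -/y; have -> : Phi (z / d) - Phi z - y / 2 * - (z * phi z) =
  (Phi (z / d) - Phi z - phi z * h) + (phi z * h - y / 2 * - (z * phi z)) by ring.
apply: (le_trans (ler_normD _ _)).
have -> : 5 * y ^+ 2 = 8 * (y / 2) ^+ 2 + 8 * (3 / 8 * y ^+ 2) by field.
exact: lerD.
Qed.

(** What the replacement argument needs of the heat flow, with a single constant. The remainder of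
    the expansion in x is bounded in two ways: by h^2 for large increments and by |h|^3 for small
    ones. *)
Definition heat_ok (A s a : R) : Prop :=
 [/\ forall x, `|heat_dx s a x| <= A,
     forall x, `|heat_dxx s a x| <= A,
     forall x h, `|heatF s a (x + h) - heatF s a x - heat_dx s a x * h - heat_dxx s a x / 2 * h ^+ 2|
       <= A * h ^+ 2,
     forall x h, `|heatF s a (x + h) - heatF s a x - heat_dx s a x * h - heat_dxx s a x / 2 * h ^+ 2|
       <= A * `|h| ^+ 3 &
     forall x v, 0 <= v ->
       `|heatF (s + v) a x - heatF s a x - v / 2 * heat_dxx s a x| <= A * v ^+ 2].

(** For s >= e^2 each derivative in x costs at most a factor 1 / e, and the error in time, of order
    v^2 / s^2, costs e^(- 4). *)
Lemma heat_bounds e : 0 < e -> exists2 A, 0 < A & forall s a, e ^+ 2 <= s -> heat_ok A s a.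
Proof.
move=> e0; have [u ue] : exists u, u = e^-1 by exists e^-1.
have u0 : 0 < u by rewrite ue invr_gt0.
have u2 : 0 < u ^+ 2 by rewrite exprn_gt0.
have u3 : 0 < u ^+ 3 by rewrite exprn_gt0.
have u4 : 0 < u ^+ 4 by rewrite exprn_gt0.
exists (16 * (u + u ^+ 2 + u ^+ 3 + u ^+ 4)); first by rewrite mulr_gt0// !addr_gt0.
set A := 16 * _.
have A1 : 8 * u <= A by rewrite /A; lra.
have A2 : 12 * u ^+ 2 <= A by rewrite /A; lra.
have A3 : 16 * u ^+ 3 <= A by rewrite /A; lra.
have A4 : 5 * u ^+ 4 <= A by rewrite /A; lra.
move=> s a hs.
have s0 : 0 < s by apply: lt_le_trans hs; rewrite exprn_gt0.
pose w := (Num.sqrt s)^-1.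
have r0 : 0 < Num.sqrt s by rewrite sqrtr_gt0.
have r2 : Num.sqrt s ^+ 2 = s by rewrite sqr_sqrtr// ltW.
have w0 : 0 < w by rewrite invr_gt0.
have er : e <= Num.sqrt s by rewrite -(@ler_pXn2r _ 2%N) ?nnegrE ?(ltW e0) ?(ltW r0)// r2.
have wu : w <= u by rewrite ue lef_pV2 ?posrE.
have w2 : w ^+ 2 = s^-1 by rewrite /w exprVn r2.
have w2u : w ^+ 2 <= u ^+ 2 by rewrite lerXn2r ?nnegrE ?(ltW w0) ?(ltW u0).
have eF x h : heatF s a (x + h) = Phi ((a - x) * w + - (h * w)).
  by rewrite /heatF -/w; congr Phi; ring.
split.
- move=> x; rewrite /heat_dx normrN normrM (ger0_norm (phi_ge0 _)) -/w gtr0_norm//.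
  apply: le_trans A1; rewrite mulrC; apply: ler_pM => //; rewrite ?phi_ge0 ?phi_le8//.
  exact: ltW.
- move=> x; rewrite /heat_dxx normrM -w2 ger0_norm ?sqr_ge0//.
  apply: (@le_trans _ _ (u ^+ 2 * 8)); last by lra.
  by apply: ler_pM => //; [exact: sqr_ge0|exact: phi1_bnd].
- move=> x h; set z := (a - x) * w.
  have -> : heatF s a (x + h) - heatF s a x - heat_dx s a x * h - heat_dxx s a x / 2 * h ^+ 2 =
      (Phi (z + - (h * w)) - Phi z - phi z * - (h * w)) + z * phi z / 2 * (h * w) ^+ 2.
    by rewrite eF -/z /heatF /heat_dx /heat_dxx -/w -/z -w2; field.
  apply: (le_trans (ler_normD _ _)).
  have t1 := taylor1 (@Phi_derive R) (@phi_derive R) (@phi1_bnd R) z (- (h * w)).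
  have t2 : `|z * phi z / 2 * (h * w) ^+ 2| <= 4 * (h * w) ^+ 2.
    rewrite normrM [`|(h * w) ^+ 2|]ger0_norm ?sqr_ge0//; apply: ler_wpM2r; first exact: sqr_ge0.
    have := phi1_bnd z; rewrite normrN [`|_ / 2|]normrM [`|2^-1|]gtr0_norm//; lra.
  apply: (@le_trans _ _ (12 * w ^+ 2 * h ^+ 2)).
    have hw : (h * w) ^+ 2 = w ^+ 2 * h ^+ 2 by ring.
    by move: t1 t2; rewrite sqrrN hw; lra.
  apply: ler_wpM2r; first exact: sqr_ge0.
  by apply: le_trans A2; rewrite ler_wpM2l.
- move=> x h; set z := (a - x) * w.
  have t1 := taylor2 (@Phi_derive R) (@phi_derive R) (@phi1_derive R) (@phi2_bnd R) z (- (h * w)).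
  have -> : heatF s a (x + h) - heatF s a x - heat_dx s a x * h - heat_dxx s a x / 2 * h ^+ 2 =
      Phi (z + - (h * w)) - Phi z - phi z * - (h * w) - - (z * phi z) / 2 * (- (h * w)) ^+ 2.
    by rewrite eF -/z /heatF /heat_dx /heat_dxx -/w -/z -w2; field.
  apply: (le_trans t1); rewrite normrN normrM (gtr0_norm w0) exprMn mulrA mulrAC.
  apply: ler_wpM2r; first by rewrite exprn_ge0.
  apply: le_trans A3; rewrite ler_wpM2l// lerXn2r ?nnegrE ?(ltW w0) ?(ltW u0)//.
- move=> x v v0; pose d := Num.sqrt (1 + v / s).
  have vs : 0 <= v / s by rewrite divr_ge0// ltW.
  have d2 : d ^+ 2 = 1 + v / s by rewrite sqr_sqrtr//; lra.
  have d1 : 1 <= d by rewrite -[leLHS]sqrtr1 ler_wsqrtr//; lra.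
  set z := (a - x) * w.
  have eFv : heatF (s + v) a x = Phi (z / d).
    have -> : s + v = s * (1 + v / s) by field; rewrite gt_eqF.
    by rewrite /heatF (sqrtrM _ (ltW s0)) invfM mulrA.
  have h5 := Phi_scale z d1.
  have y1 : d ^+ 2 - 1 = v / s by rewrite d2; ring.
  rewrite y1 in h5.
  have -> : heatF (s + v) a x - heatF s a x - v / 2 * heat_dxx s a x =
     Phi (z / d) - Phi z - v / s / 2 * - (z * phi z).
    by rewrite eFv /heatF /heat_dxx -/w -/z; congr (_ - _); rewrite mulrA [v / 2 * _]mulrAC.
  apply: (le_trans h5).
  have -> : 5 * (v / s) ^+ 2 = 5 * (w ^+ 2) ^+ 2 * v ^+ 2 by rewrite w2; field; rewrite gt_eqF.
  apply: ler_wpM2r; first exact: sqr_ge0.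
  apply: le_trans A4; rewrite ler_wpM2l// (_ : u ^+ 4 = (u ^+ 2) ^+ 2); last by ring.
  by rewrite lerXn2r ?nnegrE ?sqr_ge0.
Qed.

Lemma measurable_phi : measurable_fun setT (@phi R).
Proof. exact: measurable_normal_pdf. Qed.

Lemma measurable_Phi : measurable_fun setT (@Phi R).
Proof.
apply: continuous_measurable_fun; apply: is_derive_continuous; exact: Phi_derive.
Qed.

Lemma measurable_heat s a : measurable_fun setT (heatF s a).
Proof.
apply: (measurableT_comp measurable_Phi).
by apply: measurable_funM => //; exact: measurable_funB.
Qed.

Lemma measurable_heat_dx s a : measurable_fun setT (heat_dx s a).
Proof.
apply: measurable_funN; apply: measurable_funM => //.
apply: (measurableT_comp measurable_phi).
by apply: measurable_funM => //; exact: measurable_funB.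
Qed.

Lemma measurable_heat_dxx s a : measurable_fun setT (heat_dxx s a).
Proof.
apply: measurable_funM => //; apply: measurable_funN; apply: measurable_funM.
  by apply: measurable_funM => //; exact: measurable_funB.
apply: (measurableT_comp measurable_phi).
by apply: measurable_funM => //; exact: measurable_funB.
Qed.

Lemma heat_le1 s a x : `|heatF s a x| <= 1.
Proof. by rewrite ger0_norm ?Phi_ge0 ?Phi_le1. Qed.

End heat.

(** * Replacement of one block by a Gaussian increment *)

Lemma lindeberg_bound {R : realType} (a b c c' d A t l r q v : R) :
  `|a| <= A * (t * v + l) -> `|b| <= r * (A * q) -> `|c| <= r * (A * t ^+ 2) ->
  `|c'| <= 2 * (A * l) -> `|d| <= A * v ^+ 2 -> 0 <= r -> 0 <= A ->
  `|a + b + (c + c') / 2 - d| <= A * (t * v + 2 * l + r * (q + t ^+ 2) + v ^+ 2).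
Proof.
move=> ha hb hc hc' hd r0 A0.
have h : `|a + b + (c + c') / 2 - d| <= `|a| + `|b| + (`|c| + `|c'|) / 2 + `|d|.
  apply: (le_trans (ler_normB _ _)); rewrite lerD2r.
  apply: (le_trans (ler_normD _ _)); apply: lerD; first exact: ler_normD.
  by rewrite normrM [`|2^-1|]gtr0_norm// ler_wpM2r// ler_normD.
apply: (le_trans h).
have hr : 0 <= r * (A * t ^+ 2) by apply: mulr_ge0 => //; apply: mulr_ge0 => //; exact: sqr_ge0.
lra.
Qed.

Lemma lindeberg_split {R : realType} (F Fv Fs f1 f2q f2t f2 q l v : R) : v = q + l ->
  F - Fv = (F - Fs - f1 - 2^-1 * (f2q + f2t)) + f1
    + ((f2q - f2 * q) + (f2t - l * f2)) / 2 - (Fv - Fs - v / 2 * f2).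
Proof. by move=> ->; field. Qed.

Section lindeberg.
Context (d : measure_display) (T : measurableType d) (R : realType)
  (P : probability T R) (X : int -> {RV P >-> R}).
Hypothesis stationaryX : strictly_stationary P X.
Hypothesis X2 : sqint P (X 0).
Hypothesis X0 : Ex P (X 0) = 0.

Local Notation S := (Sx X id).

Let S2 s : sqint P (S s).
Proof. exact: (Sx_sqint stationaryX (@measurable_id _ _ _) X2). Qed.

Let S0 s : Ex P (S s) = 0.
Proof. exact: (Sx_mean stationaryX (@measurable_id _ _ _) X2 X0). Qed.

(** W is the past and V the block. In the expansion of [heatF] at W, the linear term has small
    expectation by mixing, V being centred. For the quadratic term mixing would need V^2 in L2, so V
    is truncated at tu: the truncated square has norm at most tu^2 and the rest is a tail of V^2.
    What remains, v / 2 times the second derivative, is the increment of the heat flow over the time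
    v. *)
Lemma lindeberg_step (sg : R) (s1 s2 : seq int) (g : nat) (r A s a v tu : R) :
  0 < sg -> (rho P X g <= r%:E)%E -> 0 <= r -> 0 < tu ->
  (forall t : int, t \in s1 -> t <= 0) -> (forall t : int, t \in s2 -> g%:Z <= t) ->
  heat_ok A s a -> v = Ex P (fun w => (S s2 w / sg) ^+ 2) ->
  `|Ex P (fun w => heatF s a (S s1 w / sg + S s2 w / sg)) -
    Ex P (fun w => heatF (s + v) a (S s1 w / sg))| <=
  A * (tu * v + 2 * Ex P (fun w => tl tu (S s2 w / sg)) +
       r * (Num.sqrt v + tu ^+ 2) + v ^+ 2).
Proof.
move=> sg0 hr r0 tu0 h1 h2 [hA1 hA2 hT2 hT3 hH] ve.
have A0 : 0 <= A by apply: le_trans (hA1 0).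
set W := fun w => S s1 w / sg; set V := fun w => S s2 w / sg.
rewrite -/V in ve.
have sW : sqint P W by apply: eq_sqint (sqintZ sg^-1 (S2 s1)) => w; rewrite mulrC.
have sV : sqint P V by apply: eq_sqint (sqintZ sg^-1 (S2 s2)) => w; rewrite mulrC.
have mW := sqint_meas sW; have mV := sqint_meas sV.
have v0 : 0 <= v by rewrite ve; apply: Ex_ge0 => w; exact: sqr_ge0.
have mdiv : measurable_fun setT (fun x : R => x / sg) by exact: measurable_funM.
have mWV : measurable_fun setT (fun w => W w + V w) by exact: measurable_funD.
have mF s' := @measurable_heat R s' a.
have mF1 := @measurable_heat_dx R s a; have mF2 := @measurable_heat_dxx R s a.
have iF : integr P (fun w => heatF s a (W w + V w)).
  by apply: (@integr_bnd _ _ _ P _ 1); [exact: measurableT_comp|move=> w; exact: heat_le1].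
have iFW s' : integr P (fun w => heatF s' a (W w)).
  by apply: (@integr_bnd _ _ _ P _ 1); [exact: measurableT_comp|move=> w; exact: heat_le1].
have sF1 : sqint P (fun w => heat_dx s a (W w)).
  by apply: (@sqint_bnd _ _ _ P _ A); [exact: measurableT_comp|move=> w; exact: hA1].
have sF2 : sqint P (fun w => heat_dxx s a (W w)).
  by apply: (@sqint_bnd _ _ _ P _ A); [exact: measurableT_comp|move=> w; exact: hA2].
have n2F1 : norm2 P (fun w => heat_dx s a (W w)) <= A.
  rewrite -[leRHS]ger0_norm// -(n2_cst P); apply: n2_le => //; first exact: sqint_cst.
  by move=> w; rewrite (ger0_norm A0).
have n2F2 : norm2 P (fun w => heat_dxx s a (W w)) <= A.
  rewrite -[leRHS]ger0_norm// -(n2_cst P); apply: n2_le => //; first exact: sqint_cst.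
  by move=> w; rewrite (ger0_norm A0).
have iV2 := sqint_sq sV.
have itl : integr P (fun w => tl tu (V w)).
  apply: integr_le iV2 _; first exact: measurableT_comp (measurable_tl tu) mV.
  by move=> w; rewrite ger0_norm ?tl_ge0 ?tl_le.
pose Q w := trunc tu (V w) ^+ 2.
have mQ : measurable_fun setT Q.
  apply: measurable_funX; exact: measurableT_comp (measurable_trunc tu) mV.
have Qb w : `|Q w| <= tu ^+ 2.
  rewrite ger0_norm ?sqr_ge0// -[Q w]real_normK ?num_real//.
  by rewrite lerXn2r ?nnegrE// ?(ltW tu0)//; exact: trunc_bnd (ltW tu0).
have sQ : sqint P Q by exact: sqint_bnd Qb.
have eV2 w : V w ^+ 2 = Q w + tl tu (V w).
  by rewrite /Q /trunc /tl; case: leP => _; rewrite ?addr0// expr0n add0r.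
set l := Ex P (fun w => tl tu (V w)).
have l0 : 0 <= l by apply: Ex_ge0 => w; exact: tl_ge0.
have iQ := sqint_integr sQ; have iF2 := sqint_integr sF2.
have vQl : v = Ex P Q + l.
  by rewrite ve -ExD//; apply: eq_Ex => w; exact: eV2.
have iF1V : integr P (fun w => heat_dx s a (W w) * V w) by exact: sqint_mul.
have iF2Q : integr P (fun w => heat_dxx s a (W w) * Q w) by exact: sqint_mul.
have iF2tl : integr P (fun w => heat_dxx s a (W w) * tl tu (V w)).
  apply: integr_le (integrZ A itl) _.
    apply: measurable_funM; first exact: sqint_meas sF2.
    exact: measurableT_comp (measurable_tl tu) mV.
  by move=> w; rewrite normrM (ger0_norm (tl_ge0 _ _)) ler_wpM2r ?tl_ge0.
pose D1 w := heatF s a (W w + V w) - heatF s a (W w) - heat_dx s a (W w) * V w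
   - heat_dxx s a (W w) / 2 * V w ^+ 2.
have D1b w : `|D1 w| <= A * (tu * V w ^+ 2 + tl tu (V w)).
  rewrite /tl; case: ltP => hV.
    apply: (le_trans (hT2 _ _)); apply: ler_wpM2l => //.
    by rewrite lerDr mulr_ge0 ?sqr_ge0 ?(ltW tu0).
  apply: (le_trans (hT3 _ _)); apply: ler_wpM2l => //.
  rewrite addr0 exprSr -[V w ^+ 2]real_normK ?num_real// mulrC.
  by apply: ler_wpM2r => //; exact: sqr_ge0.
have iB1 : integr P (fun w => A * (tu * V w ^+ 2 + tl tu (V w))) by integ.
have iD1 : integr P D1.
  apply: integr_le iB1 D1b.
  apply: measurable_funB; last first.
    apply: measurable_funM; last exact: measurable_funX.
    by apply: measurable_funM => //; exact: sqint_meas sF2.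
  apply: measurable_funB; last exact: integr_meas iF1V.
  by apply: measurable_funB; [exact: integr_meas iF|exact: integr_meas (iFW s)].
pose D4 w := heatF (s + v) a (W w) - heatF s a (W w) - v / 2 * heat_dxx s a (W w).
have i1 := iFW s; have i2 := iFW (s + v).
have iD4 : integr P D4 by rewrite /D4; integ.
have E1 : `|Ex P D1| <= A * (tu * v + l).
  apply: (le_trans (Ex_abs iD1)).
  have -> : A * (tu * v + l) = Ex P (fun w => A * (tu * V w ^+ 2 + tl tu (V w))).
    by rewrite ExZ ?ExD ?ExZ; try integ; rewrite -ve.
  by apply: Ex_le => //; exact: integr_abs.
have mid := @measurable_id _ (measurableTypeR R) setT.
have E2 : `|Ex P (fun w => heat_dx s a (W w) * V w)| <= r * (A * Num.sqrt v).
  have := @Sx_mixing _ _ _ P X id id g r s1 s2 (fun x => heat_dx s a (x / sg)) (fun x => x / sg)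
    mid mid (measurableT_comp mF1 mdiv) mdiv hr h1 h2 sF1 sV.
  have -> : Ex P (fun w => S s2 w / sg) = 0.
    rewrite (@eq_Ex _ _ _ P _ (fun w => sg^-1 * S s2 w)); last by move=> w; rewrite mulrC.
    by rewrite ExZ ?S0 ?mulr0//; exact/sqint_integr/S2.
  rewrite mulr0 subr0 => /le_trans; apply; apply: ler_wpM2l => //.
  apply: ler_pM; rewrite ?n2_ge0//.
  by rewrite /norm2 -/V -ve.
have E3 : `|Ex P (fun w => heat_dxx s a (W w) * Q w) - Ex P (fun w => heat_dxx s a (W w)) * Ex P Q|
    <= r * (A * tu ^+ 2).
  have mG : measurable_fun setT (fun x : R => trunc tu (x / sg) ^+ 2).
    by apply: measurable_funX; exact: measurableT_comp (measurable_trunc tu) mdiv.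
  have := @Sx_mixing _ _ _ P X id id g r s1 s2 (fun x => heat_dxx s a (x / sg))
    (fun x => trunc tu (x / sg) ^+ 2)
    mid mid (measurableT_comp mF2 mdiv) mG hr h1 h2 sF2 sQ.
  move=> /le_trans; apply; apply: ler_wpM2l => //.
  apply: ler_pM; rewrite ?n2_ge0//.
  rewrite -[leRHS]ger0_norm ?sqr_ge0// -(n2_cst P); apply: n2_le => //; first exact: sqint_cst.
  by move=> w; apply: (le_trans (Qb w)); exact: ler_norm.
have E3' : `|Ex P (fun w => heat_dxx s a (W w) * tl tu (V w)) - l * Ex P (fun w => heat_dxx s a (W w))|
    <= 2 * (A * l).
  have k1 : `|Ex P (fun w => heat_dxx s a (W w) * tl tu (V w))| <= A * l.
    apply: (le_trans (Ex_abs iF2tl)); rewrite -ExZ//.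
    apply: Ex_le; [exact: integr_abs|exact: integrZ|].
    by move=> w; rewrite normrM (ger0_norm (tl_ge0 _ _)) ler_wpM2r ?tl_ge0.
  have k2 : `|l * Ex P (fun w => heat_dxx s a (W w))| <= A * l.
    rewrite normrM (ger0_norm l0) mulrC ler_wpM2r//.
    by apply: Ex_bnd => // w; exact: hA2.
  by apply: (le_trans (ler_normB _ _)); lra.
have E4 : `|Ex P D4| <= A * v ^+ 2.
  by apply: Ex_bnd => // w; exact: hH.
have key : Ex P (fun w => heatF s a (W w + V w)) - Ex P (fun w => heatF (s + v) a (W w)) =
  Ex P D1 + Ex P (fun w => heat_dx s a (W w) * V w)
  + ((Ex P (fun w => heat_dxx s a (W w) * Q w) - Ex P (fun w => heat_dxx s a (W w)) * Ex P Q) +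
     (Ex P (fun w => heat_dxx s a (W w) * tl tu (V w)) - l * Ex P (fun w => heat_dxx s a (W w)))) / 2
  - Ex P D4.
  have iD : integr P (fun w => heat_dxx s a (W w) * (Q w + tl tu (V w))).
    by apply: eq_integr (integrD iF2Q iF2tl) => w; rewrite mulrDr.
  have eD1 : Ex P D1 = Ex P (fun w => heatF s a (W w + V w)) - Ex P (fun w => heatF s a (W w))
     - Ex P (fun w => heat_dx s a (W w) * V w)
     - 2^-1 * (Ex P (fun w => heat_dxx s a (W w) * Q w) + Ex P (fun w => heat_dxx s a (W w) * tl tu (V w))).
    rewrite -ExD// -ExZ; last by integ.
    rewrite -!ExB; try integ.
    by apply: eq_Ex => w; rewrite /D1 eV2; ring.
  have eD4 : Ex P D4 = Ex P (fun w => heatF (s + v) a (W w)) - Ex P (fun w => heatF s a (W w))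
     - v / 2 * Ex P (fun w => heat_dxx s a (W w)).
    by rewrite -ExZ// -!ExB; try integ.
  rewrite eD1 eD4.
  exact: lindeberg_split.
rewrite key; exact: lindeberg_bound E1 E2 E3 E3' E4 r0 A0.
Qed.

End lindeberg.

(** * Blocks and gaps *)

(** Blocks are added at the end, so that the block being replaced comes after all those still
    present; L - m is the length of a gap. *)
Fixpoint block_times (L m i : nat) : seq int :=
  if i is i'.+1 then block_times L m i' ++ blk (1 + (i' * L)%N%:Z) m else [::].

Lemma mem_block_times (m G i : nat) (t : int) : t \in block_times (m + G) m i ->
  t <= (i * (m + G))%N%:Z - G%:Z.
Proof.
elim: i => // i IH /=; rewrite mem_cat => /orP[/IH|/mem_blk]; rewrite mulSn; lia.
Qed.

(** s and w are the norms of the whole sum and of its blocks, D bounds the norm of what lies outside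
    the blocks, sm is the variance of one of the k blocks. The blocks are nearly orthogonal and the
    rest is negligible, so k sm / s^2, the total time run by the heat flow, is close to 1. *)
Lemma variance_ratio (R : realType) (s sm w D k r e : R) :
  0 < s -> 0 <= w -> 0 < k -> 0 <= r -> r * k <= e -> D <= e * s -> 0 <= D -> 0 < e -> e <= 8^-1 ->
  `|w ^+ 2 - k * sm| <= r * k ^+ 2 * sm -> 0 <= sm ->
  w <= s + D -> s <= w + D ->
  `|k * (sm / s ^+ 2) - 1| <= 4 * e.
Proof.
move=> s0 w0 k0 r0 rk Ds D0 e0 e8 hw sm0 ws sw.
have s2 : 0 < s ^+ 2 by rewrite exprn_gt0.
have ks0 : 0 <= k * sm by rewrite mulr_ge0// ltW.
have h1 : r * k ^+ 2 * sm <= e * (k * sm).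
  rewrite (_ : _ * sm = (r * k) * (k * sm)); last by ring.
  exact: ler_wpM2r.
have w1 : w ^+ 2 <= ((1 + e) * s) ^+ 2 by rewrite lerXn2r ?nnegrE ?mulr_ge0//; lra.
have w2 : ((1 - e) * s) ^+ 2 <= w ^+ 2.
  by rewrite lerXn2r ?nnegrE ?mulr_ge0//; lra.
have := le_trans hw h1; rewrite ler_norml => /andP[h2 h3].
have u1 : (1 - e) * (k * sm) <= (1 + e) ^+ 2 * s ^+ 2 by rewrite -exprMn; lra.
have u2 : (1 - e) ^+ 2 * s ^+ 2 <= (1 + e) * (k * sm) by rewrite -exprMn; lra.
rewrite mulrA; set y := k * sm in u1 u2 *.
have e28 : e * e <= 8^-1 * e by rewrite ler_wpM2r// ltW.
have es : e * (e * s ^+ 2) <= 8^-1 * (e * s ^+ 2) by rewrite ler_wpM2r// mulr_ge0// ltW.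
have es0 : 0 <= e * s ^+ 2 by rewrite mulr_ge0// ltW.
have es1 : 0 <= e * (e * s ^+ 2) by rewrite mulr_ge0// ltW.
have v1 : y <= (1 + 4 * e) * s ^+ 2.
  have : (1 - e) * y <= (1 - e) * ((1 + 4 * e) * s ^+ 2).
    apply: (le_trans u1); lra.
  by rewrite ler_pM2l//; lra.
have v2 : (1 - 4 * e) * s ^+ 2 <= y.
  have : (1 + e) * ((1 - 4 * e) * s ^+ 2) <= (1 + e) * y.
    apply: le_trans u2; lra.
  by rewrite ler_pM2l//; lra.
rewrite ler_norml lerBrDr lerBlDr ler_pdivlMr// ler_pdivrMr//.
apply/andP; split; lra.
Qed.

Section CLT.
Context (d : measure_display) (T : measurableType d) (R : realType)
  (P : probability T R) (X : int -> {RV P >-> R}).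
Hypothesis stationaryX : strictly_stationary P X.
Hypothesis X2 : sqint P (X 0).
Hypothesis X0 : Ex P (X 0) = 0.

Local Notation S := (Sx X id).
Local Notation sigma := (tau X id).

Let mid := @measurable_id _ (measurableTypeR R) setT.

Let S2 s : sqint P (S s).
Proof. exact: (Sx_sqint stationaryX mid X2). Qed.

Let S0 s : Ex P (S s) = 0.
Proof. exact: (Sx_mean stationaryX mid X2 X0). Qed.

Lemma shift_Ex (F : R -> R) s h : measurable_fun setT F -> integr P (fun w => F (S s w)) ->
  Ex P (fun w => F (S [seq t + h | t <- s] w)) = Ex P (fun w => F (S s w)).
Proof.
move=> mF iF; symmetry; apply: same_law_Ex => //; try exact: measurable_Sx.
by move=> B mB; symmetry; exact: Sx_stationary.
Qed.

Lemma shift_n2 s h : norm2 P (S [seq t + h | t <- s]) = norm2 P (S s).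
Proof.
congr Num.sqrt; apply: (@shift_Ex (fun x => x ^+ 2)); first exact: measurable_funX.
exact: sqint_sq.
Qed.

Lemma variance_cat (s1 s2 : seq int) (g : nat) (r : R) : (rho P X g <= r%:E)%E ->
  (forall t : int, t \in s1 -> t <= 0) -> (forall t : int, t \in s2 -> g%:Z <= t) ->
  `|norm2 P (S (s1 ++ s2)) ^+ 2 - norm2 P (S s1) ^+ 2 - norm2 P (S s2) ^+ 2| <=
  2 * (r * (norm2 P (S s1) * norm2 P (S s2))).
Proof.
move=> hr h1 h2.
have i1 := S2 s1; have i2 := S2 s2.
have -> : norm2 P (S (s1 ++ s2)) ^+ 2 - norm2 P (S s1) ^+ 2 - norm2 P (S s2) ^+ 2 =
    2 * Ex P (fun w => S s1 w * S s2 w).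
  rewrite !n2_sqr (@eq_Ex _ _ _ P _ (fun w => S s1 w ^+ 2 + 2 * (S s1 w * S s2 w) + S s2 w ^+ 2)).
    by rewrite !ExD ?ExZ; try integ; ring.
  by move=> w; rewrite Sx_cat; ring.
rewrite normrM ger0_norm// ler_wpM2l//.
have := @Sx_mixing _ _ _ P X id id g r s1 s2 id id mid mid mid mid hr h1 h2 i1 i2.
by rewrite [Ex P (fun w => id (S s1 w))]S0 mul0r subr0.
Qed.

(** This shift moves the end of the i-th block to time 0; the next block then starts at time 1 +
    G. *)
Lemma shift_past (m G i : nat) (t : int) :
  t \in [seq u + (G%:Z - (i * (m + G))%N%:Z) | u <- block_times (m + G) m i] -> t <= 0.
Proof. by move=> /mapP[u /mem_block_times hu ->]; lia. Qed.

Lemma shift_future (m G i : nat) (t : int) :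
  t \in [seq u + (G%:Z - (i * (m + G))%N%:Z) | u <- blk (1 + (i * (m + G))%N%:Z) m] ->
  G%:Z <= t.
Proof. by move=> /mapP[u /mem_blk hu ->]; lia. Qed.

Lemma block_sum_norm_le m G i : norm2 P (S (block_times (m + G) m i)) <= i%:R * sigma m.
Proof.
elim: i => [|i IH] /=.
  by rewrite mul0r (@eq_n2 _ _ _ _ _ (fun=> 0)) ?n2_cst ?normr0// => w; rewrite /Sx big_nil.
rewrite -natr1 mulrDl mul1r (eq_n2 _ (Sx_cat X id _ _)).
apply: (le_trans (n2D (S2 _) (S2 _))); apply: lerD => //.
by rewrite (blk_n2 stationaryX mid X2).
Qed.

(** Appending a block to i others adds twice a covariance, at most 2 r i [sigma m] ^ 2, and 2 i <=
    (i + 1)^2 - i^2. *)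
Lemma block_sum_variance m G i (r : R) : (rho P X G <= r%:E)%E -> 0 <= r ->
  `|norm2 P (S (block_times (m + G) m i)) ^+ 2 - i%:R * sigma m ^+ 2| <= r * i%:R ^+ 2 * sigma m ^+ 2.
Proof.
move=> hr r0; elim: i => [|i IH].
  rewrite (@eq_n2 _ _ _ _ _ (fun=> 0)) ?n2_cst ?normr0; last by move=> w; rewrite /Sx big_nil.
  by rewrite expr0n mul0r subrr normr0 mulr0 mul0r.
pose h := G%:Z - (i * (m + G))%N%:Z.
pose s1 := [seq u + h | u <- block_times (m + G) m i].
pose s2 := [seq u + h | u <- blk (1 + (i * (m + G))%N%:Z) m].
have e12 : norm2 P (S (block_times (m + G) m i.+1)) = norm2 P (S (s1 ++ s2)).
  by rewrite -(shift_n2 _ h) /= map_cat.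
have e1 : norm2 P (S s1) = norm2 P (S (block_times (m + G) m i)) by exact: shift_n2.
have e2 : norm2 P (S s2) = sigma m by rewrite shift_n2 (blk_n2 stationaryX mid X2).
have := variance_cat hr (@shift_past m G i) (@shift_future m G i); rewrite -/h -/s1 -/s2.
rewrite e12 e1 e2 => hp.
have hW := block_sum_norm_le m G i; set w := norm2 P (S (block_times _ _ _)) in IH hp hW.
have sm0 : 0 <= sigma m by exact: n2_ge0.
have hp2 : 2 * (r * (w * sigma m)) <= 2 * (r * (i%:R * sigma m * sigma m)).
  by rewrite ler_pM2l// ler_wpM2l// ler_wpM2r.
set z := norm2 P (S (s1 ++ s2)) in hp *.
rewrite (_ : z ^+ 2 - i.+1%:R * sigma m ^+ 2 =
  (z ^+ 2 - w ^+ 2 - sigma m ^+ 2) + (w ^+ 2 - i%:R * sigma m ^+ 2)); last first.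
  by rewrite -natr1; ring.
apply: (le_trans (ler_normD _ _)).
apply: (le_trans (lerD (le_trans hp hp2) IH)).
have -> : r * i.+1%:R ^+ 2 * sigma m ^+ 2 = 2 * (r * (i%:R * sigma m * sigma m)) +
   r * i%:R ^+ 2 * sigma m ^+ 2 + r * sigma m ^+ 2 by rewrite -natr1; ring.
by rewrite lerDl mulr_ge0// sqr_ge0.
Qed.

Lemma gaps_norm_le m G i :
  norm2 P (fun w => S (blk 1 (i * (m + G))) w - S (block_times (m + G) m i) w) <= i%:R * (G%:R * sigma 1).
Proof.
elim: i => [|i IH] /=.
  rewrite mul0r (@eq_n2 _ _ _ _ _ (fun=> 0)) ?n2_cst ?normr0// => w.
  by rewrite mul0n /Sx !big_nil subrr.
rewrite (@eq_n2 _ _ _ _ _ (fun w => (S (blk 1 (i * (m + G))) w - S (block_times (m + G) m i) w)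
  + S (blk (1 + (i * (m + G))%N%:Z + m%:Z) G) w)); last first.
  move=> w; rewrite mulSn addnC Sx_blkD Sx_blkD Sx_cat; ring.
rewrite -natr1 mulrDl mul1r.
apply: (le_trans (n2D (sqintB (S2 _) (S2 _)) (S2 _))); apply: lerD => //.
by rewrite (blk_n2 stationaryX mid X2); exact: tau_mul.
Qed.

Lemma tl_scale (s t x : R) : 0 < s -> tl t (x / s) = (s ^+ 2)^-1 * tl (t * s) x.
Proof.
move=> s0; rewrite /tl normrM normfV (gtr0_norm s0) ltr_pdivlMr//.
by case: ifP => _; rewrite ?mulr0// exprMn exprVn mulrC.
Qed.

Lemma tl_mono (k k' x : R) : k <= k' -> tl k' x <= tl k x.
Proof.
move=> kk; rewrite /tl; case: ifP => h; first by rewrite (le_lt_trans kk h).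
by case: ifP => // _; exact: sqr_ge0.
Qed.

Lemma tl_integr k s : integr P (fun w => tl k (S s w)).
Proof.
apply: integr_le (sqint_sq (S2 s)) _.
  by apply: measurableT_comp; [exact: measurable_tl|exact: measurable_Sx].
by move=> w; rewrite ger0_norm ?tl_ge0 ?tl_le.
Qed.

(** The condition on K lets a tail at level tu of the block normalised by sg be read as a tail at
    level K in its own scale [sigma m], where uniform integrability applies. *)
Lemma block_step (m G i : nat) (r A s a sg tu K eta v : R) :
  0 < sg -> (rho P X G <= r%:E)%E -> 0 <= r -> 0 < tu -> heat_ok A s a -> 0 <= A ->
  K * sigma m <= tu * sg ->
  Ex P (fun w => tl (K * sigma m) (Tn X id m w)) <= eta * sigma m ^+ 2 ->
  v = sigma m ^+ 2 / sg ^+ 2 ->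
  `|Ex P (fun w => heatF s a (S (block_times (m + G) m i.+1) w / sg)) -
    Ex P (fun w => heatF (s + v) a (S (block_times (m + G) m i) w / sg))| <=
  A * (tu * v + 2 * (eta * v) + r * (Num.sqrt v + tu ^+ 2) + v ^+ 2).
Proof.
move=> sg0 hr r0 tu0 hA A0 hK hUI vE.
pose h := G%:Z - (i * (m + G))%N%:Z.
pose s1 := [seq u + h | u <- block_times (m + G) m i].
pose s2 := [seq u + h | u <- blk (1 + (i * (m + G))%N%:Z) m].
have mF s' : measurable_fun setT (fun x : R => heatF s' a (x / sg)).
  by apply: (measurableT_comp (@measurable_heat R s' a)); exact: measurable_funM.
have iF s' u : integr P (fun w => heatF s' a (S u w / sg)).
  apply: (@integr_bnd _ _ _ P _ 1); last by move=> w; exact: heat_le1.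
  by apply: (measurableT_comp (mF s')); exact: measurable_Sx.
rewrite -(shift_Ex h (mF s) (iF s _)) -(shift_Ex h (mF (s + v)) (iF (s + v) _)).
rewrite /= map_cat -/s1 -/s2.
rewrite [X in X - _](@eq_Ex _ _ _ P _ (fun w => heatF s a (S s1 w / sg + S s2 w / sg))); last first.
  by move=> w; rewrite Sx_cat mulrDl.
have e2 : s2 = blk (1 + (i * (m + G))%N%:Z + h) m by rewrite blk_shift.
have sg2 : 0 < sg ^+ 2 by rewrite exprn_gt0.
have ve : v = Ex P (fun w => (S s2 w / sg) ^+ 2).
  rewrite (@eq_Ex _ _ _ P _ (fun w => (sg ^+ 2)^-1 * S s2 w ^+ 2)); last first.
    by move=> w; rewrite exprMn exprVn mulrC.
  rewrite ExZ; last exact: (sqint_sq (S2 s2)).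
  by rewrite -(n2_sqr P (S s2)) e2 (blk_n2 stationaryX mid X2) mulrC.
apply: (le_trans (lindeberg_step stationaryX X2 X0 sg0 hr r0 tu0 (@shift_past m G i)
  (@shift_future m G i) hA ve)).
rewrite ler_wpM2l// lerD2r lerD2r lerD2l ler_wpM2l//.
rewrite (@eq_Ex _ _ _ P _ (fun w => (sg ^+ 2)^-1 * tl (tu * sg) (S s2 w))); last first.
  by move=> w; exact: tl_scale.
rewrite ExZ; last exact: tl_integr.
have -> : eta * v = (sg ^+ 2)^-1 * (eta * sigma m ^+ 2) by rewrite vE; ring.
apply: ler_wpM2l; first by rewrite invr_ge0 ltW.
apply: le_trans hUI.
apply: (@le_trans _ _ (Ex P (fun w => tl (K * sigma m) (S s2 w)))).
  by apply: Ex_le; [exact: tl_integr|exact: tl_integr|move=> w; exact: tl_mono].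
rewrite e2 (@blk_Ex _ _ _ P X stationaryX id mid (tl (K * sigma m)) _ 1)//.
- exact: measurable_tl.
- exact: tl_integr.
Qed.

End CLT.

Section arith.
Context {R : realType}.

Lemma block_error_sum (A tu v e1 r k : R) : 0 <= A -> 0 <= tu -> 0 < k -> 0 <= v ->
  0 <= e1 -> 0 <= r -> k * v <= 2 -> 1 <= k ->
  k * (A * (tu * v + 2 * (e1 * v) + r * (Num.sqrt v + tu ^+ 2) + v ^+ 2)) <=
  A * (2 * tu + 4 * e1 + (k * r) * (2 + tu ^+ 2) + 4 / k).
Proof.
move=> A0 tu0 k0 v0 e0 r0 kv k1.
rewrite mulrCA; apply: ler_wpM2l => //.
have v2 : v <= 2 by apply: le_trans kv; rewrite ler_peMl.
have sv : Num.sqrt v <= 2.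
  rewrite -[leRHS]ger0_norm// -sqrtr_sqr ler_wsqrtr//; lra.
have h1 : k * v * tu <= 2 * tu by rewrite ler_wpM2r.
have h2 : k * v * e1 <= 2 * e1 by rewrite ler_wpM2r.
have h3 : k * r * (Num.sqrt v + tu ^+ 2) <= k * r * (2 + tu ^+ 2).
  by rewrite ler_wpM2l ?lerD2r// mulr_ge0// ltW.
have h4 : k * v ^+ 2 <= 4 / k.
  rewrite ler_pdivlMr// (_ : k * v ^+ 2 * k = (k * v) ^+ 2); last by ring.
  rewrite (_ : 4 = 2 ^+ 2); last by ring.
  by rewrite lerXn2r ?nnegrE// mulr_ge0// ltW.
lra.
Qed.

(** Each of the four terms is at most eta / (8 A). *)
Lemma block_error_le (A tu e1 kr k eta : R) : 0 < A -> 0 < k ->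
  tu = eta / (16 * A) -> e1 = eta / (32 * A) ->
  kr * (2 + tu ^+ 2) <= eta / (8 * A) -> 32 * A / eta <= k -> 0 < eta ->
  A * (2 * tu + 4 * e1 + kr * (2 + tu ^+ 2) + 4 / k) <= eta / 2.
Proof.
move=> A0 k0 -> -> hk hk2 eta0.
have h4 : 4 / k <= eta / (8 * A).
  rewrite ler_pdivrMr// mulrC -ler_pdivrMr ?divr_gt0 ?mulr_gt0//.
  apply: le_trans hk2; rewrite le_eqVlt; apply/orP; left; apply/eqP.
  by field; rewrite !gt_eqF.
have -> : eta / 2 = A * (2 * (eta / (16 * A)) + 4 * (eta / (32 * A)) +
   eta / (8 * A) + eta / (8 * A)) by field; rewrite gt_eqF.
by rewrite ler_pM2l// lerD// lerD.
Qed.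

Lemma block_variance_le2 (x e : R) : x - 1 <= 4 * e -> e <= 8^-1 -> x <= 2.
Proof. lra. Qed.

Lemma heat_time_arith (z u q A ee : R) : 0 <= A -> 0 <= u -> u <= 4 * ee ->
  0 <= ee -> ee <= 8^-1 ->
  `|z - u / 2 * q| <= A * u ^+ 2 -> `|q| <= A -> `|z| <= 4 * A * ee.
Proof.
move=> A0 u0 u4 ee0 ee8 h hq.
rewrite (_ : z = (z - u / 2 * q) + u / 2 * q); last by rewrite subrK.
apply: (le_trans (ler_normD _ _)).
have h6 : `|u / 2 * q| <= 2 * ee * A.
  rewrite normrM; apply: ler_pM => //.
  rewrite ger0_norm ?divr_ge0// ler_pdivrMr//; apply: le_trans u4 _.
  by rewrite le_eqVlt; apply/orP; left; apply/eqP; ring.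
have h8 : u ^+ 2 <= 2 * ee.
  rewrite expr2; apply: (@le_trans _ _ (4 * ee * (4 * 8^-1))).
    apply: ler_pM => //; apply: le_trans u4 _.
    by rewrite ler_pM2l.
  by rewrite le_eqVlt; apply/orP; left; apply/eqP; field.
apply: (le_trans (lerD (le_trans h (ler_wpM2l A0 h8)) h6)).
by rewrite le_eqVlt; apply/orP; left; apply/eqP; ring.
Qed.

Lemma heat_time (s A a x ee : R) : (forall t, s <= t -> heat_ok A t a) ->
  0 <= A -> 0 <= ee -> ee <= 8^-1 -> 0 <= x -> `|x - 1| <= 4 * ee ->
  `|heatF (s + x) a 0 - heatF (s + 1) a 0| <= 4 * A * ee.
Proof.
move=> hok A0 ee0 ee8 x0; rewrite ler_norml => /andP[x1 x2].
have hh t u : s <= t -> 0 <= u -> u <= 4 * ee ->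
    `|heatF (t + u) a 0 - heatF t a 0| <= 4 * A * ee.
  move=> es u0 u4; have [_ h2 _ _ h5] := hok t es.
  exact: heat_time_arith A0 u0 u4 ee0 ee8 (h5 0 u u0) (h2 0).
have [h1|h1] := leP 1 x.
  have -> : s + x = s + 1 + (x - 1) by ring.
  by apply: hh; rewrite ?lerDl// subr_ge0.
have -> : s + 1 = s + x + (1 - x) by ring.
rewrite distrC; apply: hh; first by rewrite lerDl.
  by rewrite subr_ge0 ltW.
by rewrite lerBlDr -lerBlDl; rewrite lerBlDl; move: x1; clear; lra.
Qed.

Lemma heat_space_arith (z p q h A : R) :
  `|z - p * h - q / 2 * h ^+ 2| <= A * h ^+ 2 -> `|p| <= A -> `|q| <= A ->
  `|z| <= A * `|h| + 2 * A * h ^+ 2.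
Proof.
move=> hz hp hq; have A0 := le_trans (normr_ge0 _) hq.
have q1 : `|p * h| <= A * `|h| by rewrite normrM ler_wpM2r.
have q2 : `|q / 2 * h ^+ 2| <= A * h ^+ 2.
  rewrite normrM (ger0_norm (sqr_ge0 _)) ler_wpM2r ?sqr_ge0//.
  rewrite normrM [X in _ * X]ger0_norm// ler_pdivrMr//; apply: le_trans hq _.
  by rewrite mulr_natr mulr2n lerDl.
rewrite (_ : z = (z - p * h - q / 2 * h ^+ 2) + (p * h + q / 2 * h ^+ 2)); last by ring.
apply: (le_trans (ler_normD _ _)); apply: (le_trans (lerD hz (ler_normD _ _))).
by apply: (le_trans (lerD (lexx _) (lerD q1 q2))); rewrite le_eqVlt; apply/orP; left; apply/eqP; ring.
Qed.

Lemma smooth_clt_triangle (z1 z2 z3 z4 a e : R) : `|z1 - z2| <= 3 * a -> `|z2 - z3| <= e / 2 ->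
  `|z3 - z4| <= 4 * a -> 7 * a <= e / 2 -> `|z1 - z4| <= e.
Proof.
move=> h1 h2 h3 h4; apply: (le_trans (ler_distD z2 _ _)).
apply: (le_trans (lerD h1 (ler_distD z3 _ _))).
apply: (le_trans (lerD (lexx _) (lerD h2 h3))); lra.
Qed.

End arith.

(** The flow is Lipschitz in x up to a quadratic term; this serves to drop the gaps and the last
    variables, small in L2. *)
Lemma heat_shift (d : measure_display) (T : measurableType d) (R : realType)
    (P : probability T R) (f g : T -> R) (s a A sg ee : R) :
  sqint P f -> sqint P g -> heat_ok A s a -> 0 < sg -> 0 < ee -> ee <= 1 ->
  norm2 P (fun w => f w - g w) <= ee * sg ->
  `|Ex P (fun w => heatF s a (f w / sg)) - Ex P (fun w => heatF s a (g w / sg))|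
    <= 3 * (A * ee).
Proof.
move=> sf sg' [h1 h2 h3 _ _] sg0 ee0 ee1 hD.
have A0 : 0 <= A := le_trans (normr_ge0 _) (h2 0).
have mF : measurable_fun setT (fun x : R => heatF s a (x / sg)).
  by apply: (measurableT_comp (@measurable_heat R _ a)); exact: measurable_funM.
have iF k : sqint P k -> integr P (fun w => heatF s a (k w / sg)).
  move=> sk; apply: (@integr_bnd _ _ _ P _ 1); last by move=> w; exact: heat_le1.
  by apply: (measurableT_comp mF); exact: sqint_meas sk.
have i1 := iF _ sf; have i2 := iF _ sg'.
rewrite -ExB//; apply: (le_trans (Ex_abs (integrB i1 i2))).
pose h w := (f w - g w) / sg.
have sh : sqint P h.
  by apply: eq_sqint (sqintZ sg^-1 (sqintB sf sg')) => w; rewrite mulrC.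
have nh : norm2 P h <= ee.
  rewrite (@eq_n2 _ _ _ _ _ (fun w => sg^-1 * (f w - g w))); last first.
    by move=> w; rewrite mulrC.
  rewrite n2Z; last exact: sqintB.
  by rewrite gtr0_norm ?invr_gt0// ler_pdivrMl// mulrC.
have pt w : `|heatF s a (f w / sg) - heatF s a (g w / sg)|
    <= A * `|h w| + 2 * A * h w ^+ 2.
  have fh : g w / sg + h w = f w / sg by rewrite /h -mulrDl addrC subrK.
  by rewrite -fh; exact: heat_space_arith (h3 _ _) (h1 _) (h2 _).
have sah : sqint P (fun w => `|h w|).
  apply: (sqint_le _ sh); last by move=> w; rewrite normr_id.
  by apply: measurableT_comp => //; exact: sqint_meas sh.
have iah := sqint_integr sah; have ih2 := sqint_sq sh.
apply: (@le_trans _ _ (Ex P (fun w => A * `|h w| + 2 * A * h w ^+ 2))).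
  by apply: Ex_le => //; [apply: integr_abs; exact: integrB|integ].
rewrite ExD ?ExZ; try integ.
have q3 : Ex P (fun w => `|h w|) <= ee.
  apply: le_trans nh; apply: le_trans (ler_norm _) _; apply: (le_trans (Ex_n2 sah)).
  by apply: n2_le => // w; rewrite normr_id.
have q4 : Ex P (fun w => h w ^+ 2) <= ee.
  rewrite -n2_sqr; apply: (@le_trans _ _ (ee ^+ 2)).
    by rewrite lerXn2r ?nnegrE ?n2_ge0 ?(ltW ee0).
  by rewrite expr2 ler_piMl ?(ltW ee0).
have := ler_wpM2l A0 q3; have := ler_wpM2l A0 q4; clear; lra.
Qed.

(** * The limit theorem for smoothed indicators *)

Section CLT.
Context (d : measure_display) (T : measurableType d) (R : realType)
  (P : probability T R) (X : int -> {RV P >-> R}).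
Hypothesis stationaryX : strictly_stationary P X.
Hypothesis X2 : sqint P (X 0).
Hypothesis X0 : Ex P (X 0) = 0.

Local Notation S := (Sx X id).
Local Notation sigma := (tau X id).

Hypothesis rho0 : forall e : R, 0 < e ->
  exists N : nat, (rho P X N <= e%:E)%E.
Hypothesis sigmay : forall A : R, exists N : nat,
  forall n, (N <= n)%N -> A <= sigma n.
Hypothesis UI : forall eta : R, 0 < eta -> exists (K : R) (N : nat), 0 < K /\
  forall n, (N <= n)%N ->
    Ex P (fun w => tl (K * sigma n) (Tn X id n w)) <= eta * sigma n ^+ 2.

Let mid := @measurable_id _ (measurableTypeR R) setT.

Let S2 s : sqint P (S s).
Proof. exact: (Sx_sqint stationaryX mid X2). Qed.

Lemma lindeberg_telescope (m G k : nat) (r A e a sg tu K eta v : R) :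
  0 < sg -> (rho P X G <= r%:E)%E -> 0 <= r -> 0 < tu ->
  (forall s, e ^+ 2 <= s -> heat_ok A s a) -> 0 <= A ->
  K * sigma m <= tu * sg ->
  Ex P (fun w => tl (K * sigma m) (Tn X id m w)) <= eta * sigma m ^+ 2 ->
  v = sigma m ^+ 2 / sg ^+ 2 ->
  `|Ex P (fun w => heatF (e ^+ 2) a (S (block_times (m + G) m k) w / sg)) -
    heatF (e ^+ 2 + k%:R * v) a 0| <=
  k%:R * (A * (tu * v + 2 * (eta * v) + r * (Num.sqrt v + tu ^+ 2) + v ^+ 2)).
Proof.
move=> sg0 hr r0 tu0 hA A0 hK hUI vE.
have v0 : 0 <= v by rewrite vE divr_ge0// sqr_ge0.
set B := A * _.
(* The first i blocks are kept, the other k - i are replaced by the time (k - i) v: t k is the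
   quantity studied and t 0 is deterministic. *)
pose t i := Ex P (fun w => heatF (e ^+ 2 + (k - i)%:R * v) a (S (block_times (m + G) m i) w / sg)).
suff h i : (i <= k)%N -> `|t i - heatF (e ^+ 2 + k%:R * v) a 0| <= i%:R * B.
  by have := h k (leqnn _); rewrite /t subnn mul0r addr0.
elim: i => [|i IH] ik.
  rewrite mul0r /t subn0 (@eq_Ex _ _ _ P _ (fun=> heatF (e ^+ 2 + k%:R * v) a 0)).
    by rewrite Ex_cst subrr normr0.
  by move=> w; rewrite /Sx big_nil mul0r.
have es : e ^+ 2 <= e ^+ 2 + (k - i.+1)%:R * v by rewrite lerDl mulr_ge0.
have st := block_step stationaryX X2 X0 i sg0 hr r0 tu0 (hA _ es) A0 hK hUI vE.
have ev : e ^+ 2 + (k - i.+1)%:R * v + v = e ^+ 2 + (k - i)%:R * v.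
  by rewrite -(subnSK ik) -natr1; ring.
rewrite ev -/B -/(t i) -/(t i.+1) in st.
rewrite -natr1 mulrDl mul1r [leRHS]addrC.
apply: (le_trans (ler_distD (t i) _ _)); apply: lerD => //.
by apply: IH; exact: ltnW.
Qed.

(** The order of the choices matters: the number k of blocks is fixed before the gap G, large enough
    for one block to be small; then G, since the mixing coefficient must be small compared with 1 /
    k; n is last and makes gaps and remainder negligible. *)
Lemma smooth_clt (e a eta : R) : 0 < e -> 0 < eta -> exists N : nat,
  forall n, (N <= n)%N ->
  `|Ex P (fun w => heatF (e ^+ 2) a (Tn X id n w / sigma n)) - heatF (e ^+ 2 + 1) a 0| <= eta.
Proof.
move=> e0 eta0; have [A A0 hA] := heat_bounds e0.
have hok s : e ^+ 2 <= s -> heat_ok A s a by move=> h; exact: hA.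
pose tu := eta / (16 * A); pose e1 := eta / (32 * A).
have tu0 : 0 < tu by rewrite divr_gt0// mulr_gt0.
have e10 : 0 < e1 by rewrite divr_gt0// mulr_gt0.
have [K [NK [K0 hUI]]] := UI e10.
(* The first summand controls the squares v^2, the second gives K [sigma m] <= tu [sigma n]. *)
pose ka := 32 * A / eta + 2 * (K / tu) ^+ 2 + 1.
have kA0 : 0 <= 32 * A / eta.
  by apply: divr_ge0; [apply: mulr_ge0; [exact: ler0n|exact: ltW]|exact: ltW].
have kK0 : 0 <= 2 * (K / tu) ^+ 2 by apply: mulr_ge0; [exact: ler0n|exact: sqr_ge0].
have ka0 : 0 <= ka by apply: addr_ge0; [exact: addr_ge0|exact: ler01].
pose k := (Num.bound ka).+1.
have kka : ka <= k%:R by rewrite ltW// (lt_le_trans (archi_boundP ka0))// ler_nat.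
have kR0 : 0 < k%:R :> R by rewrite ltr0n.
have k1 : 1 <= k%:R :> R by rewrite ler1n.
have kA : 32 * A / eta <= k%:R.
  by apply: le_trans kka; rewrite /ka -addrA lerDl; apply: addr_ge0; [|exact: ler01].
have kK : 2 * (K / tu) ^+ 2 <= k%:R.
  by apply: le_trans kka; rewrite /ka addrAC lerDr; apply: addr_ge0; [|exact: ler01].
pose ee := Num.min 8^-1 (eta / (14 * A)).
have ee0 : 0 < ee by rewrite lt_min invr_gt0 ltr0n/= divr_gt0// mulr_gt0.
have ee8 : ee <= 8^-1 by rewrite ge_min lexx.
have eeA : ee <= eta / (14 * A) by rewrite ge_min lexx orbT.
have d0 : 0 < 2 + tu ^+ 2 by rewrite ltr_wpDr ?sqr_ge0.
pose r := Num.min (ee / k%:R) (eta / (8 * A) / (k%:R * (2 + tu ^+ 2))).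
have r0 : 0 < r by rewrite lt_min !divr_gt0// mulr_gt0.
have rk : r * k%:R <= ee by rewrite -ler_pdivlMr// ge_min lexx.
have rkt : k%:R * r * (2 + tu ^+ 2) <= eta / (8 * A).
  rewrite mulrAC mulrC -ler_pdivlMr ?mulr_gt0//.
  by rewrite ge_min lexx orbT.
have [G hG] := rho0 r0.
(* A bound for the norm of k gaps of length G and of a remainder of fewer than k variables. *)
pose D := k%:R * (G%:R * sigma 1) + k%:R * sigma 1.
have D0 : 0 <= D by rewrite addr_ge0 ?mulr_ge0 ?n2_ge0.
have [N1 hN1] := sigmay (D / ee + 1).
exists (maxn N1 ((NK + G) * k)) => n; rewrite geq_max => /andP[nN1 nk].
(* A block and its gap have total length exactly the quotient of n by k, so that k of them leave
   fewer than k variables. *)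
pose L := (n %/ k)%N; pose m := (L - G)%N.
have LG : (NK + G <= L)%N by rewrite leq_divRL.
have mNK : (NK <= m)%N by rewrite /m leq_subRL ?(leq_trans _ LG) ?leq_addl// addnC.
have mG : (m + G = L)%N by rewrite subnK// (leq_trans _ LG)// leq_addl.
have hs := hN1 n nN1.
have De0 : 0 <= D / ee by rewrite divr_ge0// ltW.
have [sg sge] : exists sg, sg = sigma n by exists (sigma n).
rewrite -sge in hs *.
have sg0 : 0 < sg by apply: lt_le_trans hs; rewrite ltr_wpDl.
have Ds : D <= ee * sg.
  rewrite mulrC -ler_pdivrMr//; apply: le_trans hs; by rewrite lerDl.
pose W := S (block_times (m + G) m k).
have hW := block_sum_variance stationaryX X2 X0 m k hG (ltW r0).
have hD : norm2 P (fun w => Tn X id n w - W w) <= D.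
  have en : n = (k * (m + G) + n %% k)%N by rewrite mG mulnC -divn_eq.
  rewrite (@eq_n2 _ _ _ _ _ (fun w => (S (blk 1 (k * (m + G))) w - W w)
     + S (blk (1 + (k * (m + G))%N%:Z) (n %% k)) w)); last first.
    by move=> w; rewrite /Tn [in LHS]en Sx_blkD; ring.
  apply: (le_trans (n2D (sqintB (S2 _) (S2 _)) (S2 _))); apply: lerD.
    exact: gaps_norm_le.
  rewrite (blk_n2 stationaryX mid X2); apply: (le_trans (tau_mul stationaryX mid X2 _)).
  by rewrite ler_wpM2r ?n2_ge0// ler_nat ltnW// ltn_mod.
have sT : sqint P (Tn X id n) := S2 _.
have sW : sqint P W := S2 _.
have w1 : norm2 P W <= sg + D.
  rewrite (@eq_n2 _ _ _ _ _ (fun w => Tn X id n w - (Tn X id n w - W w))); last first.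
    by move=> w; ring.
  by apply: (le_trans (n2B sT (sqintB sT sW))); rewrite sge lerD.
have w2 : sg <= norm2 P W + D.
  rewrite sge /tau (@eq_n2 _ _ _ _ _ (fun w => W w + (Tn X id n w - W w))); last first.
    by move=> w; ring.
  by apply: (le_trans (n2D sW (sqintB sT sW))); rewrite lerD.
have [v vE] : exists v, v = sigma m ^+ 2 / sg ^+ 2 by exists (sigma m ^+ 2 / sg ^+ 2).
have v0 : 0 <= v by rewrite vE divr_ge0// sqr_ge0.
have hv := variance_ratio sg0 (n2_ge0 P W) kR0 (ltW r0) rk Ds D0 ee0 ee8 hW (sqr_ge0 _) w1 w2.
rewrite -vE in hv.
have hv2 := hv; rewrite ler_norml in hv2; have /andP[hv3 hv4] := hv2.
have kv2 : k%:R * v <= 2.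
  exact: block_variance_le2 hv4 ee8.
have hK : K * sigma m <= tu * sg.
  have k1' : 0 <= K * sigma m by apply: mulr_ge0; [exact: ltW|exact: n2_ge0].
  have k2' : 0 <= tu * sg by apply: mulr_ge0; exact: ltW.
  rewrite -(@ler_pXn2r _ 2%N) ?nnegrE//.
  have -> : (K * sigma m) ^+ 2 = K ^+ 2 * v * sg ^+ 2 by rewrite vE; field; rewrite gt_eqF.
  rewrite exprMn ler_wpM2r ?sqr_ge0//.
  have -> : K ^+ 2 = (K / tu) ^+ 2 * tu ^+ 2 by field; rewrite gt_eqF.
  rewrite mulrAC -[leRHS]mul1r ler_wpM2r ?sqr_ge0//.
  have : 2 * (K / tu) ^+ 2 * v <= 2 by apply: le_trans kv2; rewrite ler_wpM2r.
  by rewrite -mulrA ger_pMr.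
have tel := lindeberg_telescope k sg0 hG (ltW r0) tu0 hok (ltW A0) hK (hUI m mNK) vE.
have tot := block_error_sum (ltW A0) (ltW tu0) kR0 v0 (ltW e10) (ltW r0) kv2 k1.
have tet := block_error_le A0 kR0 erefl erefl rkt kA eta0.
have part1 := le_trans tel (le_trans tot tet).
have part2 := heat_time hok (ltW A0) (ltW ee0) ee8 (mulr_ge0 (ltW kR0) v0) hv.
have ee1 : ee <= 1 by apply: (le_trans ee8); rewrite invf_le1// ler1n.
have part3 := heat_shift sT sW (hok _ (lexx _)) sg0 ee0 ee1 (le_trans hD Ds).
have hAee : 7 * (A * ee) <= eta / 2.
  apply: (@le_trans _ _ (7 * (A * (eta / (14 * A))))).
    by rewrite ler_pM2l// ler_pM2l.
  by rewrite le_eqVlt; apply/orP; left; apply/eqP; field; rewrite gt_eqF.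
rewrite -mulrA in part2; exact: smooth_clt_triangle part3 part1 part2 hAee.
Qed.

End CLT.

(** * From smoothed to genuine distribution functions *)

Lemma prob_tails (d : measure_display) (T : measurableType d) (R : realType)
    (Q : probability T R) (Y : T -> R) (e : R) : measurable_fun setT Y -> 0 < e ->
  exists y : R, [/\ 0 < y, 1 - e <= fine (Q (Y @^-1` `]-oo, y])) &
    fine (Q (Y @^-1` `]-oo, (- y)])) <= e].
Proof.
move=> mY e0.
have mY' : Y \in mfun by rewrite inE.
pose X : {RV Q >-> R} := mfun_Sub mY'.
have hy : fine (cdf X x) @[x --> +oo] --> (1 : R) by apply: fine_cvg; exact: cvg_cdfy1.
have hN : fine (cdf X x) @[x --> -oo] --> (0 : R) by apply: fine_cvg; exact: cvg_cdfNy0.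
move/cvgrPdist_le : hy => /(_ _ e0) [u [ur hu]].
move/cvgrPdist_le : hN => /(_ _ e0) [v [vr hv]].
exists (`|u| + `|v| + 1).
have u1 : u < `|u| + `|v| + 1.
  by have := ler_norm u; have := normr_ge0 v; lra.
have v1 : - (`|u| + `|v| + 1) < v.
  by have := ler_norm (- v); rewrite normrN; have := normr_ge0 u; lra.
split; first by have := normr_ge0 u; have := normr_ge0 v; lra.
  have := hu _ u1; rewrite /= ler_norml; lra.
have := hv _ v1; rewrite /= ler_norml; lra.
Qed.

Section normal_cdf.
Context {R : realType}.

Lemma Phi_tails (e : R) : 0 < e -> exists y : R,
  [/\ 0 < y, 1 - e <= Phi y & Phi (- y) <= e].
Proof. exact: (prob_tails (normal_prob 0 1) (@measurable_id _ (measurableTypeR R) setT)). Qed.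

Lemma Phi_lip (x y : R) : `|Phi x - Phi y| <= 8 * `|x - y|.
Proof.
have [t _] := mvt_segment (@Phi_derive R) y (x - y).
rewrite [y + (x - y)]addrC subrK => ->; rewrite normrM ler_wpM2r//.
by rewrite ger0_norm ?phi_ge0// phi_le8.
Qed.

(** Smoothing at time e^2 gives the limit the variance e^2 + 1 instead of 1, and 1 - 1 / sqrt (e^2 +
    1) <= e^2. *)
Lemma Phi_shrink (x e : R) : `|Phi (x / Num.sqrt (e ^+ 2 + 1)) - Phi x| <= 8 * (`|x| * e ^+ 2).
Proof.
apply: (le_trans (Phi_lip _ _)); rewrite ler_pM2l//.
have e0 := sqr_ge0 e.
rewrite -[X in _ - X]mulr1 -mulrBr normrM ler_wpM2l//.
have s1 : 1 <= Num.sqrt (e ^+ 2 + 1) by rewrite -[leLHS]sqrtr1 ler_wsqrtr// lerDr.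
have s0 : 0 < Num.sqrt (e ^+ 2 + 1) by apply: lt_le_trans s1.
have i1 : (Num.sqrt (e ^+ 2 + 1))^-1 <= 1 by rewrite invf_le1.
rewrite distrC ger0_norm ?subr_ge0// lerBlDr -lerBlDl.
have h : Num.sqrt (e ^+ 2 + 1) <= e ^+ 2 + 1.
  rewrite -[leRHS](@sqr_sqrtr _ (e ^+ 2 + 1)); last by rewrite addr_ge0.
  by rewrite expr2 ler_peMl// ltW.
apply: (@le_trans _ _ ((e ^+ 2 + 1)^-1)); last by rewrite lef_pV2 ?posrE// ltr_wpDl.
have d0 : 0 < e ^+ 2 + 1 by rewrite ltr_wpDl.
rewrite -[leRHS]mul1r ler_pdivlMr// mulrDr mulr1 mulrBl mul1r.
have : 0 <= e ^+ 2 * e ^+ 2 by rewrite mulr_ge0.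
lra.
Qed.

Lemma Phi_approx (x a e eps : R) : 0 < eps -> 0 <= e -> e <= 1 -> `|a - x| <= 1 ->
  `|a - x| <= eps / 64 -> e <= eps / (64 * (`|x| + 1)) ->
  `|Phi (a / Num.sqrt (e ^+ 2 + 1)) - Phi x| <= eps / 4.
Proof.
move=> eps0 e0 e1 a1 a2 e2.
apply: (le_trans (ler_distD (Phi a) _ _)).
have h1 : `|a| * e ^+ 2 <= eps / 64.
  have x1 : 0 < `|x| + 1 by rewrite ltr_wpDl.
  apply: (@le_trans _ _ ((`|x| + 1) * (eps / (64 * (`|x| + 1))))); last first.
    by rewrite le_eqVlt; apply/orP; left; apply/eqP; field; rewrite gt_eqF.
  apply: ler_pM => //; first exact: sqr_ge0.
    rewrite (_ : a = x + (a - x)); last by rewrite addrC subrK.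
    by apply: (le_trans (ler_normD _ _)); rewrite lerD.
  by apply: le_trans e2; rewrite expr2 ler_piMl.
have := Phi_shrink a e; have := Phi_lip a x; lra.
Qed.

End normal_cdf.

Section smoothing.
Context (d : measure_display) (T : measurableType d) (R : realType)
  (P : probability T R).

(* The indicator of x' <= x lies between heatF (e^2) (x - del) x' - Phi (- del / e)
   and heatF (e^2) (x + del) x' + 1 - Phi (del / e). *)
Lemma smooth_cdf (Y : T -> R) (x e del y z : R) : measurable_fun setT Y ->
  0 < e -> y * e <= del -> 1 - z <= Phi y -> Phi (- y) <= z ->
  Ex P (fun w => heatF (e ^+ 2) (x - del) (Y w)) - z <= fine (P (Y @^-1` `]-oo, x])) /\
  fine (P (Y @^-1` `]-oo, x])) <= Ex P (fun w => heatF (e ^+ 2) (x + del) (Y w)) + z.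
Proof.
move=> mY e0 ye hy hNy.
have mA : measurable (Y @^-1` `]-oo, x]) by rewrite -[X in measurable X]setTI; exact: mY.
have iI : integr P (\1_(Y @^-1` `]-oo, x]) : T -> R).
  apply: (@integr_bnd _ _ _ P _ 1); first exact: measurable_indic.
  by move=> w; rewrite indicE; case: (_ \in _); rewrite ?normr1 ?normr0.
have iF a : integr P (fun w => heatF (e ^+ 2) a (Y w)).
  apply: (@integr_bnd _ _ _ P _ 1); last by move=> w; exact: heat_le1.
  exact: (measurableT_comp (@measurable_heat R _ a)).
have z0 : 0 <= z by apply: le_trans hNy; exact: Phi_ge0.
have se : Num.sqrt (e ^+ 2) = e by rewrite sqrtr_sqr gtr0_norm.
have iz : integr P (fun=> z) by exact: integr_cst.
have Ez f : integr P f -> Ex P f + z = Ex P (fun w => f w + z).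
  by move=> i; rewrite ExD// Ex_cst.
rewrite -(Ex_indic P mA) lerBlDr !Ez//.
have low a w : a - Y w <= - del -> heatF (e ^+ 2) a (Y w) <= z.
  move=> h; apply: le_trans hNy; apply: Phi_mono; rewrite se ler_pdivrMr//.
  by rewrite mulNr (le_trans h)// lerN2.
have high a w : del <= a - Y w -> 1 <= heatF (e ^+ 2) a (Y w) + z.
  move=> h; rewrite -lerBlDr (le_trans hy)//; apply: Phi_mono.
  by rewrite se ler_pdivlMr// (le_trans ye).
split; apply: Ex_le; try exact: iF; try exact: iI; try exact: (integrD iI iz);
  try exact: (integrD (iF _) iz).
  move=> w; rewrite indicE; have [|] := boolP (w \in _) => /=.
    by move=> _; rewrite ler_wpDr// Phi_le1.
  rewrite notin_setE /= in_itv /= => /negP; rewrite -ltNge => h; rewrite add0r low//.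
  by rewrite addrAC lerBlDr addNr subr_le0 ltW.
move=> w; rewrite indicE; have [|] := boolP (w \in _) => /=; last first.
  by move=> _; rewrite addr_ge0// Phi_ge0.
rewrite in_setE /= in_itv /= => h; apply: high.
by rewrite addrAC lerDr subr_ge0.
Qed.

(** Three parameters in this order: a Gaussian quantile y for the error eps / 4, a shift del of the
    threshold, and a smoothing e at most del / y. *)
Lemma cdf_of_smooth (Y : nat -> T -> R) :
  (forall n, measurable_fun setT (Y n)) ->
  (forall e a eta : R, 0 < e -> 0 < eta -> exists N : nat, forall n, (N <= n)%N ->
    `|Ex P (fun w => heatF (e ^+ 2) a (Y n w)) - heatF (e ^+ 2 + 1) a 0| <= eta) ->
  forall x eps : R, 0 < eps -> exists N : nat, forall n, (N <= n)%N ->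
    `|fine (P (Y n @^-1` `]-oo, x])) - Phi x| <= eps.
Proof.
move=> mY hs x eps eps0.
have e4 : 0 < eps / 4 by rewrite divr_gt0.
have [y [y0 hy hNy]] := Phi_tails e4.
pose del := Num.min 1 (eps / 64).
have del0 : 0 < del by rewrite lt_min ltr01 divr_gt0.
have x1 : 0 < `|x| + 1 by rewrite ltr_wpDl.
pose e := Num.min (Num.min 1 (del / y)) (eps / (64 * (`|x| + 1))).
have e0 : 0 < e by rewrite !lt_min ltr01 !divr_gt0// mulr_gt0.
have e1 : e <= 1 by rewrite !ge_min lexx.
have e2 : e <= eps / (64 * (`|x| + 1)) by rewrite ge_min lexx orbT.
have ye : y * e <= del by rewrite mulrC -ler_pdivlMr// !ge_min lexx orbT.
have [N1 h1] := hs e (x - del) _ e0 e4.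
have [N2 h2] := hs e (x + del) _ e0 e4.
have del1 : del <= 1 by rewrite ge_min lexx.
have del2 : del <= eps / 64 by rewrite ge_min lexx orbT.
have nd : `|del| = del by rewrite gtr0_norm.
have a1 : `|Phi ((x - del) / Num.sqrt (e ^+ 2 + 1)) - Phi x| <= eps / 4.
  by apply: Phi_approx => //; rewrite ?(ltW e0)// addrAC subrr add0r normrN nd.
have a2 : `|Phi ((x + del) / Num.sqrt (e ^+ 2 + 1)) - Phi x| <= eps / 4.
  by apply: Phi_approx => //; rewrite ?(ltW e0)// addrAC subrr add0r nd.
exists (maxn N1 N2) => n; rewrite geq_max => /andP[/h1 b1 /h2 b2].
have [c1 c2] := smooth_cdf x (mY n) e0 ye hy hNy.
move: b1 b2 a1 a2; rewrite /heatF !subr0 !ler_norml; clear -c1 c2.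
move: c1 c2; rewrite /heatF.
set u1 := Ex P _; set u2 := Ex P _; set u3 := fine _; set u4 := Phi _; set u5 := Phi _.
set u6 := Phi _; clearbody u1 u2 u3 u4 u5 u6.
lra.
Qed.

End smoothing.

(** * The two moment conditions *)

Section weighted_tail.
Context (d : measure_display) (T : measurableType d) (R : realType)
  (P : probability T R).

(** W a times the tail at a is at most the integral of Y^2 W(|Y|) over |Y| > N for a > N, which
    vanishes as N grows by dominated convergence. *)
Lemma weighted_tail (Y : T -> R) (W : R -> R) : sqint P Y ->
  (forall x, 0 <= x -> 0 <= W x) ->
  (forall x y, 0 <= x -> x <= y -> W x <= W y) ->
  integr P (fun w => Y w ^+ 2 * W `|Y w|) ->
  forall e : R, 0 < e -> exists2 A : R, 0 < A & forall a, A <= a ->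
    W a * Ex P (fun w => tl a (Y w)) <= e.
Proof.
move=> sY W0 Wm iW e e0; have mY := sqint_meas sY.
pose h (n : nat) w := if n%:R < `|Y w| then Y w ^+ 2 * W `|Y w| else 0.
have g0 w : 0 <= Y w ^+ 2 * W `|Y w| by rewrite mulr_ge0 ?sqr_ge0 ?W0.
have hb n w : `|h n w| <= Y w ^+ 2 * W `|Y w|.
  by rewrite /h; case: ifP => _; rewrite ?normr0// ger0_norm.
have mh n : measurable_fun setT (h n).
  apply: measurable_fun_ifT => //; last exact: integr_meas iW.
  by apply: measurable_fun_ltr => //; exact: measurableT_comp.
have ih n : integr P (h n) by exact: integr_le (mh n) iW (hb n).
have : (\int[P]_w (h n w)%:E)%E @[n --> \oo] --> (0 : \bar R)%E.
  rewrite -[X in _ --> X](integral0 P setT).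
  apply: (dominated_cvg _ (f_ := fun n w => (h n w)%:E) _ _ _ iW) => //.
  - by move=> n; exact/measurable_EFinP.
  - move=> w _; apply: cvg_near_cst; exists (Num.bound `|Y w|) => // n /= hn.
    rewrite /h ltNge (le_trans (ltW (archi_boundP (normr_ge0 _))))//.
    by rewrite ler_nat.
  - by move=> n w _; rewrite /= lee_fin hb.
move=> hc; have hc2 : Ex P (h n) @[n --> \oo] --> (0 : R) by exact: fine_cvg hc.
move/cvgrPdist_le : hc2 => /(_ _ e0) [N _ /(_ N (leqnn _))].
rewrite /= sub0r normrN => hN.
exists N.+1%:R => // a Na; rewrite -ExZ; last first.
  apply: (integr_le _ (sqint_sq sY)).
    by apply: (measurableT_comp (@measurable_tl R a)).
  by move=> w; rewrite ger0_norm ?tl_ge0// tl_le.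
apply: le_trans hN; apply: le_trans (ler_norm _).
have a0 : 0 <= a by apply: le_trans Na; rewrite ler0n.
have it : integr P (fun w => tl a (Y w)).
  apply: (integr_le _ (sqint_sq sY)).
    by apply: (measurableT_comp (@measurable_tl R a)).
  by move=> w; rewrite ger0_norm ?tl_ge0// tl_le.
apply: Ex_le => [||w]; [exact: integrZ|exact: ih|].
rewrite /tl /h; case: ifPn => [aY|_]; last by rewrite mulr0; case: ifP.
rewrite ifT; last by rewrite (lt_trans _ aY)// (lt_le_trans _ Na)// ltr_nat.
by rewrite mulrC ler_wpM2l ?sqr_ge0// Wm// ltW.
Qed.

End weighted_tail.

Section truncation_level.
Context {R : realType}.
Variables (u C1 : R).
Hypotheses (u0 : 0 < u) (u1 : u < 1).

(** The truncation level for [D J] = J^u / u. *)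
Definition level (J : nat) : R := 2 `^ (J%:R / 2) * expR (- (C1 * (J%:R `^ u / u))).

Lemma level_gt0 J : 0 < level J.
Proof. by rewrite mulr_gt0 ?powR_gt0 ?expR_gt0. Qed.

(** Twice the logarithm of the level is at least J minus this constant times J^u; the absolute value
    is there because the sign of C1 is not known. *)
Definition level_loss : R := `|2 * C1 / (u * ln 2)|.

Lemma log2_level J : J%:R - level_loss * J%:R `^ u <= 2 * log2 (level J).
Proof.
have l2 := @ln2_gt0 R.
rewrite /log2 /level lnM ?posrE ?powR_gt0 ?expR_gt0// ln_powR expRK.
have -> : 2 * ((J%:R / 2 * ln 2 + - (C1 * (J%:R `^ u / u))) / ln 2) =
  J%:R - 2 * C1 / (u * ln 2) * J%:R `^ u by field; rewrite !gt_eqF.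
by rewrite lerD2l lerN2 ler_wpM2r ?powR_ge0// ler_norm.
Qed.

Lemma level_loss_small : exists J1 : nat, forall J, (J1 <= J)%N ->
  level_loss * J%:R `^ u <= J%:R / 2.
Proof.
have [|//|//|j0 h] := @powRN_small R (level_loss + 1) (1 - u) 2^-1.
- by rewrite ltr_wpDl// /level_loss normr_ge0.
- by rewrite subr_gt0.
exists j0.+1 => -[//|J] jJ; have := h J jJ => hJ.
have J0 : 0 < J.+1%:R :> R by rewrite ltr0n.
have -> : J.+1%:R `^ u = J.+1%:R `^ (- (1 - u)) * J.+1%:R.
  rewrite -[X in _ * X](@powRr1 _ J.+1%:R)// -powRD; last by rewrite (gt_eqF J0) implybT.
  by congr (_ `^ _); ring.
rewrite mulrA [leRHS]mulrC ler_wpM2r ?ler0n//; apply: le_trans hJ.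
by rewrite ler_wpM2r ?powR_ge0// lerDl.
Qed.

Lemma level_large (A : R) : exists J1 : nat, forall J, (J1 <= J)%N -> A <= level J.
Proof.
have l2 := @ln2_gt0 R.
have [J1 h1] := level_loss_small.
exists (maxn J1 (Num.bound (4 * `|A| / ln 2))) => J; rewrite geq_max => /andP[/h1 h2 h3].
apply: (le_trans (ler_norm A)).
rewrite -[level J]lnK ?posrE ?level_gt0//.
apply: le_trans (expR_ge1Dx _).
apply: (@le_trans _ _ (ln (level J))); last by rewrite lerDr.
have h4 : 4 * `|A| / ln 2 <= J%:R.
  rewrite (le_trans (ltW (archi_boundP _))) ?ler_nat//.
  by rewrite divr_ge0 ?mulr_ge0// ltW.
rewrite ler_pdivrMr// in h4.
have := log2_level J; rewrite /log2 mulrA ler_pdivlMr// => h5.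
have h6 : (J%:R / 2) * ln 2 <= (J%:R - level_loss * J%:R `^ u) * ln 2.
  by rewrite ler_wpM2r ?(ltW l2)//; lra.
lra.
Qed.

Lemma logplus_level J : log2 (level J) <= logplus (level J).
Proof. by apply: log2_le; rewrite ?level_gt0// le_max lexx. Qed.

Lemma logplus_ge0 (x : R) : 0 <= logplus x.
Proof. by apply: divr_ge0; apply: ln_ge0; rewrite ?le_max ?lexx ?orbT ?ler1n. Qed.

Lemma logplus_le (x y : R) : x <= y -> logplus x <= logplus y.
Proof.
move=> xy; apply: log2_le; first by rewrite lt_max ltr01 orbT.
by rewrite ge_max !le_max xy lexx orbT.
Qed.

(** For 0 < t <= 1 and s <= 1 one has t^s >= t; this is applied to t = 1 - y / x. *)
Lemma powR_sub_le (x y s : R) : 0 < x -> 0 <= y -> y <= x -> 0 < s -> s <= 1 ->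
  x `^ s - y * x `^ (s - 1) <= (x - y) `^ s.
Proof.
move=> x0 y0 yx s0 s1.
have [->|yx'] := eqVneq y x.
  rewrite subrr powR0 ?gt_eqF//.
  rewrite -{2}(@powRr1 _ x) ?(ltW x0)// -powRD; last by rewrite (gt_eqF x0) implybT.
  by rewrite [1 + _]addrC subrK subrr.
have t0 : 0 < 1 - y / x <= 1.
  rewrite subr_gt0 ltr_pdivrMr// mul1r lt_neqAle yx' yx/=.
  by rewrite gerBl divr_ge0// ltW.
have [t1 t2] := andP t0.
have -> : x - y = x * (1 - y / x) by field; rewrite gt_eqF.
rewrite powRM ?(ltW x0) ?(ltW t1)//.
have -> : y * x `^ (s - 1) = x `^ s * (y / x).
  have -> : x `^ s = x `^ (s - 1) * x.
    rewrite -[X in _ * X](@powRr1 _ x) ?(ltW x0)// -powRD; last by rewrite (gt_eqF x0) implybT.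
    by rewrite subrK.
  by field; rewrite gt_eqF.
rewrite -{1}[x `^ s]mulr1 -mulrBr ler_wpM2l ?powR_ge0//.
by rewrite -[leLHS]powRr1 ?(ltW t1)//; exact: ger_powR.
Qed.

(** Eventually J is at most four times the logarithm of the level, and under a power a constant
    factor is harmless. *)
Lemma weight_log (alpha : R) : 0 < alpha -> exists J1 : nat, forall J, (J1 <= J)%N ->
  expR (2 * (alpha * ln J%:R)) <= 4 `^ (2 * alpha) * logplus (level J) `^ (2 * alpha).
Proof.
move=> a0; have [J1 h1] := level_loss_small.
exists J1.+1 => -[//|J] /ltnW/h1 h2.
have aa : 0 <= 2 * alpha by rewrite mulr_ge0// ltW.
have -> : expR (2 * (alpha * ln J.+1%:R)) = J.+1%:R `^ (2 * alpha).
  by rewrite /powR gt_eqF// mulrA.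
have l0 := logplus_ge0 (level J.+1).
have l4 : 0 <= 4 * logplus (level J.+1) by apply: mulr_ge0.
rewrite -powRM//; apply: ge0_ler_powR => //; rewrite ?nnegrE//.
have := log2_level J.+1; have := logplus_level J.+1; lra.
Qed.

(** In an exponent an additive error is harmless, but a factor is not. The loss is at most a
    constant times J^(u + s - 1), bounded exactly when s <= 1 - u. *)
Lemma weight_exp (alpha s : R) : 0 < alpha -> 0 < s -> s <= 1 - u ->
  exists (k : R) (J1 : nat), forall J, (J1 <= J)%N ->
  expR (2 * (alpha * (J%:R `^ s / s))) <=
  k * expR (2 * alpha * (2 * logplus (level J)) `^ s / s).
Proof.
move=> a0 s0 su; have [J1 h1] := level_loss_small.
have C0 : 0 <= level_loss by rewrite /level_loss normr_ge0.
exists (expR (2 * alpha * level_loss / s)), J1.+1 => -[//|J] /ltnW/h1 h2.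
rewrite -expRD ler_expR -!mulrA -mulrDr ler_pM2l// -mulrDr ler_pM2l// -mulrDl.
rewrite ler_pM2r ?invr_gt0//.
have J0 : 0 < J.+1%:R :> R by rewrite ltr0n.
have J1' : 1 <= J.+1%:R :> R by rewrite ler1n.
have s1 : s <= 1 by move: su u0; lra.
have yx : level_loss * J.+1%:R `^ u <= J.+1%:R by move: h2 J0; lra.
have y0 : 0 <= level_loss * J.+1%:R `^ u by rewrite mulr_ge0 ?powR_ge0.
have h3 := powR_sub_le J0 y0 yx s0 s1.
have h4 : level_loss * J.+1%:R `^ u * J.+1%:R `^ (s - 1) <= level_loss.
  rewrite -mulrA ler_piMr// -powRD; last by rewrite (gt_eqF J0) implybT.
  by rewrite -[leRHS](powRr0 J.+1%:R) ler_powR//; move: su; lra.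
have h5 : (J.+1%:R - level_loss * J.+1%:R `^ u) `^ s <= (2 * logplus (level J.+1)) `^ s.
  have l2 : 0 <= 2 * logplus (level J.+1) by apply: mulr_ge0 => //; exact: logplus_ge0.
  apply: ge0_ler_powR; rewrite ?nnegrE ?subr_ge0// ?(ltW s0)//.
  by apply: (le_trans (log2_level _)); rewrite ler_pM2l// logplus_level.
move: h3 h4 h5; clear; lra.
Qed.

End truncation_level.

(** * The theorem under both moment conditions *)

Section conclusion.
Context (d : measure_display) (T : measurableType d) (R : realType)
  (P : probability T R) (X : int -> {RV P >-> R}).
Hypothesis stationaryX : strictly_stationary P X.
Hypothesis meanX : ('E_P[X 0] = 0)%E.
Hypothesis momentX : ('E_P[(fun w => X 0 w ^+ 2)%R] < +oo)%E.
Hypothesis sigmaX : sigma_n P X n @[n --> \oo] --> +oo.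
Hypothesis rhoX : rho P X n @[n --> \oo] --> 0%E.

Lemma integr_expectation (f : T -> R) : measurable_fun setT f ->
  (forall w, 0 <= f w) -> ('E_P[f] < +oo)%E -> integr P f.
Proof.
move=> mf f0; rewrite unlock => h; apply/integrableP; split.
  exact/measurable_EFinP.
rewrite (eq_integral (fun w => (f w)%:E)) // => w _ /=.
by rewrite ger0_norm.
Qed.

Let X2 : sqint P (X 0).
Proof.
split=> //; apply: integr_expectation => // [|w]; last exact: sqr_ge0.
exact: measurable_funX.
Qed.

Let X0 : Ex P (X 0) = 0.
Proof. by rewrite /Ex /Rintegral; move: meanX; rewrite unlock => ->. Qed.

Let mid := @measurable_id _ (measurableTypeR R) setT.

Let sigmaE n : sigma_n P X n = tau X id n.
Proof.
rewrite /sigma_n partial_sumE stddev_n2//.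
  exact: (Sx_sqint stationaryX mid X2).
exact: (Sx_mean stationaryX mid X2 X0).
Qed.

Let sigmay (A : R) : exists N : nat, forall n, (N <= n)%N -> A <= tau X id n.
Proof.
move/cvgryPge : sigmaX => /(_ A) [N _ h]; exists N => n /h /=.
by rewrite sigmaE.
Qed.

Let rho0 (e : R) : 0 < e -> exists N : nat, (rho P X N <= e%:E)%E.
Proof.
move=> e0; have [[N1 _ h1] h2] := (fine_cvgP _ _).1 rhoX.
move/cvgrPdist_le : h2 => /(_ _ e0) [N2 _ h2].
have h3 : `|0 - fine (rho P X (maxn N1 N2))| <= e := h2 _ (leq_maxr _ _).
exists (maxn N1 N2); rewrite -(fineK (h1 _ (leq_maxl _ _))) lee_fin.
by apply: le_trans h3; rewrite sub0r normrN ler_norm.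
Qed.

(** Common to both cases: [Lam], half the order of the moments p and the constants relating [Lam] to
    [D] stay free, while [D j] is j^u / u with u = 1 - beta / p. *)
Lemma clt_of_tail (alpha beta p KL KL0 : R) (N0 : nat) (Lam : nat -> R) :
  1 < p -> p <= 3 / 2 -> 0 < alpha -> 2^-1 < beta -> beta <= 1 ->
  (forall n, (N0 <= n)%N ->
    (rho P X n <= (alpha * (log2 n%:R) `^ (- beta))%:E)%E) ->
  (forall j, (1 <= j)%N -> 0 <= Lam j) ->
  (forall j, (1 <= j)%N -> alpha * j.+1%:R `^ (- beta) <= Lam j.+1 - Lam j) ->
  (forall j, (1 <= j)%N ->
    Lam j <= KL * (j%:R `^ (1 - p^-1 * beta) / (1 - p^-1 * beta)) + KL0) ->
  (forall C1 e : R, 0 < e -> exists J1 : nat, forall J, (J1 <= J)%N ->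
    expR (2 * Lam J) * tail X (level (1 - p^-1 * beta) C1 J) <= e) ->
  cvg_in_distribution P (fun n => normalized_sum P X n) (normal_prob 0 1).
Proof.
move=> p1 p3 a0 b2 b1 hrho Lam0 LamS LamD tail_cvg x _.
have b0 : 0 < beta by apply: lt_trans b2; rewrite invr_gt0.
have p0 : 0 < p by apply: lt_trans p1.
have pi0 : 0 < p^-1 by rewrite invr_gt0.
have pi1 : p^-1 < 1 by rewrite invf_lt1.
have pb0 : 0 < p^-1 * beta by rewrite mulr_gt0.
have pb1 : p^-1 * beta < 1 by apply: le_lt_trans pi1; rewrite ler_piMr// ltW.
have [u uE] : exists u, u = 1 - p^-1 * beta by exists (1 - p^-1 * beta).
rewrite -uE in LamD tail_cvg.
have u0 : 0 < u by rewrite uE subr_gt0.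
have u1 : u < 1 by rewrite uE ltrBlDr ltrDl.
have D0 (j : nat) : (1 <= j)%N -> 0 <= j%:R `^ u / u.
  by move=> _; rewrite divr_ge0 ?powR_ge0// ltW.
have DS (j : nat) : (1 <= j)%N -> j.+1%:R `^ (- (p^-1 * beta)) <=
    j.+1%:R `^ u / u - j%:R `^ u / u.
  move=> j1; rewrite -mulrBl ler_pdivlMr// mulrC.
  have := @powR_increment R j.+1%:R u; rewrite ler1n => /(_ isT u0 u1).
  by rewrite -[X in (X - 1) `^ _]natr1 addrK uE [1 - _ - 1]addrAC subrr add0r.
have q2 : 2 < 2 * p by lra.
have q3 : 2 * p <= 3 by lra.
have UI := unif_integrable stationaryX X2 X0 rho0 sigmay
  q2 q3 erefl a0 b2 b1 hrho Lam0 LamS D0 DS LamD tail_cvg.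
have sm := smooth_clt stationaryX X2 X0 rho0 sigmay UI.
have lim := @cdf_of_smooth _ _ _ P (fun n w => Tn X id n w / tau X id n) _ _ x.
have Yn n : normalized_sum P X n = (fun w => Tn X id n w / tau X id n).
  by apply/funext => w; rewrite /normalized_sum partial_sumE sigmaE.
have mY n : measurable_fun setT (normalized_sum P X n) := measurable_normalized_sum X n.
have E n : @cdf _ _ _ P (normalized_sum P X n) x =
    (fine (P (normalized_sum P X n @^-1` `]-oo, x]%classic)))%:E.
  rewrite fineK; first by [].
  by apply: fin_num_measure; rewrite -[X in measurable X]setTI; exact: mY.
rewrite -PhiE; apply: cvg_EFin; first by apply: nearW => n; rewrite E.
apply/cvgrPdist_le => e e0; have [|n' a' eta e'0 eta0|N hN] := lim _ _ e e0.
- by move=> n; rewrite -Yn; exact: mY.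
- exact: sm.
exists N => // n /hN /=; rewrite distrC E /= -Yn; exact.
Qed.

(** The level tends to infinity, so [weighted_tail] applies along it; it remains to dominate exp (L
    J) by a multiple of the weight at the level. *)
Lemma tail_of_weight (u : R) (W : R -> R) (L : nat -> R) : 0 < u -> u < 1 ->
  (forall x, 0 <= x -> 0 <= W x) ->
  (forall x y, 0 <= x -> x <= y -> W x <= W y) ->
  (forall C1 : R, exists (k : R) (J1 : nat), forall J, (J1 <= J)%N ->
    expR (L J) <= k * W (level u C1 J)) ->
  measurable_fun setT W ->
  ('E_P[(fun w => X 0 w ^+ 2 * W `|X 0 w|)%R] < +oo)%E ->
  forall C1 e : R, 0 < e -> exists J1 : nat, forall J, (J1 <= J)%N ->
    expR (L J) * tail X (level u C1 J) <= e.
Proof.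
move=> u0 u1 W0 Wm hL mW hW C1 e e0.
have iW : integr P (fun w => X 0 w ^+ 2 * W `|X 0 w|).
  apply: integr_expectation => // [|w]; last by rewrite mulr_ge0 ?sqr_ge0 ?W0.
  apply: measurable_funM; first exact: measurable_funX.
  by apply: (measurableT_comp mW); exact: measurableT_comp.
have [k [J1 h1]] := hL C1.
have k0 : 0 < `|k| + 1 by rewrite ltr_wpDl.
have [A A0 hA] := weighted_tail X2 W0 Wm iW (divr_gt0 e0 k0).
have [J2 h2] := level_large C1 u0 u1 A.
exists (maxn J1 J2) => J; rewrite geq_max => /andP[/h1 h3 /h2/hA h4].
have t0 : 0 <= tail X (level u C1 J) by apply: Ex_ge0 => w; exact: tl_ge0.
apply: (le_trans (ler_wpM2r t0 h3)).
rewrite -mulrA; apply: (@le_trans _ _ ((`|k| + 1) * (e / (`|k| + 1)))); last first.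
  by rewrite mulrC divfK// gt_eqF.
apply: (@le_trans _ _ ((`|k| + 1) * (W (level u C1 J) * tail X (level u C1 J)))).
  apply: ler_wpM2r; first by rewrite mulr_ge0// W0// ltW// level_gt0.
  by rewrite (le_trans (ler_norm k))// lerDl.
by rewrite ler_pM2l.
Qed.

End conclusion.

Theorem corollary2p3 (d : measure_display) (T : measurableType d)
    (R : realType) (P : probability T R) (X : int -> {RV P >-> R})
    (alpha beta : R)
    (stationaryX : strictly_stationary P X)
    (meanX : 'E_P[(X 0)%R]%E = 0%E)
    (momentX : ('E_P[(fun w => X 0 w ^+ 2)%R] < +oo)%E)
    (sigmaX : sigma_n P X n @[n --> \oo] --> +oo)
    (rhoX : rho P X n @[n --> \oo] --> 0%E)
    (alpha_gt0 : 0 < alpha)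
    (beta_gt : 2^-1 < beta) (beta_lt1 : beta < 1)
    (mixing :
      (('E_P[(fun w =>
           X 0 w ^+ 2 * logplus `|X 0 w| `^ (2 * alpha))%R] < +oo)%E
       /\ \forall n \near \oo,
            (rho P X n <= (alpha * (log2 n%:R)^-1)%:E)%E)
      \/
      (('E_P[(fun w => X 0 w ^+ 2 *
           expR (2 * alpha * (2 * logplus `|X 0 w|) `^ (1 - beta)
                 / (1 - beta)))%R] < +oo)%E
       /\ \forall n \near \oo,
            (rho P X n <= (alpha * (log2 n%:R) `^ (- beta))%:E)%E)) :
  cvg_in_distribution P (fun n => normalized_sum P X n) (normal_prob 0 1).
Proof.
have mlog : measurable_fun setT (fun x : R => logplus x).
  apply: measurable_funM => //; apply: measurableT_comp => //.
  exact: measurable_maxr.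
have aa : 0 < 2 * alpha by rewrite mulr_gt0.
have lp0 := @logplus_ge0 R.
case: mixing => -[hW [N0 _ hrho]].
  (* Case (a) is beta = 1 with Lam j = alpha ln j; any p in (1, 3/2] would do, and p = 3/2, that is
     q = 3, gives u = 1/3. *)
  have u13 : 1 - (3 / 2)^-1 * 1 = 3^-1 :> R by field.
  have u0 : (0 : R) < 3^-1 by rewrite invr_gt0.
  have u1 : (3^-1 : R) < 1 by rewrite invf_lt1// ltr1n.
  have hT := tail_of_weight momentX u0 u1
    (W := fun x => logplus x `^ (2 * alpha)) (L := fun j => 2 * (alpha * ln j%:R)).
  apply: (@clt_of_tail _ _ _ P X stationaryX meanX momentX sigmaX rhoX
    alpha 1 (3 / 2) alpha 0 (maxn N0 1) (fun j => alpha * ln j%:R)) => //.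
  - lra.
  - by rewrite invf_lt1// ltr1n.
  - move=> n; rewrite geq_max => /andP[/hrho /= h n1].
    by rewrite powR_inv1// divr_ge0// ln_ge0// ler1n.
  - by move=> j j1; rewrite mulr_ge0 ?ln_ge0 ?ler1n// ltW.
  - move=> j j1; rewrite powR_inv1 ?ler0n// -mulrBr ler_pM2l//.
    have := @ln_increment R j.+1%:R; rewrite ltr1n ltnS j1 => /(_ isT).
    by rewrite -[X in ln (X - 1)]natr1 addrK.
  - move=> j j1; rewrite u13 addr0 ler_pM2l// ler_pdivlMr// mulrC -ln_powR.
    apply: (le_trans (@ln_le_sub1 R _ _)); first by rewrite powR_gt0// ltr0n.
    by rewrite gerBl.
  - move=> C1 e e0; rewrite u13; apply: hT => //.
    + by move=> x _; exact: powR_ge0.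
    + by move=> x y x0 xy; apply: ge0_ler_powR; rewrite ?nnegrE ?lp0 ?(ltW aa)// logplus_le.
    + move=> C2; have [J1 h] := weight_log C2 u0 u1 alpha_gt0.
      by exists (4 `^ (2 * alpha)), J1.
    + exact: (measurableT_comp (@measurable_powR R _)).
have b0 : 0 < beta by apply: lt_trans beta_gt; rewrite invr_gt0.
(* theta = 1/p: the bound 2/3 means q <= 3, and 1/beta - 1 is the least value for which the loss in
   the truncation level does not disturb the weight. Both are below 1, the latter since beta >
   1/2. *)
pose th : R := Num.max (2 / 3) (beta^-1 - 1).
have th0 : 0 < th by rewrite lt_max divr_gt0.
have th1 : th < 1.
  rewrite gt_max; apply/andP; split; first by rewrite ltr_pdivrMr// mul1r ltr_nat.
  by rewrite ltrBlDr -[1 + 1]invrK ltf_pV2 ?posrE ?invr_gt0//.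
have thb : beta * (1 + th) >= 1.
  rewrite -ler_pdivrMl// mulr1 -lerBlDl le_max lexx orbT//.
have tb : th * beta < 1 by apply: lt_trans th1; rewrite gtr_pMr.
have [s sE] : exists s, s = 1 - beta by exists (1 - beta).
have [u uE] : exists u, u = 1 - th * beta by exists (1 - th * beta).
have s0 : 0 < s by rewrite sE subr_gt0.
have s1 : s < 1 by rewrite sE ltrBlDr ltrDl.
have u0 : 0 < u by rewrite uE subr_gt0.
have u1 : u < 1 by rewrite uE ltrBlDr ltrDl mulr_gt0.
have su : s <= 1 - u by rewrite sE uE; move: thb; lra.
have su' : s <= u by rewrite sE uE lerD2l lerN2 ger_pMl// ltW.
rewrite -sE in hW.
pose W x := expR (2 * alpha * (2 * logplus x) `^ s / s).
have W0 x : 0 <= x -> 0 <= W x by move=> _; exact: expR_ge0.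
have Wm x y : 0 <= x -> x <= y -> W x <= W y.
  move=> x0 xy; rewrite ler_expR ler_pM2r ?invr_gt0// ler_pM2l//.
  have l2 z : 0 <= 2 * logplus z :> R by apply: mulr_ge0.
  by apply: ge0_ler_powR; rewrite ?nnegrE ?(ltW s0)// ler_pM2l// logplus_le.
have mW : measurable_fun setT W.
  apply: measurableT_comp => //; apply: measurable_funM => //.
  apply: measurable_funM => //.
  apply: (measurableT_comp (@measurable_powR R _)).
  exact: measurable_funM.
have hT := tail_of_weight momentX u0 u1 W0 Wm
  (fun C1 => weight_exp C1 u0 u1 alpha_gt0 s0 su) mW hW.
(* alpha j^s / s is at most (alpha u / s) (j^u / u), since s <= u; this gives the constant relating
   [Lam] to [D]. *)
apply: (@clt_of_tail _ _ _ P X stationaryX meanX momentX sigmaX rhoX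
  alpha beta th^-1 (alpha / s * u) 0 N0 (fun j => alpha * (j%:R `^ s / s))) => //.
- by rewrite invf_gt1.
- rewrite -[leRHS]invrK lef_pV2 ?posrE ?invr_gt0 ?divr_gt0//.
  by rewrite invf_div le_max lexx.
- exact: ltW.
- by move=> j j1; rewrite mulr_ge0 ?divr_ge0 ?powR_ge0// ltW.
- move=> j j1; rewrite -mulrBr ler_pM2l// -mulrBl ler_pdivlMr// mulrC.
  have := @powR_increment R j.+1%:R s; rewrite ler1n => /(_ isT s0 s1).
  by rewrite -[X in (X - 1) `^ _]natr1 addrK sE [1 - _ - 1]addrAC subrr add0r.
- move=> j j1; rewrite invrK addr0 -uE.
  have -> : alpha / s * u * (j%:R `^ u / u) = alpha * (j%:R `^ u / s).
    by field; rewrite !gt_eqF.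
  by rewrite ler_pM2l// ler_pM2r ?invr_gt0// ler_powR// ler1n.
- by rewrite invrK -uE.
Qed.
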